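(* Suppose that the following four assumptions hold. (1) There exists a constant $0<F_{\max}<\infty$ such that $|f_d(\theta)|\le F_{\max}$ for any $d\in D$ and any $\theta$. (2) There exists a constant $c_0>0$ such that for all $0<r<1$, $$\mathbb{P}_Y\Big[\min_{y\in K}\|Y-y\|\le r\Big]\le c_0 r.$$ (3) There exist constants $c_1,c_2>0$ such that if $Y\notin K$, then $$\max_{d\in D}G_d(Y)-\max_{\substack{d\in D\\ d\ne d_{\mathrm{opt}}(Y)}}G_d(Y)>\min\Big(c_1,\;c_2\min_{y\in K}\|Y-y\|\Big).$$ (4) There exists a constant $p\ge 2$ such that $$\mathbb{E}_Y\left[\mathbb{E}_\theta\left[\left(\frac{\rho(Y\,|\,\theta)}{\rho(Y)}\right)^p\right]\right]<\infty.$$ Then there exists a constant $c>0$ such that for any $0<\varepsilon<e^{-1}$ there are $L\in\mathbb{Z}_{\ge0}$ and $N_0,\dots,N_L\in\mathbb{Z}_{>0}$ for which the antithetic multilevel Monte Carlo estimator $Z_{\mathrm{MLMC}}=\sum_{\ell=0}^{L}\frac1{N_\ell}\sum_{n=1}^{N_\ell}\Delta P_\ell^{(n)}$ satisfies $$\mathbb{E}\big[(Z_{\mathrm{MLMC}}-(\mathrm{EVPI}-\mathrm{EVSI}))^2\big]\le\varepsilon^2$$ with total computational cost $\sum_{\ell=0}^{L}2^{\ell}N_\ell$ bounded by $c\,\varepsilon^{-2}$ if $p>2$, and by $c\,\varepsilon^{-2}(\log\varepsilon^{-1})^2$ if $p=2$.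
   Context: Setting. $\theta$ is a random vector with (prior) probability density $\pi_0$; $\mathbb{E}_\theta$ denotes expectation with respect to $\pi_0$. $D$ is a finite set of decisions, and for each $d\in D$, $f_d$ is a real-valued function of $\theta$. The random vector $Y$ is generated by $Y=h(\theta)+\epsilon$, where $h$ is a known deterministic (possibly vector-valued) function and $\epsilon$ is a zero-mean random noise variable with density $\rho$, independent of $\theta$; thus the conditional density (likelihood) of $Y$ given $\theta$ is $\rho(Y\,|\,\theta):=\rho(Y-h(\theta))$. $\mathbb{E}_Y$ and $\mathbb{P}_Y$ refer to the marginal distribution of $Y$, whose density is $\rho(Y):=\mathbb{E}_\theta[\rho(Y\,|\,\theta)]$. In an expression such as $\mathbb{E}_Y[\mathbb{E}_\theta[\cdot]]$ the inner expectation is over the prior of $\theta$ with $Y$ held fixed (i.e. $\theta$ is drawn from the prior independently of $Y$). $\mathbb{E}_{\theta|Y}$ denotes expectation with respect to the posterior density $\pi^Y(\theta)=\rho(Y\,|\,\theta)\pi_0(\theta)/\rho(Y)$. The expected value of perfect information and of sample information are $$\mathrm{EVPI}=\mathbb{E}_\theta\Big[\max_{d\in D}f_d(\theta)\Big]-\max_{d\in D}\mathbb{E}_\theta[f_d(\theta)],\qquad \mathrm{EVSI}=\mathbb{E}_Y\Big[\max_{d\in D}\mathbb{E}_{\theta|Y}[f_d(\theta)]\Big]-\max_{d\in D}\mathbb{E}_\theta[f_d(\theta)].$$ Put $F_d(Y):=\mathbb{E}_\theta[f_d(\theta)\rho(Y\,|\,\theta)]$ and $G_d(Y):=F_d(Y)/\rho(Y)=\mathbb{E}_{\theta|Y}[f_d(\theta)]$,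 and $d_{\mathrm{opt}}(Y):=\arg\max_{d\in D}F_d(Y)=\arg\max_{d\in D}G_d(Y)$. $K$ denotes the set of values of $Y$ at which $d_{\mathrm{opt}}$ is not uniquely defined (the decision manifold); it is assumed to be a lower-dimensional subspace of the domain for $Y$. $\|\cdot\|$ is the norm on the space of $Y$. Correction variables. Fix $M_0\in\mathbb{Z}_{>0}$ and set $M_\ell=M_02^\ell$. For $\ell\ge 0$, draw $Y$ from its marginal distribution and, independently of $Y$, i.i.d. samples $\theta^{(1)},\dots,\theta^{(M_\ell)}$ from $\pi_0$. For a function $\varphi$ of $\theta$ write $\overline{\varphi}=\frac1{M_\ell}\sum_{m=1}^{M_\ell}\varphi(\theta^{(m)})$, and for $\ell\ge1$ let $\overline{\varphi}^{(a)}$ and $\overline{\varphi}^{(b)}$ be the averages of $\varphi$ over the first $M_{\ell-1}$ samples and over the remaining $M_{\ell-1}$ samples, respectively. Define $$\overline{g_d}=\frac{\overline{f_d(\cdot)\rho(Y\,|\,\cdot)}}{\overline{\rho(Y\,|\,\cdot)}},\qquad \overline{g}_{\max}=\frac{\overline{\max_{d\in D}f_d(\cdot)\,\rho(Y\,|\,\cdot)}}{\overline{\rho(Y\,|\,\cdot)}},$$ and define $\overline{g_d}^{(a)},\overline{g}_{\max}^{(a)}$ (resp. $\overline{g_d}^{(b)},\overline{g}_{\max}^{(b)}$) by the same ratios with all averages replaced by the $(a)$ (resp. $(b)$) averages. Ratios are read with the convention $0/0=0$. Set $\Delta P_0=\overline{g}_{\max}-\max_{d\in D}\overline{g_d}$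 (with $\ell=0$), and for $\ell\ge1$ $$\Delta P_\ell=\overline{g}_{\max}-\max_{d\in D}\overline{g_d}-\frac12\left[\overline{g}_{\max}^{(a)}+\overline{g}_{\max}^{(b)}\right]+\frac12\left[\max_{d\in D}\overline{g_d}^{(a)}+\max_{d\in D}\overline{g_d}^{(b)}\right].$$ In $Z_{\mathrm{MLMC}}$, the variables $\Delta P_\ell^{(1)},\dots,\Delta P_\ell^{(N_\ell)}$ are i.i.d. copies of $\Delta P_\ell$, and the samples at different levels are independent. Each evaluation of $f_d(\theta)$, $\rho(Y\,|\,\theta)$ and $h(\theta)$ has unit cost, so one sample of $\Delta P_\ell$ costs a constant multiple of $2^\ell$; the total cost is measured by $\sum_{\ell=0}^L2^\ell N_\ell$. *)

(* Defs.v *)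
From HB Require Import structures.
From mathcomp Require Import all_boot all_order all_algebra.
From mathcomp Require Import all_classical all_reals all_analysis.

Set Implicit Arguments.
Unset Strict Implicit.
Unset Printing Implicit Defensive.

Import Order.TTheory GRing.Theory Num.Theory.
Import numFieldNormedType.Exports.

Local Open Scope classical_set_scope.
Local Open Scope ring_scope.

(* The sigma-algebra of R^n = 'rV[R]_n generated by the coordinates; for a
   realType this is the Borel sigma-algebra. *)
Definition rV_display : measure_display -> measure_display.
Proof. exact. Qed.

Section measurable_rV.
Context {d : measure_display} {T : measurableType d}.
Variable n : nat.

Definition rV_coord (i : 'I_n) (x : 'rV[T]_n) : T := x 0 i.

Let rV_set0 : g_sigma_preimage rV_coord set0.
Proof. exact: sigma_algebra0. Qed.

Let rV_setC A : g_sigma_preimage rV_coord A -> g_sigma_preimage rV_coord (~` A).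
Proof. exact: sigma_algebraC. Qed.

Let rV_bigcup (F : (set 'rV[T]_n)^nat) :
  (forall i, g_sigma_preimage rV_coord (F i)) ->
  g_sigma_preimage rV_coord (\bigcup_i (F i)).
Proof. exact: sigma_algebra_bigcup. Qed.

HB.instance Definition _ := @isMeasurable.Build (rV_display d)
  'rV[T]_n (g_sigma_preimage rV_coord) rV_set0 rV_setC rV_bigcup.

End measurable_rV.

Section rV_measurability.
Context {d d' : measure_display} {S : measurableType d} {T : measurableType d'}.

Lemma measurable_rV_coord n (i : 'I_n) :
  measurable_fun [set: 'rV[T]_n] (fun x : 'rV[T]_n => x 0 i).
Proof.
move=> _ Y mY; rewrite setTI; apply: sub_sigma_algebra => /=.
rewrite -bigcup_seq/=; exists i => /=; first by rewrite mem_index_enum.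
by exists Y => //; rewrite setTI.
Qed.

Lemma measurable_fun_rV n (f : S -> 'rV[T]_n) :
  (forall i, measurable_fun [set: S] (fun x => f x 0 i)) ->
  measurable_fun [set: S] f.
Proof.
move=> mf _ A mA; rewrite setTI.
have sub : g_sigma_preimage (@rV_coord _ T n) `<=`
    image_set_system [set: S] f measurable.
  apply: smallest_sub.
    exact/sigma_algebra_image/sigma_algebra_measurable.
  rewrite -bigcup_seq/=; apply: bigcup_sub => i _ _ [B mB <-].
  rewrite /image_set_system /= !setTI.
  by have := mf i measurableT B mB; rewrite setTI.
by have := sub _ mA; rewrite /image_set_system /= setTI.
Qed.

End rV_measurability.

Section lebesgue_rV.
Context {R : realType}.

Definition rV_cons n (p : measurableTypeR R * 'rV[R]_n) : 'rV[R]_n.+1 := row_mx (p.1 : R)%:M p.2.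

Definition rV_uncons n (v : 'rV[R]_n.+1) : measurableTypeR R * 'rV[R]_n :=
  (v 0 0, \row_(j < n) v 0 (lift ord0 j)).

Lemma rV_cons0 n (p : measurableTypeR R * 'rV[R]_n) : rV_cons p 0 0 = p.1.
Proof.
have -> : rV_cons p 0 0 = row_mx (p.1 : R)%:M p.2 0 (lshift n (0 : 'I_1)).
  by congr fun_of_matrix; exact/val_inj.
by rewrite row_mxEl mxE eqxx mulr1n.
Qed.

Lemma rV_consS n (p : measurableTypeR R * 'rV[R]_n) i : rV_cons p 0 (lift ord0 i) = p.2 0 i.
Proof.
have -> : rV_cons p 0 (lift ord0 i) = row_mx (p.1 : R)%:M p.2 0 (rshift 1 i).
  by congr fun_of_matrix; exact/val_inj.
by rewrite row_mxEr.
Qed.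

Lemma rV_consK n : cancel (@rV_cons n) (@rV_uncons n).
Proof.
move=> [x v]; rewrite /rV_uncons rV_cons0; congr pair.
by apply/rowP => j; rewrite mxE rV_consS.
Qed.

Lemma rV_cons_preimage n (A : set (measurableTypeR R * 'rV[R]_n)) :
  @rV_cons n @^-1` (@rV_uncons n @^-1` A) = A.
Proof.
rewrite -comp_preimage (_ : _ \o _ = id) ?preimage_id//.
by apply/funext => p; exact: rV_consK.
Qed.

Lemma measurable_rV_cons n : measurable_fun [set: measurableTypeR R * 'rV[R]_n] (@rV_cons n).
Proof.
apply: measurable_fun_rV => i.
case: (unliftP ord0 i) => [j ->|->].
  rewrite (_ : (fun x => _) = (fun v : 'rV[R]_n => v 0 j) \o snd); last first.
    by apply/funext => p; rewrite rV_consS.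
  exact: measurableT_comp (measurable_rV_coord j) measurable_snd.
rewrite (_ : (fun x => _) = fst); first exact: measurable_fst.
by apply/funext => p; rewrite rV_cons0.
Qed.

Lemma measurable_rV_uncons n :
  measurable_fun [set: 'rV[R]_n.+1] (@rV_uncons n).
Proof.
apply/measurable_fun_pairP; split.
  exact: measurable_rV_coord.
apply: measurable_fun_rV => i.
rewrite (_ : (fun x => _) = (fun v : 'rV[R]_n.+1 => v 0 (lift ord0 i))).
  exact: measurable_rV_coord.
by apply/funext => v; rewrite mxE.
Qed.

HB.instance Definition _ n :=
  @isMeasurableFun.Build _ _ _ _ (@rV_cons n) (@measurable_rV_cons n).

End lebesgue_rV.

Section lebesgue_rV_step.
Context {R : realType} (n : nat).
Variable m : {sigma_finite_measure set 'rV[R]_n -> \bar R}.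

Definition lebesgue_rV_step : set 'rV[R]_n.+1 -> \bar R :=
  @pushforward _ _ _ _ _ (@lebesgue_measure R \x m)%E (@rV_cons R n).

Let lebesgue_rV_step0 : lebesgue_rV_step set0 = 0%E.
Proof. exact: measure0. Qed.

Let lebesgue_rV_step_ge0 A : (0 <= lebesgue_rV_step A)%E.
Proof. exact: measure_ge0. Qed.

Let lebesgue_rV_step_sigma_additive : semi_sigma_additive lebesgue_rV_step.
Proof. exact: measure_semi_sigma_additive. Qed.

HB.instance Definition _ := isMeasure.Build _ _ _ lebesgue_rV_step
  lebesgue_rV_step0 lebesgue_rV_step_ge0 lebesgue_rV_step_sigma_additive.

Let lebesgue_rV_step_sigma_finite : sigma_finite setT lebesgue_rV_step.
Proof.
have /sigma_finiteP[F [TF ndF Foo]] := sigma_finiteT (@lebesgue_measure R).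
have /sigma_finiteP[G [TG ndG Goo]] := sigma_finiteT m.
exists (fun k => @rV_uncons R n @^-1` (F k `*` G k)).
  rewrite -preimage_bigcup (_ : \bigcup_k _ = setT) ?preimage_setT//.
  rewrite -setXTT TF TG; apply/seteqP; split => [[x v] [k _ [/= Fx Gv]]|].
    by split; exists k.
  move=> [x v] [/= [k _ Fx] [l _ Gv]]; exists (maxn k l) => //; split => /=.
    by move: x Fx; exact/subsetPset/ndF/leq_maxl.
  by move: v Gv; exact/subsetPset/ndG/leq_maxr.
move=> k; have [mF Fk] := Foo k; have [mG Gk] := Goo k; split.
  rewrite -[X in measurable X]setTI; apply: measurable_rV_uncons => //.
  exact: measurableX.
rewrite /lebesgue_rV_step /pushforward rV_cons_preimage.
by rewrite product_measure1E// lte_mul_pinfty// ge0_fin_numE.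
Qed.

HB.instance Definition _ := Measure_isSigmaFinite.Build _ _ _ lebesgue_rV_step
  lebesgue_rV_step_sigma_finite.

End lebesgue_rV_step.

(* Lebesgue measure on R^n, as an iterated product *)
Fixpoint lebesgue_rV (R : realType) (n : nat) :
    {sigma_finite_measure set 'rV[R]_n -> \bar R} :=
  match n return {sigma_finite_measure set 'rV[R]_n -> \bar R} with
  | 0 => \d_(0 : 'rV[R]_0)
  | n'.+1 => lebesgue_rV_step (lebesgue_rV R n')
  end.

Section probability_notions.
Context {d : measure_display} {Om : measurableType d} {R : realType}.
Variable P : probability Om R.

Definition has_density n (X : Om -> 'rV[R]_n) (p : 'rV[R]_n -> R) : Prop :=
  [/\ measurable_fun [set: 'rV[R]_n] p,
      forall x, 0 <= p x &
      forall A : set 'rV[R]_n, measurable A ->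
        P (X @^-1` A) = (\int[lebesgue_rV R n]_(x in A) (p x)%:E)%E].

Definition zero_mean n (X : Om -> 'rV[R]_n) : Prop :=
  forall i : 'I_n, P.-integrable [set: Om] (fun w => (X w 0 i)%:E) /\
                   ('E_P[fun w => X w 0%R i] = 0)%E.

Definition same_law d' (T : measurableType d') (X X' : Om -> T) : Prop :=
  forall A : set T, measurable A -> P (X @^-1` A) = P (X' @^-1` A).

Definition sigma_of d' (T : measurableType d') (X : Om -> T) : set (set Om) :=
  preimage_set_system [set: Om] X measurable.

Definition independent_RV d1 d2 (T1 : measurableType d1)
    (T2 : measurableType d2) (X1 : Om -> T1) (X2 : Om -> T2) : Prop :=
  forall A1 A2, sigma_of X1 A1 -> sigma_of X2 A2 ->
    P (A1 `&` A2) = (P A1 * P A2)%E.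

Definition mutually_independent (I : eqType) (F : I -> set (set Om)) : Prop :=
  forall (r : seq I) (A : I -> set Om), uniq r ->
    (forall i, i \in r -> F i (A i)) ->
    P (\bigcap_(i in [set` r]) A i) = (\prod_(i <- r) P (A i))%E.

End probability_notions.

Definition is_norm (R : realType) n (N : 'rV[R]_n -> R) : Prop :=
  [/\ forall x y, N (x + y) <= N x + N y,
      forall (a : R) x, N (a *: x) = `|a| * N x &
      forall x, N x = 0 -> x = 0].

(* The distance to a set is the infimum in [0, +oo], so that it is defined for
   sets that are not closed and is +oo for the empty set. *)
Definition dist_to (R : realType) n (N : 'rV[R]_n -> R) (K : set 'rV[R]_n)
    (x : 'rV[R]_n) : \bar R :=
  ereal_inf [set (N (x - y))%:E | y in K].

(* The value does not depend on the element d0 witnessing nonemptiness. *)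
Definition maxD (R : realType) (D : finType) (d0 : D) (a : D -> R) : R :=
  \big[Num.max/a d0]_(d : D) a d.

Section decision_problem.
Context {disp : measure_display} {Om : measurableType disp} {R : realType}.
Context {s t : nat} {D : finType}.
Variables (P : probability Om R) (d0 : D) (f : D -> 'rV[R]_s -> R).
Variables (h : 'rV[R]_s -> 'rV[R]_t) (rho : 'rV[R]_t -> R).
Variables (pi0 : 'rV[R]_s -> R).
Variables (theta : Om -> 'rV[R]_s) (noise : Om -> 'rV[R]_t).

Definition obs (w : Om) : 'rV[R]_t := h (theta w) + noise w.

Definition lik (y : 'rV[R]_t) (x : 'rV[R]_s) : R := rho (y - h x).

Definition Etheta (phi : 'rV[R]_s -> R) : R := \int[P]_w phi (theta w).

Definition EY (phi : 'rV[R]_t -> R) : R := \int[P]_w phi (obs w).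

(* A (Lebesgue-null) infinite value of the integral is read as 0. *)
Definition rhoY (y : 'rV[R]_t) : R := Etheta (lik y).

Definition posterior (y : 'rV[R]_t) (x : 'rV[R]_s) : R :=
  lik y x * pi0 x / rhoY y.

Definition Epost (y : 'rV[R]_t) (phi : 'rV[R]_s -> R) : R :=
  \int[lebesgue_rV R s]_x (phi x * posterior y x).

Definition EVPI : R :=
  Etheta (fun x => maxD d0 (f ^~ x)) - maxD d0 (fun d => Etheta (f d)).

Definition EVSI : R :=
  EY (fun y => maxD d0 (fun d => Epost y (f d))) -
  maxD d0 (fun d => Etheta (f d)).

Definition Fdec (d : D) (y : 'rV[R]_t) : R := Etheta (fun x => f d x * lik y x).

Definition Gdec (d : D) (y : 'rV[R]_t) : R := Fdec d y / rhoY y.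

(* The domain for Y: the points at which the posterior is defined. *)
Definition Ydomain : set 'rV[R]_t := [set y | 0 < rhoY y].

Definition is_dopt (y : 'rV[R]_t) (d : D) : Prop :=
  forall d', Fdec d' y <= Fdec d y.

Definition decision_manifold : set 'rV[R]_t :=
  [set y | Ydomain y /\ ~ exists! d, is_dopt y d].

(* max_d G_d - max_{d != dopt} G_d, where a maximum over no decision at all
   (when D is a singleton) is -oo *)
Definition decision_gap (y : 'rV[R]_t) (dopt : D) : \bar R :=
  ((maxD d0 (Gdec ^~ y))%:E -
   \big[maxe/-oo]_(d : D | d != dopt) (Gdec d y)%:E)%E.

End decision_problem.

Section correction_variables.
Context {R : realType} {s t : nat} {D : finType}.
Variables (d0 : D) (f : D -> 'rV[R]_s -> R).
Variables (h : 'rV[R]_s -> 'rV[R]_t) (rho : 'rV[R]_t -> R).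
Variable M0 : nat.

Definition Mlev (l : nat) : nat := (M0 * 2 ^ l)%N.

(* The samples are numbered from 0; savg a b averages over a <= m < b. *)
Definition savg (a b : nat) (x : nat -> 'rV[R]_s) (phi : 'rV[R]_s -> R) : R :=
  (\sum_(a <= m < b) phi (x m)) / (b - a)%:R.

(* Division by 0 gives 0 here, as required. *)
Definition gbar (a b : nat) (y : 'rV[R]_t) (x : nat -> 'rV[R]_s) (d : D) : R :=
  savg a b x (fun u => f d u * lik h rho y u) / savg a b x (lik h rho y).

Definition gmaxbar (a b : nat) (y : 'rV[R]_t) (x : nat -> 'rV[R]_s) : R :=
  savg a b x (fun u => maxD d0 (f ^~ u) * lik h rho y u) /
  savg a b x (lik h rho y).

Definition DeltaP (l : nat) (y : 'rV[R]_t) (x : nat -> 'rV[R]_s) : R :=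
  match l with
  | 0 => gmaxbar 0 (Mlev 0) y x - maxD d0 (gbar 0 (Mlev 0) y x)
  | k.+1 =>
      gmaxbar 0 (Mlev k.+1) y x - maxD d0 (gbar 0 (Mlev k.+1) y x)
      - 2^-1 * (gmaxbar 0 (Mlev k) y x + gmaxbar (Mlev k) (Mlev k.+1) y x)
      + 2^-1 * (maxD d0 (gbar 0 (Mlev k) y x) +
                maxD d0 (gbar (Mlev k) (Mlev k.+1) y x))
  end.

End correction_variables.

Definition Zmlmc (R : realType) (Om : Type) (DP : nat -> nat -> Om -> R)
    (L : nat) (N : nat -> nat) (w : Om) : R :=
  \sum_(l < L.+1) (N l)%:R^-1 * \sum_(n < N l) DP l n w.

Definition mlmc_cost (L : nat) (N : nat -> nat) : nat :=
  (\sum_(l < L.+1) 2 ^ l * N l)%N.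

(* Main.v *)
Require Import Defs.
From HB Require Import structures.
From mathcomp Require Import all_boot all_order all_algebra.
From mathcomp Require Import all_classical all_reals all_analysis.
From mathcomp Require Import measurable_realfun ring lra.
Set Implicit Arguments.
Unset Strict Implicit.
Unset Printing Implicit Defensive.
Import Order.TTheory GRing.Theory Num.Theory.
Import numFieldNormedType.Exports.
Local Open Scope classical_set_scope.
Local Open Scope ring_scope.

(** Set q = 2 + e = min(p, 3).  Given Y, the ratio estimators on a block of M
    draws are quotients of averages of centred variables, and assumption (4)
    bounds their deviation dev from the posterior means by
    E[dev^q] = O(M^(-q/2)).  This comes from the one-step inequality
    E|S + X|^q <= (1 + 1/(2n)) E|S|^q + O(n^(e/2)) E|X|^q, valid because X is
    centred given S.

    In all cases |Delta P| = O(dev).  If dev is small compared with the gap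
    between the two best decisions, the same decision is optimal on the block
    and on both of its halves; Delta P is then an antithetic difference of
    ratios, of size O(dev^2), and as it is also bounded its square is O(dev^q).
    If dev is larger than the gap g, then dev^2 = O(g^(-e) dev^q).  By (3) the
    gap is at least of order r when Y is at distance more than r from K, and
    by (2) the remaining event has probability O(r); there
    dev^2 <= sg^2 + sg^(-e) dev^q.  With r = M^(-1/4) / 2 and sg = M^(-7/16)
    this gives E[(Delta P_l)^2] = O(M_l^(-(1 + e/16))).

    The means of the Delta P_l telescope, because the halves of the draws of
    level l+1 have the law of the draws of level l, and the remaining bias is
    O(E[dev]) = O(M_L^(-1/2)).  The mean square error is the squared bias plus
    the sum of the Var(Delta P_l) / N_l, so 2^L of order 1/eps^2 and N_l
    proportional to sqrt(Var(Delta P_l) / 2^l) give the stated cost. *)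

(** * Inequalities between real powers *)

(** The obstacle is the kink of the maximum: near [K] the correction is only of first order in the
    deviation, and second moments alone give a variance of order 1/M, the borderline case of the
    cost bound. Moments of order 2 + e turn the thresholds into a gain: for sg = M^(-7/16) one has
    sg^(-e) M^(-(1+e/2)) = M^(-(1+e/16)); the factor r^(-e), of order M^(e/4), costs less; and sg^2
    r is of order M^(-9/8), which suffices as e <= 1. For p = 2 one has e = 0 and the variance stays
    of order 1/M, whence the squared logarithm. The cap q <= 3 makes x^e concave, so that an
    elementary quadratic bound on (1 + t)^(2+e) is enough. No conditional expectation given Y is
    formed: Y is frozen by Fubini for independent pairs, and the draws are read one at a time by a
    state recursion. [rhoY] is 0 also where the likelihood has infinite integral; all points with
    [rhoY] = 0 are carried along under 0/0 = 0 and discarded at the end as a null event for Y. *)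

Section power_inequalities.
Context {R : realType}.
Implicit Types (a b e q r t x y : R).

(** Young's inequality for the conjugate exponents 1/e and 1/(1-e), applied to x^e and 1; at e = 0
    and e = 1 one of these exponents is infinite, so the endpoints are treated apart. *)
Lemma powR_le_tangent x e : 0 <= x -> 0 <= e <= 1 -> x `^ e <= 1 + e * (x - 1).
Proof.
move=> x0 /andP[e0 e1].
have [->|en0] := eqVneq e 0; first by rewrite powRr0 mul0r addr0.
have [->|en1] := eqVneq e 1; first by rewrite powRr1// mul1r addrC subrK.
have ep : 0 < e by rewrite lt0r en0.
have ep1 : 0 < 1 - e by rewrite subr_gt0 lt_neqAle en1.
have := @conjugate_powR R (x `^ e) 1 e^-1 (1 - e)^-1 (powR_ge0 _ _) ler01.
rewrite !invr_gt0 ep ep1 !invrK => /(_ isT isT).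
rewrite addrC subrK => /(_ erefl).
by rewrite mulr1 -powRrM divff// powRr1// powR1 mul1r => h; lra.
Qed.

Lemma ler_powRl x y r : 0 <= r -> 0 <= x -> x <= y -> x `^ r <= y `^ r.
Proof.
move=> r0 x0 xy; apply: ge0_ler_powR => //; rewrite nnegrE//.
exact: le_trans xy.
Qed.

Lemma powRN_anti x y r : 0 <= r -> 0 < x -> x <= y ->
  y `^ (- r) <= x `^ (- r).
Proof.
move=> r0 x0 xy; have y0 : 0 < y by exact: lt_le_trans xy.
rewrite [leLHS]powRN [leRHS]powRN lef_pV2 ?posrE ?powR_gt0//.
by apply: ler_powRl => //; exact: ltW.
Qed.

Lemma ge0_powR_2D x e : 0 <= e -> 0 <= x -> x `^ (2 + e) = x `^ e * x ^+ 2.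
Proof.
move=> e0 x0; rewrite addrC powRD; last by apply/implyP; rewrite gt_eqF// ltr_wpDl.
by congr (_ * _); rewrite -powR_mulrn.
Qed.

(** Split off (1+t)^2 and bound the factor (1+t)^e by its tangent. The slack left by the constant 4
    is t^2 (3 - 2e - et), nonnegative for |t| <= 1/2 and e <= 1. *)
Lemma powR_le_quadratic t e : 0 <= e <= 1 -> `|t| <= 2^-1 ->
  (1 + t) `^ (2 + e) <= 1 + (2 + e) * t + 4 * t ^+ 2.
Proof.
move=> e01; have /andP[e0 e1] := e01; rewrite ler_norml => /andP[tl tr].
have t1 : 0 <= 1 + t by lra.
rewrite ge0_powR_2D//.
have := powR_le_tangent t1 e01.
rewrite [1 + t - 1]addrC addKr => h.
apply: (@le_trans _ _ ((1 + e * t) * (1 + t) ^+ 2)).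
  by rewrite ler_wpM2r// exprn_ge0.
rewrite -subr_ge0.
have -> : 1 + (2 + e) * t + 4 * t ^+ 2 - (1 + e * t) * (1 + t) ^+ 2 =
  t ^+ 2 * (3 - 2 * e - e * t) by ring.
rewrite mulr_ge0 ?sqr_ge0//; nra.
Qed.

(* The term in |b|^(2+e) absorbs the quadratic remainder unless b is small
   compared with a / sqrt n, in which case the term in 1/n does. *)
Lemma powR_add_le n e a b : 0 <= e <= 1 -> 1 <= n ->
  `|a + b| `^ (2 + e) <= `|a| `^ (2 + e) * (1 + (2 * n)^-1)
     + (2 + e) * (`|a| `^ e * a * b) + 39 * n `^ (e / 2) * `|b| `^ (2 + e).
Proof.
move=> e01 n1; have /andP[e0 e1] := e01.
have n0 : 0 < n by exact: lt_le_trans n1.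
have en0 : 0 < 2 + e by lra.
have i2n : 0 <= (2 * n)^-1 by rewrite invr_ge0 mulr_ge0// ltW.
(* When |a| < 2|b| every term is of order |b|^(2+e): 3^3 = 27 controls the left side and 3 * 2 * 2 =
   12 the cross term, which is the origin of 39. *)
have [ba|ab] := lerP `|b| (`|a| / 2); last first.
  have ne1 : 1 <= n `^ (e / 2).
    by rewrite -[leLHS](powRr0 n); apply: ler_powR => //; rewrite divr_ge0.
  have b0 : 0 <= `|b| by [].
  have H1 : `|a + b| `^ (2 + e) <= 27 * `|b| `^ (2 + e).
    apply: (@le_trans _ _ ((3 * `|b|) `^ (2 + e))).
      apply: ler_powRl => //; first exact: ltW.
      by rewrite (le_trans (ler_normD _ _))//; lra.
    rewrite powRM// ler_wpM2r ?powR_ge0//.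
    apply: (@le_trans _ _ (3 `^ 3)).
      by apply: ler_powR; lra.
    by rewrite powR_mulrn//; lra.
  have H2 : - (12 * `|b| `^ (2 + e)) <= (2 + e) * (`|a| `^ e * a * b).
    have : `| (2 + e) * (`|a| `^ e * a * b) | <= 12 * `|b| `^ (2 + e).
      rewrite !normrM (ger0_norm (ltW en0)) (ger0_norm (powR_ge0 _ _)).
      have a2 : `|a| <= 2 * `|b| by lra.
      have h : `|a| `^ e <= 2 * `|b| `^ e.
        apply: (@le_trans _ _ ((2 * `|b|) `^ e)).
          exact: ler_powRl.
        rewrite powRM// ler_wpM2r ?powR_ge0//.
        by rewrite -[leRHS]powRr1//; apply: ler_powR; lra.
      rewrite ge0_powR_2D//.
      have p0 := powR_ge0 `|b| e.
      apply: (@le_trans _ _ (3 * ((2 * `|b| `^ e) * (2 * `|b|) * `|b|))).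
        apply: ler_pM; [exact: ltW|by rewrite !mulr_ge0 ?powR_ge0|lra|].
        by apply: ler_pM; rewrite ?mulr_ge0 ?powR_ge0//; apply: ler_pM.
      by rewrite le_eqVlt; apply/orP; left; apply/eqP; ring.
    by rewrite ler_norml => /andP[].
  have H3 : 39 * `|b| `^ (2 + e) <= 39 * n `^ (e / 2) * `|b| `^ (2 + e).
    by rewrite ler_wpM2r ?powR_ge0// ler_peMr.
  have H4 : 0 <= `|a| `^ (2 + e) * (1 + (2 * n)^-1).
    by rewrite mulr_ge0 ?powR_ge0// addr_ge0.
  lra.
have [a0|a0] := eqVneq a 0.
  move: ba; rewrite a0 normr0 mul0r normr_le0 => /eqP ->.
  by rewrite addr0 normr0 mulr0 mulr0 addr0 powR0 ?mul0r ?mulr0 ?addr0// gt_eqF.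
pose t := b / a.
have bE : b = a * t by rewrite /t mulrC divfK.
have t2 : `|t| <= 2^-1.
  by rewrite /t normrM normfV ler_pdivrMr ?normr_gt0// mulrC.
have t1 : 0 <= 1 + t by move: t2; rewrite ler_norml => /andP[]; lra.
have -> : `|a + b| `^ (2 + e) = `|a| `^ (2 + e) * (1 + t) `^ (2 + e).
  by rewrite {1}bE -[X in X + _]mulr1 -mulrDr normrM powRM// (ger0_norm t1).
have H := powR_le_quadratic e01 t2.
have pa := powR_ge0 `|a| (2 + e).
apply: (le_trans (ler_wpM2l pa H)).
rewrite (ge0_powR_2D e0 (normr_ge0 a)) real_normK ?num_real//.
have pae := powR_ge0 `|a| e.
suff : 4 * (`|a| `^ e * b ^+ 2) <= `|a| `^ e * a ^+ 2 * (2 * n)^-1 +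
    39 * n `^ (e / 2) * `|b| `^ (2 + e) by move: bE => -> ; lra.
have pb : 0 <= 39 * n `^ (e / 2) * `|b| `^ (2 + e).
  by rewrite !mulr_ge0 ?powR_ge0.
have [sm|la] := lerP (4 * b ^+ 2) (a ^+ 2 * (2 * n)^-1).
  rewrite -mulrA [4 * _]mulrCA ler_wpDr// ler_wpM2l//.
have la' : a ^+ 2 <= 8 * n * b ^+ 2.
  move: la; rewrite ltr_pdivrMr ?mulr_gt0//; lra.
have h : `|a| `^ e <= 8 * n `^ (e / 2) * `|b| `^ e.
  have -> : `|a| `^ e = (a ^+ 2) `^ (e / 2).
    rewrite -[a ^+ 2]real_normK ?num_real// -powR_mulrn// -powRrM.
    by congr (_ `^ _); field.
  have -> : `|b| `^ e = (b ^+ 2) `^ (e / 2).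
    rewrite -[b ^+ 2]real_normK ?num_real// -powR_mulrn// -powRrM.
    by congr (_ `^ _); field.
  apply: (@le_trans _ _ ((8 * n * b ^+ 2) `^ (e / 2))).
    by apply: ler_powRl la'; rewrite ?divr_ge0 ?sqr_ge0.
  rewrite [leLHS]powRM ?sqr_ge0 ?mulr_ge0 ?(ltW n0)//.
  rewrite [X in X * _ <= _]powRM ?(ltW n0)//.
  do 2 (rewrite ler_wpM2r ?powR_ge0//).
  have e21 : e / 2 <= 1 by clear -e0 e1; lra.
  by rewrite -[leRHS]powRr1//; apply: ler_powR; rewrite // ler1n.
rewrite -[leLHS]add0r; apply: lerD.
  by apply: mulr_ge0 => //; apply: mulr_ge0 => //; exact: sqr_ge0.
rewrite (ge0_powR_2D e0 (normr_ge0 b)) real_normK ?num_real//.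
apply: (@le_trans _ _ (4 * ((8 * n `^ (e / 2) * `|b| `^ e) * b ^+ 2))).
  by apply: ler_wpM2l => //; apply: ler_wpM2r => //; exact: sqr_ge0.
have : 0 <= n `^ (e / 2) * `|b| `^ e * b ^+ 2.
  by apply: mulr_ge0 (sqr_ge0 _); apply: mulr_ge0; exact: powR_ge0.
lra.
Qed.

(** In one step N^(1+e/2) grows by at least the factor 1 + 1/N, while the recursion multiplies by 1
    + 1/(2N) only. The difference, 78 N^(1+e/2) / (2N) = 39 N^(e/2), is exactly the term added,
    hence 78 = 2 * 39. *)
Lemma moment_recursion (u : nat -> R) e B : 0 <= e <= 1 -> 0 <= B ->
  u 1%N <= B ->
  (forall n, (0 < n)%N ->
     u n.+1 <= u n * (1 + (2 * n%:R)^-1) + 39 * n%:R `^ (e / 2) * B) ->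
  forall n, (0 < n)%N -> u n <= 78 * n%:R `^ (1 + e / 2) * B.
Proof.
move=> e01 B0 u1 uS; have /andP[e0 e1] := e01.
case=> // n _; elim: n => [|n IH].
  by rewrite powR1 mulr1; lra.
have N0 : 0 < n.+1%:R :> R by rewrite ltr0n.
apply: (le_trans (uS n.+1 isT)).
set N : R := n.+1%:R in N0 IH *.
have -> : n.+2%:R = N * (1 + N^-1) :> R.
  by rewrite mulrDr mulfV ?gt_eqF// mulr1 -[n.+2]addn1 natrD.
clearbody N.
have iN : 0 < N^-1 by rewrite invr_gt0.
have pE : N `^ (1 + e / 2) = N * N `^ (e / 2).
  rewrite powRD ?powRr1 ?(ltW N0)//; apply/implyP; rewrite gt_eqF//; lra.
have p0 := powR_ge0 N (e / 2).
have b1 : 0 <= 1 + N^-1 by lra.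
rewrite [(N * _) `^ _]powRM ?(ltW N0)//.
have hB : 1 + N^-1 <= (1 + N^-1) `^ (1 + e / 2).
  rewrite -[leLHS]powRr1//; apply: ler_powR; lra.
apply: (@le_trans _ _ (78 * (N `^ (1 + e / 2) * (1 + N^-1)) * B)); last first.
  by rewrite ler_wpM2r// ler_wpM2l// ler_wpM2l ?powR_ge0.
have -> : (2 * N)^-1 = N^-1 / 2 by rewrite invfM mulrC.
have := ler_wpM2r (_ : 0 <= 1 + N^-1 / 2) IH.
move=> /(_ ltac:(lra)) h; apply: (le_trans (lerD h (lexx _))).
rewrite pE -subr_ge0.
have -> : 78 * (N * N `^ (e / 2) * (1 + N^-1)) * B -
  (78 * (N * N `^ (e / 2)) * B * (1 + N^-1 / 2) + 39 * N `^ (e / 2) * B)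
  = 39 * N `^ (e / 2) * B * (N * N^-1 - 1) by field; lra.
by rewrite mulfV ?gt_eqF// subrr mulr0.
Qed.

Lemma powR_normD_le q x y : 0 <= q ->
  `|x + y| `^ q <= 2 `^ q * (`|x| `^ q + `|y| `^ q).
Proof.
move=> q0.
have H (u v : R) : `|u| <= `|v| ->
    `|u + v| `^ q <= 2 `^ q * (`|u| `^ q + `|v| `^ q).
  move=> uv; apply: (@le_trans _ _ ((2 * `|v|) `^ q)).
    by apply: ler_powRl => //; rewrite (le_trans (ler_normD _ _))//; lra.
  by rewrite powRM// ler_wpM2l ?powR_ge0// lerDr powR_ge0.
have [/H//|/ltW/H] := leP `|x| `|y|.
by rewrite addrC [X in _ * X]addrC.
Qed.

Lemma sqr_le_powR s x e : 0 <= e -> 0 < s -> 0 <= x -> s <= x ->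
  x ^+ 2 <= s `^ (- e) * x `^ (2 + e).
Proof.
move=> e0 s0 x0 sx.
rewrite ge0_powR_2D// mulrA ler_peMl ?sqr_ge0//.
rewrite powRN mulrC ler_pdivlMr ?powR_gt0// mul1r; exact: ler_powRl (ltW s0) sx.
Qed.

Lemma sqr_le_sqrD_powR s x e : 0 <= e -> 0 < s -> 0 <= x ->
  x ^+ 2 <= s ^+ 2 + s `^ (- e) * x `^ (2 + e).
Proof.
move=> e0 s0 x0; have [xs|/ltW sx] := leP x s.
  by rewrite ler_wpDr ?mulr_ge0 ?powR_ge0// ler_pXn2r// nnegrE// ltW.
by rewrite ler_wpDl ?sqr_ge0// sqr_le_powR.
Qed.

End power_inequalities.

(** * Independence and equality of laws *)

Section independence.
Context {d : measure_display} {Om : measurableType d} {R : realType}.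
Variable P : probability Om R.
Local Open Scope ereal_scope.

Definition mkRV d1 (T1 : measurableType d1) (f : Om -> T1)
  (mf : measurable_fun [set: Om] f) : {mfun Om >-> T1} :=
  HB.pack f (isMeasurableFun.Build _ _ _ _ _ mf).

Lemma measurable_preimageT d1 (T1 : measurableType d1) (f : Om -> T1) A :
  measurable_fun [set: Om] f -> measurable A -> measurable (f @^-1` A).
Proof. by move=> mf mA; rewrite -[X in measurable X]setTI; exact: mf. Qed.

(** Valid for every measurable f: both sides are differences of the integrals of the positive and
    negative parts, and each part transfers. *)
Lemma integral_distributionT d1 (T1 : measurableType d1) (V : {mfun Om >-> T1})
    (f : T1 -> \bar R) : measurable_fun [set: T1] f ->
  \int[distribution P V]_y f y = \int[P]_w f (V w).
Proof.
move=> mf; rewrite [LHS]integralE [RHS]integralE.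
rewrite !(@ge0_integral_distribution _ _ _ _ _ P V)//.
- by rewrite -funepos_comp -funeneg_comp.
- exact: measurable_funeneg.
- exact: measurable_funepos.
Qed.

Section pairs.
Context {d1 d2 : measure_display} {T1 : measurableType d1}
  {T2 : measurableType d2}.
Variables (W : {mfun Om >-> T1}) (V : {mfun Om >-> T2}).

Definition RVpair (w : Om) := (W w, V w).

Lemma measurable_RVpair : measurable_fun [set: Om] RVpair.
Proof. exact: measurable_fun_pair. Qed.

(** The law of the pair under P restricted to E, divided by P E, agrees with the product measure on
    rectangles, hence everywhere; if P E = 0 both sides vanish. E = setT gives the joint law, and E
    a tail event keeps the pair independent of later draws. *)
Lemma indep_pair_event (E : set Om) : measurable E ->
  (forall A B, measurable A -> measurable B ->
    P (W @^-1` A `&` V @^-1` B `&` E) = P (W @^-1` A) * P (V @^-1` B) * P E) ->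
  forall X, measurable X ->
    P (RVpair @^-1` X `&` E) =
      (distribution P W \x distribution P V) X * P E.
Proof.
move=> mE H X mX.
have [PE0|PE0] := eqVneq (P E) 0.
  rewrite PE0 mule0; apply/eqP; rewrite eq_le measure_ge0 andbT -PE0.
  rewrite le_measure ?inE//; apply: measurableI => //.
  exact: measurable_preimageT measurable_RVpair mX.
have PEfin : P E \is a fin_num by exact: fin_num_measure.
pose r := fine (P E).
have rE : P E = r%:E by rewrite /r fineK.
have r0 : (0 < r)%R by rewrite -lte_fin -rE lt0e PE0 measure_ge0.
have ri : (0 <= r^-1)%R by rewrite invr_ge0 ltW.
pose m'_ : {measure set (T1 * T2) -> \bar R} :=
  mscale (NngNum ri) (pushforward (mrestr P mE) RVpair).
pose m' := m'_ measurable_RVpair.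
rewrite (@product_measure_unique _ _ _ _ _ _ _ m')//; last first.
  move=> A B mA mB.
  rewrite [LHS]/(mscale _ _ _) /pushforward /mrestr/=.
  transitivity (r^-1%:E * (P (W @^-1` A) * P (V @^-1` B) * P E)).
    by rewrite -H//; congr (_ * P _).
  by rewrite rE muleC -muleA -EFinM divff ?gt_eqF// mule1.
rewrite [m' X]/(mscale _ _ _) /pushforward /mrestr/=.
by rewrite muleC muleA rE -EFinM divff ?gt_eqF// mul1e.
Qed.

Hypothesis WV : forall A B, measurable A -> measurable B ->
  P (W @^-1` A `&` V @^-1` B) = P (W @^-1` A) * P (V @^-1` B).

Lemma indep_pair_law X : measurable X ->
  P (RVpair @^-1` X) = (distribution P W \x distribution P V) X.
Proof.
move=> mX; rewrite -[RHS]mule1 -(probability_setT P) -indep_pair_event//.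
  by rewrite setIT.
by move=> A B mA mB; rewrite setIT probability_setT mule1; exact: WV.
Qed.

(** Takes the place of conditioning on W: the inner integral keeps W at its value and averages over
    an independent copy of V. *)
Lemma ge0_indep_integral (Phi : T1 * T2 -> \bar R) :
  measurable_fun [set: T1 * T2] Phi -> (forall z, 0 <= Phi z) ->
  \int[P]_w Phi (W w, V w) = \int[P]_w \int[P]_w' Phi (W w, V w').
Proof.
move=> mPhi Phi0.
rewrite -(ge0_integral_pushforward measurable_RVpair P measurableT)//.
rewrite (eq_measure_integral (distribution P W \x distribution P V));
  [|exact: measurable_RVpair|by move=> mpair A mA _; rewrite /= -indep_pair_law].
rewrite fubini_tonelli1//.
rewrite ge0_integral_distribution//.
- apply: eq_integral => w _ /=; rewrite /fubini_F.
  by rewrite ge0_integral_distribution//; exact: measurable_fun_pair2.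
- exact: measurable_fun_fubini_tonelli_F.
- by move=> x; exact: integral_ge0.
Qed.

Lemma indep_integral (Phi : T1 * T2 -> \bar R) :
  measurable_fun [set: T1 * T2] Phi ->
  P.-integrable [set: Om] (fun w => Phi (W w, V w)) ->
  \int[P]_w Phi (W w, V w) = \int[P]_w \int[P]_w' Phi (W w, V w').
Proof.
move=> mPhi iPhi.
have iprod : (distribution P W \x distribution P V).-integrable setT Phi.
  apply/integrableP; split => //.
  have -> : \int[distribution P W \x distribution P V]_x `|Phi x| =
      \int[P]_w `|Phi (W w, V w)|.
    rewrite -(ge0_integral_pushforward measurable_RVpair P measurableT
      (f := fun z => `|Phi z|))//.
      apply: eq_measure_integral; first exact: measurable_RVpair.
      by move=> mpair A mA _; rewrite /= -indep_pair_law.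
    exact: measurableT_comp.
  by case/integrableP: iPhi.
transitivity (\int[pushforward P RVpair]_z Phi z).
  by rewrite integral_pushforward//; exact: measurable_RVpair.
rewrite (eq_measure_integral (distribution P W \x distribution P V));
  [|exact: measurable_RVpair|by move=> mpair A mA _; rewrite /= -indep_pair_law].
rewrite -integral12_prod_meas1//.
rewrite integral_distributionT; last exact: (measurable_fubini_F iprod).
apply: eq_integral => w _; rewrite /fubini_F.
by rewrite integral_distributionT//; exact: measurable_fun_pair2.
Qed.

End pairs.

Lemma same_law_ge0_integral d1 (T1 : measurableType d1) (X X' : Om -> T1)
    (f : T1 -> \bar R) : measurable_fun [set: Om] X ->
  measurable_fun [set: Om] X' -> same_law P X X' ->
  measurable_fun [set: T1] f ->  (forall x, 0 <= f x) ->
  \int[P]_w f (X w) = \int[P]_w f (X' w).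
Proof.
move=> mX mX' XX' mf f0.
rewrite -(ge0_integral_pushforward mX P measurableT)//.
rewrite -(ge0_integral_pushforward mX' P measurableT)//.
apply: eq_measure_integral => A mA _; exact: XX'.
Qed.

Lemma same_law_integral d1 (T1 : measurableType d1) (X X' : Om -> T1)
    (f : T1 -> \bar R) : measurable_fun [set: Om] X ->
  measurable_fun [set: Om] X' -> same_law P X X' ->
  measurable_fun [set: T1] f ->
  \int[P]_w f (X w) = \int[P]_w f (X' w).
Proof.
move=> mX mX' XX' mf; rewrite [LHS]integralE [RHS]integralE.
have pE Y : (fun w : Om => f (Y w))^\+ = f^\+ \o Y := funepos_comp f Y.
have nE Y : (fun w : Om => f (Y w))^\- = f^\- \o Y := funeneg_comp f Y.
rewrite !pE !nE; congr (_ - _).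
  apply: (same_law_ge0_integral (f := f^\+) mX mX' XX') => //.
  exact: measurable_funepos.
apply: (same_law_ge0_integral (f := f^\-) mX mX' XX') => //.
exact: measurable_funeneg.
Qed.

Lemma same_law_integrable d1 (T1 : measurableType d1) (X X' : Om -> T1)
    (f : T1 -> \bar R) : measurable_fun [set: Om] X ->
  measurable_fun [set: Om] X' -> same_law P X X' ->
  measurable_fun [set: T1] f ->
  P.-integrable [set: Om] (f \o X) -> P.-integrable [set: Om] (f \o X').
Proof.
move=> mX mX' XX' mf /integrableP[_ fX]; apply/integrableP; split.
  exact: measurableT_comp.
rewrite -(same_law_ge0_integral mX mX' XX' (f := fun x => `|f x|))//.
exact: measurableT_comp.
Qed.

Lemma same_law_comp d1 d2 (T1 : measurableType d1) (T2 : measurableType d2)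
    (X X' : Om -> T1) (g : T1 -> T2) : measurable_fun [set: T1] g ->
  same_law P X X' -> same_law P (g \o X) (g \o X').
Proof.
move=> mg XX' A mA; apply: (XX' (g @^-1` A)).
by rewrite -[X in measurable X]setTI; exact: mg.
Qed.

Section chains.
Context {d2 : measure_display} {T2 : measurableType d2}.
Variables (th : nat -> {mfun Om >-> T2}) (N : nat).

Definition tail_event (n : nat) (B : nat -> set T2) : set Om :=
  \bigcap_(i in [set i | (n <= i < N)%N]) (th i @^-1` B i).

Lemma tail_eventS n B : (n < N)%N ->
  tail_event n B = th n @^-1` B n `&` tail_event n.+1 B.
Proof.
move=> nN; apply/seteqP; split=> w.
  move=> h; split; first by apply: h; rewrite /= leqnn.
  by move=> i /= /andP[ni iN]; apply: h; rewrite /= (ltnW ni).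
move=> [hn h] i /= /andP[]; rewrite leq_eqVlt => /predU1P[<-//|ni iN].
by apply: h; rewrite /= ni.
Qed.

Lemma measurable_tail_event n B : (forall i, measurable (B i)) ->
  measurable (tail_event n B).
Proof.
move=> mB; apply: bigcap_measurableType => i _.
exact: measurable_preimageT.
Qed.

(** Independence from the draws n, ..., N-1 is tested on cylinder events only. This is enough
    because the draws are consumed one at a time. *)
Definition tail_indep d1 (T1 : measurableType d1) (n : nat) (W : Om -> T1) :=
  forall A B, measurable A -> (forall i, measurable (B i)) ->
    P (W @^-1` A `&` tail_event n B) = P (W @^-1` A) * P (tail_event n B).

Lemma tail_indep_comp d1 d3 (T1 : measurableType d1) (T3 : measurableType d3)
    n (W : Om -> T1) (g : T1 -> T3) : measurable_fun [set: T1] g ->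
  tail_indep n W -> tail_indep n (g \o W).
Proof.
move=> mg h A B mA mB; apply: (h (g @^-1` A)) => //.
by rewrite -[X in measurable X]setTI; exact: mg.
Qed.

Hypothesis th_indep : forall n, (n < N)%N -> tail_indep n.+1 (th n).

Lemma tail_indep_pairE d1 (T1 : measurableType d1) n (W : {mfun Om >-> T1}) :
  (n < N)%N -> tail_indep n W -> forall A B, measurable A -> measurable B ->
  P (W @^-1` A `&` th n @^-1` B) = P (W @^-1` A) * P (th n @^-1` B).
Proof.
move=> nN Wn A B mA mB.
have := Wn A (fun i => if i == n then B else setT) mA.
rewrite tail_eventS// eqxx [tail_event n.+1 _](_ : _ = setT) ?setIT.
  by apply => i; case: ifP.
by apply/seteqP; split => // w _ i /= /andP[ni iN]; rewrite gtn_eqF.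
Qed.

(** [indep_pair_event] with the tail after n as its event reduces this to rectangles. There B'
    becomes the n-th coordinate of a longer tail: independence of W splits off A', and then
    [th_indep] splits off B'. *)
Lemma tail_indep_pair d1 (T1 : measurableType d1) n (W : {mfun Om >-> T1}) :
  (n < N)%N -> tail_indep n W -> tail_indep n.+1 (RVpair W (th n)).
Proof.
move=> nN Wn A B mA mB.
rewrite indep_pair_event//; first by rewrite -indep_pair_law//; exact: tail_indep_pairE.
  exact: measurable_tail_event.
move=> A' B' mA' mB'; rewrite -setIA.
pose B1 i := if i == n then B' else B i.
have mB1 i : measurable (B1 i) by rewrite /B1; case: ifP.
have E1 : tail_event n.+1 B1 = tail_event n.+1 B.
  apply/seteqP; split => w h i /= /andP[ni iN]; have /= := h i;
  by rewrite ni iN /B1 gtn_eqF// => /(_ isT).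
have := Wn A' B1 mA' mB1; rewrite tail_eventS// E1 {1 2}/B1 eqxx => ->.
by rewrite th_indep// muleA.
Qed.

End chains.
End independence.

(** * Densities and the observation model *)

Section density_integral.
Local Open Scope ereal_scope.

(** The change of variables holds for the Radon-Nikodym derivative of nu, and p equals it almost
    everywhere because both have the same integral over every measurable set. *)
Lemma ge0_integral_density d (T : measurableType d) (R : realType)
    (nu : {finite_measure set T -> \bar R})
    (mu : {sigma_finite_measure set T -> \bar R})
    (p : T -> \bar R) (f : T -> \bar R) :
  measurable_fun [set: T] p -> (forall x, 0 <= p x) ->
  (forall A, measurable A -> nu A = \int[mu]_(x in A) p x) ->
  measurable_fun [set: T] f -> (forall x, 0 <= f x) ->
  \int[nu]_x f x = \int[mu]_x (f x * p x).
Proof.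
move=> mp p0 nuE mf f0.
have numu : nu `<< mu.
  move=> A A0 B mB BA; have B0 := A0 B mB BA; rewrite nuE//.
  by apply: null_set_integral => //; exact: measurable_funTS.
have g0 := Radon_Nikodym_SigmaFinite.f_ge0 numu.
have gi := Radon_Nikodym_SigmaFinite.f_integrable numu.
have mg := measurable_int _ gi.
rewrite -(Radon_Nikodym_SigmaFinite.change_of_variables numu)//.
apply: ge0_ae_eq_integral => //.
- exact: emeasurable_funM.
- exact: emeasurable_funM.
- by move=> x _; exact: mule_ge0.
- by move=> x _; exact: mule_ge0.
have : ae_eq mu setT (Radon_Nikodym_SigmaFinite.f nu mu) p.
  apply: integral_ae_eq => // E _ mE.
  by rewrite -(Radon_Nikodym_SigmaFinite.f_integral numu)// nuE.
by apply: filterS => x /= h /h ->.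
Qed.

End density_integral.

(** * Translation invariance of Lebesgue measure on R^n *)

Section translation.
Context {R : realType}.
Local Open Scope ereal_scope.

Lemma measurable_translate (a : R) :
  measurable_fun setT ((fun x => x + a)%R : measurableTypeR R -> measurableTypeR R).
Proof. exact: measurable_funD. Qed.

(** The image of Lebesgue measure under a translation takes the same values on half-open intervals,
    and these determine it. *)
Lemma ge0_integral_translate (a : R) (f : measurableTypeR R -> \bar R) :
  measurable_fun setT f -> (forall x, 0 <= f x) ->
  \int[@lebesgue_measure R]_x f (x + a)%R = \int[@lebesgue_measure R]_x f x.
Proof.
move=> mf f0.
rewrite -(ge0_integral_pushforward (measurable_translate a) _ measurableT)//.
apply: eq_measure_integral; first exact: measurable_translate.
move=> mt A mA _; apply/esym/lebesgue_measure_unique => //= _ [[x y]] _ <-.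
rewrite /pushforward.
have -> : (fun x0 : R => x0 + a)%R @^-1` `]x, y]%classic =
    `](x - a)%R, (y - a)%R]%classic.
  by apply/seteqP; split => z /=; rewrite !in_itv/= ltrBlDr lerBrDr.
rewrite /= !lebesgue_measure_itv/= !lte_fin ltrD2r; case: ifP => // _.
by rewrite -!EFinB opprB addrA subrK.
Qed.

Lemma measurable_rV_translate n (v : 'rV[R]_n) :
  measurable_fun [set: 'rV[measurableTypeR R]_n]
    ((fun x => x + v)%R : 'rV[measurableTypeR R]_n -> 'rV[measurableTypeR R]_n).
Proof.
apply: measurable_fun_rV => i.
rewrite (_ : (fun x => _) = (fun x : 'rV_n => x ord0 i + v ord0 i)%R); last first.
  by apply/funext => x; rewrite mxE.
by apply: measurable_funD => //; exact: measurable_rV_coord.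
Qed.

Lemma ge0_integral_rV_translate n (v : 'rV[R]_n) (f : 'rV[R]_n -> \bar R) :
  measurable_fun setT f -> (forall x, 0 <= f x) ->
  \int[lebesgue_rV R n]_x f (x + v)%R = \int[lebesgue_rV R n]_x f x.
Proof.
elim: n v f => [|n IH] v f mf f0.
  by apply: eq_integral => x _; congr f; rewrite [x]thinmx0 [v]thinmx0 addr0.
pose v' := \row_(j < n) v ord0 (lift ord0 j).
have consD (x : R) (u : 'rV[R]_n) : (rV_cons (x, u) + v)%R =
    rV_cons ((x + v ord0 ord0)%R, (u + v')%R).
  apply/rowP => j; rewrite mxE; case: (unliftP ord0 j) => [k ->|->].
    by rewrite !rV_consS/= !mxE.
  by rewrite !rV_cons0.
(* Tonelli along the construction of [lebesgue_rV]: splitting off the first coordinate leaves an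
   n-dimensional integral for the induction hypothesis. *)
have E (g : 'rV[R]_n.+1 -> \bar R) : measurable_fun setT g ->
    (forall x, 0 <= g x) -> \int[lebesgue_rV R n.+1]_x g x =
    \int[@lebesgue_measure R]_x \int[lebesgue_rV R n]_u g (rV_cons (x, u)).
  move=> mg g0.
  apply: (etrans (ge0_integral_pushforward (@measurable_rV_cons R n)
    (@lebesgue_measure R \x lebesgue_rV R n) measurableT mg (fun y _ => g0 y))).
  rewrite preimage_setT fubini_tonelli1//.
    by apply: measurableT_comp => //; exact: measurable_rV_cons.
  by move=> x; exact: g0.
have mfv : measurable_fun setT (fun x : 'rV[R]_n.+1 => f (x + v)%R).
  by apply: (measurableT_comp mf); exact: measurable_rV_translate.
rewrite (E _ mfv (fun x => f0 _)) (E _ mf f0).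
have mfc : measurable_fun setT (fun z : measurableTypeR R * 'rV[R]_n => f (rV_cons z)).
  by apply: (measurableT_comp mf); exact: measurable_rV_cons.
pose F (x : measurableTypeR R) := \int[lebesgue_rV R n]_u f (rV_cons (x, u)).
have mF : measurable_fun setT F.
  exact: (measurable_fun_fubini_tonelli_F (m2 := lebesgue_rV R n) _ mfc
    (fun z => f0 (rV_cons z))).
have F0 x : 0 <= F x by exact: integral_ge0.
apply: (etrans _ (ge0_integral_translate (v ord0 ord0) mF F0)).
apply: eq_integral => x _; rewrite /F -[RHS](IH v').
- by apply: eq_integral => u _; rewrite consD.
- exact: measurable_fun_pair2 mfc.
- by [].
Qed.

End translation.

Section measurability_helpers.
Context {d : measure_display} {T : measurableType d} {R : realType}.

Lemma measurable_rV_add n (f g : T -> 'rV[R]_n) :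
  measurable_fun [set: T] f -> measurable_fun [set: T] g ->
  measurable_fun [set: T] (fun x => f x + g x).
Proof.
move=> mf mg; apply: measurable_fun_rV => i.
rewrite (_ : (fun x => _) = (fun x => f x ord0 i + g x ord0 i)); last first.
  by apply/funext => x; rewrite mxE.
apply: measurable_funD.
  exact: measurableT_comp (measurable_rV_coord i) mf.
exact: measurableT_comp (measurable_rV_coord i) mg.
Qed.

Lemma measurable_rV_sub n (f g : T -> 'rV[R]_n) :
  measurable_fun [set: T] f -> measurable_fun [set: T] g ->
  measurable_fun [set: T] (fun x => f x - g x).
Proof.
move=> mf mg; apply: measurable_fun_rV => i.
rewrite (_ : (fun x => _) = (fun x => f x ord0 i - g x ord0 i)); last first.
  by apply/funext => x; rewrite !mxE.
apply: measurable_funB.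
  exact: measurableT_comp (measurable_rV_coord i) mf.
exact: measurableT_comp (measurable_rV_coord i) mg.
Qed.

Lemma measurable_maxD (D : finType) (d0 : D) (a : D -> T -> R) :
  (forall d, measurable_fun [set: T] (a d)) ->
  measurable_fun [set: T] (fun x => maxD d0 (a ^~ x)).
Proof.
move=> ma; rewrite /maxD; elim: (index_enum D) => [|i l IH].
  by under eq_fun do rewrite big_nil; exact: ma.
under eq_fun do rewrite big_cons.
exact: measurable_maxr.
Qed.

(** 1/f is written as f times the square of |f|^(-1), a composition with the measurable real power;
    at the zeros of f both sides are 0. *)
Lemma measurable_fun_inv (f : T -> R) :
  measurable_fun [set: T] f -> measurable_fun [set: T] (fun x => (f x)^-1).
Proof.
move=> mf.
rewrite (_ : (fun x => _) = (fun x => f x * (`|f x| `^ (-1)) ^+ 2)); last first.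
  apply/funext => x; have [->|fx] := eqVneq (f x) 0; first by rewrite invr0 mul0r.
  rewrite powR_inv1// exprVn real_normK ?num_real// expr2 invfM mulrA mulfV//.
  by rewrite mul1r.
apply: measurable_funM => //; apply: measurable_funX.
apply: (measurableT_comp (measurable_powR (-1))).
exact: measurableT_comp.
Qed.

Lemma measurable_fun_div (f g : T -> R) :
  measurable_fun [set: T] f -> measurable_fun [set: T] g ->
  measurable_fun [set: T] (fun x => f x / g x).
Proof. by move=> mf mg; apply: measurable_funM => //; exact: measurable_fun_inv. Qed.

End measurability_helpers.

(** * Joint law of parameter and observation, marginal density *)

Section bayes.
Context {disp : measure_display} {Om : measurableType disp} {R : realType}
  (P : probability Om R) {s t : nat}.
Variables (pi0 : 'rV[R]_s -> R) (theta : {RV P >-> 'rV[R]_s}).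
Variables (h : 'rV[R]_s -> 'rV[R]_t) (mh : measurable_fun [set: 'rV[R]_s] h).
Variables (rho : 'rV[R]_t -> R) (noise : {RV P >-> 'rV[R]_t}).
Hypothesis noise_rho : has_density P noise rho.
Hypothesis noise_indep : independent_RV P theta noise.

Let mrho : measurable_fun [set: 'rV[R]_t] rho. Proof. by case: noise_rho. Qed.
Let rho0 x : 0 <= rho x. Proof. by case: noise_rho. Qed.

Lemma lik_ge0 y x : 0 <= lik h rho y x. Proof. exact: rho0. Qed.

Lemma measurable_obs : measurable_fun [set: Om] (obs h theta noise).
Proof. by apply: measurable_rV_add => //; exact: measurableT_comp. Qed.

Lemma measurable_lik :
  measurable_fun [set: 'rV[R]_t * 'rV[R]_s] (fun z => lik h rho z.1 z.2).
Proof.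
apply: (measurableT_comp mrho); apply: measurable_rV_sub.
  exact: measurable_fst.
exact: measurableT_comp mh measurable_snd.
Qed.

Lemma measurable_lik_comp d (T : measurableType d) (u : T -> 'rV[R]_t)
    (v : T -> 'rV[R]_s) : measurable_fun [set: T] u -> measurable_fun [set: T] v ->
  measurable_fun [set: T] (fun x => lik h rho (u x) (v x)).
Proof.
move=> mu mv; apply: (measurableT_comp measurable_lik (g := fun x => (u x, v x))).
exact: measurable_fun_pair.
Qed.

Local Open Scope ereal_scope.

(** [lik] is the conditional density of the observation given theta: by independence theta is
    frozen, the noise is integrated against its density, and the shift by h(theta) is absorbed by
    translation invariance. *)
Lemma joint_integral (Phi : 'rV[R]_s * 'rV[R]_t -> \bar R) :
  measurable_fun setT Phi -> (forall z, 0 <= Phi z) ->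
  \int[P]_w Phi (theta w, obs h theta noise w) =
  \int[P]_w \int[lebesgue_rV R t]_y
    (Phi (theta w, y) * (lik h rho y (theta w))%:E).
Proof.
move=> mPhi Phi0.
pose Phi' (z : 'rV[R]_s * 'rV[R]_t) := Phi (z.1, (h z.1 + z.2)%R).
have mPhi' : measurable_fun setT Phi'.
  apply: (measurableT_comp mPhi); apply: measurable_fun_pair => //.
  apply: measurable_rV_add; last exact: measurable_snd.
  exact: measurableT_comp mh measurable_fst.
have Phi'0 z : 0 <= Phi' z by exact: Phi0.
rewrite (@ge0_indep_integral _ _ _ P _ _ _ _ theta noise _ Phi' mPhi' Phi'0); last first.
  move=> A B mA mB; apply: noise_indep; [exists A|exists B] => //;
  by rewrite setTI.
apply: eq_integral => w _; rewrite /Phi' /=.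
set x := theta w.
have mPx : measurable_fun setT (fun y : 'rV[R]_t => Phi (x, y)).
  exact: measurable_fun_pair2 mPhi.
have mPxh : measurable_fun setT (fun e : 'rV[R]_t => Phi (x, (h x + e)%R)).
  by apply: (measurableT_comp mPx); apply: measurable_rV_add.
rewrite -(integral_distributionT P noise mPxh).
rewrite (@ge0_integral_density _ _ _ (distribution P noise) (lebesgue_rV R t)
   (EFin \o rho))//; last 2 first.
- exact/measurable_EFinP.
- by case: noise_rho.
rewrite -[RHS](ge0_integral_rV_translate (h x)).
- by apply: eq_integral => e _; rewrite /lik addrK addrC.
- apply: emeasurable_funM => //; apply/measurable_EFinP.
  exact: measurable_lik_comp.
- by move=> y; rewrite mule_ge0// lee_fin lik_ge0.
Qed.

(** The marginal density with its possible value +oo. [rhoY] turns that value into 0, which Tonelli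
    does not tolerate. *)
Definition erhoY (y : 'rV[R]_t) : \bar R := \int[P]_w (lik h rho y (theta w))%:E.

Lemma rhoYE y : rhoY P h rho theta y = fine (erhoY y). Proof. by []. Qed.

Lemma erhoY_ge0 y : 0 <= erhoY y.
Proof. by apply: integral_ge0 => w _; rewrite lee_fin lik_ge0. Qed.

Lemma rhoY_ge0 y : (0 <= rhoY P h rho theta y)%R.
Proof. by rewrite rhoYE fine_ge0// erhoY_ge0. Qed.

Lemma rhoY_gt0_fin y : (0 < rhoY P h rho theta y)%R ->
  erhoY y = (rhoY P h rho theta y)%:E.
Proof.
by rewrite rhoYE; case: (erhoY y) => [r| |] //=; rewrite ltxx.
Qed.

Lemma measurable_weighted_lik (phi : 'rV[R]_s -> R) :
  measurable_fun setT phi ->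
  measurable_fun setT (fun z : 'rV[R]_t * Om =>
    (phi (theta z.2) * lik h rho z.1 (theta z.2))%:E).
Proof.
move=> mphi; apply/measurable_EFinP; apply: measurable_funM.
  apply: (measurableT_comp mphi); exact: measurableT_comp measurable_snd.
apply: measurable_lik_comp; first exact: measurable_fst.
exact: measurableT_comp measurable_snd.
Qed.

Lemma measurable_erhoY : measurable_fun setT erhoY.
Proof.
have m1 : measurable_fun setT (fun z : 'rV[R]_t * Om =>
    (lik h rho z.1 (theta z.2))%:E).
  apply/measurable_EFinP; apply: measurable_lik_comp; first exact: measurable_fst.
  exact: measurableT_comp measurable_snd.
apply: (measurable_fun_fubini_tonelli_F (m2 := P) _ m1) => z.
by rewrite lee_fin lik_ge0.
Qed.

Lemma measurable_Etheta (phi : 'rV[R]_s -> R) : measurable_fun setT phi ->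
  measurable_fun setT
    (fun y => Etheta P theta (fun x => phi x * lik h rho y x)%R).
Proof.
move=> mphi; rewrite /Etheta /Rintegral.
apply: (@measurableT_comp _ _ _ _ _ _ fine) => //.
have m1 := measurable_weighted_lik mphi.
pose F0 (g : 'rV[R]_t * Om -> \bar R) y := \int[P]_w g (y, w).
pose Gp := fun z : 'rV[R]_t * Om =>
    (phi (theta z.2) * lik h rho z.1 (theta z.2))%:E.
have -> : (fun y => \int[P]_x (phi (theta x) * lik h rho y (theta x))%:E) =
   F0 Gp^\+ \- F0 Gp^\-.
  apply/funext => y; rewrite /F0 [LHS]integralE.
  rewrite -[X in X^\+]/(Gp \o pair y) -[X in X^\-]/(Gp \o pair y).
  by rewrite funepos_comp funeneg_comp.
apply: emeasurable_funB.
  apply: (measurable_fun_fubini_tonelli_F (m2 := P)) => //.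
  exact: measurable_funepos.
apply: (measurable_fun_fubini_tonelli_F (m2 := P)) => //.
exact: measurable_funeneg.
Qed.

Lemma measurable_rhoY : measurable_fun setT (rhoY P h rho theta).
Proof.
by apply: (@measurableT_comp _ _ _ _ _ _ fine) => //; exact: measurable_erhoY.
Qed.

(** Exchanging the two integrals of [joint_integral] identifies [erhoY] as the density of the
    observation. *)
Lemma obs_integral (Psi : 'rV[R]_t -> \bar R) :
  measurable_fun setT Psi -> (forall z, 0 <= Psi z) ->
  \int[P]_w Psi (obs h theta noise w) =
  \int[lebesgue_rV R t]_y (Psi y * erhoY y).
Proof.
move=> mPsi Psi0.
have mP2 : measurable_fun setT (fun z : 'rV[R]_s * 'rV[R]_t => Psi z.2).
  exact: measurableT_comp mPsi measurable_snd.
rewrite (@joint_integral _ mP2) //=.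
have mm : measurable_fun setT (fun z : Om * 'rV[R]_t =>
    Psi z.2 * (lik h rho z.2 (theta z.1))%:E).
  apply: emeasurable_funM; first exact: measurableT_comp mPsi measurable_snd.
  apply/measurable_EFinP; apply: measurable_lik_comp; first exact: measurable_snd.
  exact: measurableT_comp measurable_fst.
have mm0 z : 0 <= Psi z.2 * (lik h rho z.2 (theta z.1))%:E.
  by rewrite mule_ge0// lee_fin lik_ge0.
rewrite (fubini_tonelli (m1 := P) (m2 := lebesgue_rV R t) _ mm mm0).
apply: eq_integral => y _ /=; rewrite ge0_integralZl//.
- apply/measurable_EFinP; apply: measurable_lik_comp => //.
- by move=> w _; rewrite lee_fin lik_ge0.
Qed.

Lemma erhoY_ae_fin : {ae lebesgue_rV R t, forall y, erhoY y \is a fin_num}.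
Proof.
have i1 : \int[lebesgue_rV R t]_y erhoY y = 1.
  transitivity (\int[P]_w (cst 1) (obs h theta noise w)).
    by rewrite obs_integral//; apply: eq_integral => y _; rewrite /= mul1e.
  rewrite -[LHS]/(\int[P]_w (cst 1) w) integral_cst//.
  by rewrite mul1e; exact: probability_setT.
have : (lebesgue_rV R t).-integrable setT erhoY.
  apply/integrableP; split; first exact: measurable_erhoY.
  under eq_integral do rewrite gee0_abs ?erhoY_ge0//.
  by rewrite i1 ltry.
move=> /integrable_ae => /(_ measurableT).
by apply: filterS => y /= /(_ I).
Qed.

(** [rhoY] vanishes where [erhoY] is 0 or +oo. The first set has no mass under the density [erhoY],
    and the second is Lebesgue-null because [erhoY] has integral 1. *)
Lemma rhoY_obs_gt0 :
  P [set w | (rhoY P h rho theta (obs h theta noise w) <= 0)%R] = 0.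
Proof.
pose B := [set y : 'rV[R]_t | (rhoY P h rho theta y <= 0)%R].
have mB : measurable B.
  rewrite (_ : B = rhoY P h rho theta @^-1` `]-oo, 0%R]%classic); last first.
    by apply/seteqP; split => y /=; rewrite in_itv.
  by rewrite -[X in measurable X]setTI; exact: measurable_rhoY.
rewrite -[X in P X]/((obs h theta noise) @^-1` B).
have mB' : measurable (obs h theta noise @^-1` B).
  exact: measurable_preimageT measurable_obs mB.
transitivity (\int[P]_w (\1_B (obs h theta noise w))%:E).
  rewrite -[X in P X]setIT -integral_indic//.
rewrite (@obs_integral (EFin \o \1_B)); last 2 first.
- by apply/measurable_EFinP; exact: measurable_indic.
- by move=> y; rewrite lee_fin.
transitivity (\int[lebesgue_rV R t]_y (cst 0) y); last by rewrite integral_cst// mul0e.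
apply: ge0_ae_eq_integral => //.
- apply: emeasurable_funM; last exact: measurable_erhoY.
  by apply/measurable_EFinP; exact: measurable_indic.
- by move=> y _; rewrite mule_ge0 ?lee_fin ?erhoY_ge0.
apply: filterS erhoY_ae_fin => y /= yfin _; rewrite indicE.
case: (boolP (y \in B)) => [|_]; last by rewrite mul0e.
rewrite inE /B /= rhoYE => hy; rewrite mul1e -(fineK yfin).
by congr EFin; apply/eqP; rewrite eq_le hy fine_ge0// erhoY_ge0.
Qed.

End bayes.

Section probability_integrals.
Context {d : measure_display} {Om : measurableType d} {R : realType}
  (P : probability Om R).

Lemma integrable_dominated (f g : Om -> R) : measurable_fun setT f ->
  (forall w, `|f w| <= g w) -> P.-integrable setT (EFin \o g) ->
  P.-integrable setT (EFin \o f).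
Proof.
move=> mf fg; apply: le_integrable => //; first exact/measurable_EFinP.
by move=> w _ /=; rewrite lee_fin (le_trans (fg w))// ler_norm.
Qed.

Lemma integrable_cstR (C : R) : P.-integrable setT (EFin \o (fun=> C)).
Proof.
by apply: finite_measure_integrable_cst.
Qed.

Lemma integrable_bounded (f : Om -> R) (C : R) : measurable_fun setT f ->
  (forall w, `|f w| <= C) -> P.-integrable setT (EFin \o f).
Proof. by move=> mf fC; apply: (integrable_dominated mf fC); exact: integrable_cstR. Qed.

Lemma Rintegral_cstT (C : R) : \int[P]_w C = C.
Proof.
transitivity (C * fine (P setT)); first exact: Rintegral_cst.
by rewrite probability_setT mulr1.
Qed.

Lemma EFin_Rintegral (f : Om -> R) : P.-integrable setT (EFin \o f) ->
  (\int[P]_w f w)%:E = (\int[P]_w (f w)%:E)%E.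
Proof. by move=> fi; rewrite /Rintegral fineK//; exact: integrable_fin_num. Qed.

End probability_integrals.

Section density_integral_signed.
Local Open Scope ereal_scope.

Lemma integral_density d (T : measurableType d) (R : realType)
    (nu : {finite_measure set T -> \bar R})
    (mu : {sigma_finite_measure set T -> \bar R}) (p f : T -> R) :
  measurable_fun [set: T] p -> (forall x, 0 <= p x)%R ->
  (forall A, measurable A -> nu A = \int[mu]_(x in A) (p x)%:E) ->
  measurable_fun [set: T] f ->
  \int[nu]_x (f x)%:E = \int[mu]_x (f x * p x)%:E.
Proof.
move=> mp p0 nuE mf.
have mp' : measurable_fun setT (EFin \o p) by exact/measurable_EFinP.
have p0' x : 0 <= (EFin \o p) x by rewrite lee_fin.
have mf' : measurable_fun setT (EFin \o f) by exact/measurable_EFinP.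
have M (a b : R) : (0 <= b)%R -> maxe a%:E 0 * b%:E = maxe (a * b)%:E 0.
  by move=> b0; rewrite -!EFin_max -EFinM maxr_pMl// mul0r.
rewrite [LHS]integralE [RHS]integralE; congr (_ - _).
  rewrite (@ge0_integral_density _ _ _ nu mu (EFin \o p))//.
    by apply: eq_integral => x _; rewrite !funeposE /= M.
  exact: measurable_funepos.
rewrite (@ge0_integral_density _ _ _ nu mu (EFin \o p))//.
  by apply: eq_integral => x _; rewrite !funenegE /= M// mulNr.
exact: measurable_funeneg.
Qed.

End density_integral_signed.

(** * Posterior means and the tower property *)

Section posterior.
Context {disp : measure_display} {Om : measurableType disp} {R : realType}
  (P : probability Om R) {s t : nat}.
Variables (pi0 : 'rV[R]_s -> R) (theta : {RV P >-> 'rV[R]_s}).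
Hypothesis theta_pi0 : has_density P theta pi0.
Variables (h : 'rV[R]_s -> 'rV[R]_t) (mh : measurable_fun [set: 'rV[R]_s] h).
Variables (rho : 'rV[R]_t -> R) (noise : {RV P >-> 'rV[R]_t}).
Hypothesis noise_rho : has_density P noise rho.
Hypothesis noise_indep : independent_RV P theta noise.

Let rY := rhoY P h rho theta.
Let rY0 y : 0 <= rY y. Proof. exact: rhoY_ge0 noise_rho _. Qed.

Definition lratio (y : 'rV[R]_t) (x : 'rV[R]_s) : R :=
  lik h rho y x / rhoY P h rho theta y.

(** For phi = [f d] this is [Gdec]; a general phi lets the same lemmas serve the pointwise maximum
    of the f_d. *)
Definition post (phi : 'rV[R]_s -> R) (y : 'rV[R]_t) : R :=
  Etheta P theta (fun x => phi x * lik h rho y x) / rhoY P h rho theta y.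

Lemma ratio_ge0 y x : 0 <= lratio y x.
Proof. by rewrite divr_ge0 ?rY0// (lik_ge0 h noise_rho). Qed.

Lemma measurable_ratio_comp d (T : measurableType d) (u : T -> 'rV[R]_t)
    (v : T -> 'rV[R]_s) : measurable_fun [set: T] u -> measurable_fun [set: T] v ->
  measurable_fun [set: T] (fun x => lratio (u x) (v x)).
Proof.
move=> mu mv; apply: measurable_fun_div; first exact: (measurable_lik_comp mh noise_rho).
exact: measurableT_comp (measurable_rhoY theta mh noise_rho) mu.
Qed.

Lemma measurable_post (phi : 'rV[R]_s -> R) : measurable_fun setT phi ->
  measurable_fun setT (post phi).
Proof.
move=> mphi; apply: measurable_fun_div.
  exact: (measurable_Etheta theta mh noise_rho).
exact: (measurable_rhoY theta mh noise_rho).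
Qed.

Lemma rhoY_eq0 y : ~ 0 < rY y -> rY y = 0.
Proof. by move=> /negP; rewrite -leNgt => h0; apply/eqP; rewrite eq_le h0 rY0. Qed.

Lemma integrable_lik y : 0 < rY y ->
  P.-integrable setT (EFin \o (fun w => lik h rho y (theta w))).
Proof.
move=> y0; apply/integrableP; split.
  by apply/measurable_EFinP; exact: (measurable_lik_comp mh noise_rho).
under eq_integral do rewrite /= ger0_norm ?(lik_ge0 h noise_rho)//.
by rewrite [X in (X < _)%E](rhoY_gt0_fin y0) ltry.
Qed.

Lemma integrable_ratio y : P.-integrable setT (EFin \o (fun w => lratio y (theta w))).
Proof.
have [y0|/rhoY_eq0 y0] := pselect (0 < rY y); last first.
  rewrite (_ : _ \o _ = cst 0%E) ?integrable0//.
  by apply/funext => w; rewrite /= /lratio -/rY y0 invr0 mulr0.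
rewrite (_ : _ \o _ = (fun w => (rY y)^-1%:E * (lik h rho y (theta w))%:E)%E).
  by apply: integrableZl => //; exact: integrable_lik.
by apply/funext => w; rewrite /= /lratio mulrC EFinM.
Qed.

(** The quotient on the right is 1 on the domain of Y and 0 off it, so that the identity can be used
    at every y. *)
Lemma Rintegral_ratio y : \int[P]_w lratio y (theta w) = rY y / rY y.
Proof.
have [y0|/rhoY_eq0 y0] := pselect (0 < rY y); last first.
  rewrite y0 mul0r -[RHS](Rintegral_cstT P); apply: eq_Rintegral => w _.
  by rewrite /lratio -/rY y0 invr0 mulr0.
by rewrite RintegralZr//; exact: integrable_lik.
Qed.

Section bounded.
Variables (phi : 'rV[R]_s -> R) (mphi : measurable_fun setT phi) (C : R).
Hypothesis phiC : forall x, `|phi x| <= C.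

Let C0 : 0 <= C. Proof. exact: le_trans (phiC 0). Qed.

Lemma integrable_bounded_ratio y :
  P.-integrable setT (EFin \o (fun w => phi (theta w) * lratio y (theta w))).
Proof.
apply: (integrable_dominated (g := fun w => C * lratio y (theta w))).
- apply: measurable_funM; first exact: measurableT_comp.
  exact: measurable_ratio_comp.
- by move=> w; rewrite normrM (ger0_norm (ratio_ge0 _ _)) ler_wpM2r ?ratio_ge0.
- rewrite (_ : _ \o _ = (fun w => C%:E * (lratio y (theta w))%:E)%E)//.
  by apply: integrableZl => //; exact: integrable_ratio.
Qed.

Lemma integrable_bounded_lik y : 0 < rY y ->
  P.-integrable setT (EFin \o (fun w => phi (theta w) * lik h rho y (theta w))).
Proof.
move=> y0.
apply: (integrable_dominated (g := fun w => C * lik h rho y (theta w))).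
- apply: measurable_funM; first exact: measurableT_comp.
  exact: (measurable_lik_comp mh noise_rho).
- move=> w; rewrite normrM (ger0_norm (lik_ge0 h noise_rho _ _)).
  by rewrite ler_wpM2r ?(lik_ge0 h noise_rho).
- rewrite (_ : _ \o _ = (fun w => C%:E * (lik h rho y (theta w))%:E)%E)//.
  by apply: integrableZl => //; exact: integrable_lik.
Qed.

Lemma postE y : post phi y = \int[P]_w (phi (theta w) * lratio y (theta w)).
Proof.
rewrite /post /lratio /Etheta.
under [RHS]eq_Rintegral do rewrite mulrA.
have [y0|/rhoY_eq0 y0] := pselect (0 < rY y); last first.
  rewrite -/rY y0 invr0 mulr0 -[LHS](Rintegral_cstT P); apply: eq_Rintegral => w _.
  by rewrite mulr0.
by rewrite RintegralZr//; exact: integrable_bounded_lik.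
Qed.

Lemma post_bounded y : `|post phi y| <= C.
Proof.
rewrite postE (le_trans (le_normr_Rintegral _ (integrable_bounded_ratio y)))//.
apply: (@le_trans _ _ (\int[P]_w (C * lratio y (theta w)))).
  apply: le_Rintegral => //.
  - exact: (integrable_norm (integrable_bounded_ratio y)).
  - rewrite (_ : _ \o _ = (fun w => C%:E * (lratio y (theta w))%:E)%E)//.
    by apply: integrableZl => //; exact: integrable_ratio.
  - move=> w _; rewrite normrM (ger0_norm (ratio_ge0 _ _)).
    by rewrite ler_wpM2r ?ratio_ge0.
rewrite RintegralZl//; last exact: integrable_ratio.
rewrite Rintegral_ratio ler_piMr//.
by have [->|y0] := eqVneq (rY y) 0; rewrite ?mul0r// divff.
Qed.

(** phi is centred before it is weighted because the error of a ratio estimator is the average of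
    exactly these variables divided by the average weight. *)
Lemma Rintegral_centered_ratio y :
  \int[P]_w ((phi (theta w) - post phi y) * lratio y (theta w)) = 0.
Proof.
under eq_Rintegral do rewrite mulrBl.
rewrite RintegralB//; last 2 first.
- exact: integrable_bounded_ratio.
- rewrite (_ : _ \o _ = (fun w => (post phi y)%:E * (lratio y (theta w))%:E)%E)//.
  by apply: integrableZl => //; exact: integrable_ratio.
rewrite RintegralZl//; last exact: integrable_ratio.
rewrite -postE Rintegral_ratio.
have [y0|y0] := eqVneq (rY y) 0; last by rewrite divff// mulr1 subrr.
by rewrite /post -/rY y0 invr0 !mulr0 subrr.
Qed.

(** Since pi0 is the density of theta, integrating against the posterior density is integrating over
    the prior law with weight [lratio]. *)
Lemma Epost_post y : Epost P h rho pi0 theta y phi = post phi y.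
Proof.
rewrite postE /Epost /Rintegral; congr fine.
have [mpi pi00 pi0E] := theta_pi0.
have mg : measurable_fun setT (fun x => phi x * lratio y x).
  by apply: measurable_funM => //; exact: measurable_ratio_comp.
rewrite -(integral_distributionT P theta (f := fun x => (phi x * lratio y x)%:E)); last first.
  exact/measurable_EFinP.
rewrite (@integral_density _ _ _ (distribution P theta) (lebesgue_rV R s) pi0)//.
apply: eq_integral => x _; congr EFin; rewrite /posterior /lratio; ring.
Qed.

End bounded.

(** Both sides become Lebesgue integrals in y, whose integrands agree wherever [erhoY] is finite: if
    it is positive the denominator of [post] cancels, and if it is 0 the other integrand is at most
    C times [erhoY], hence 0. *)
Lemma ge0_EY_post (phi : 'rV[R]_s -> R) (C : R) :
  measurable_fun setT phi -> (forall x, 0 <= phi x <= C) ->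
  (\int[P]_w (post phi (obs h theta noise w))%:E = \int[P]_w (phi (theta w))%:E)%E.
Proof.
move=> mphi phi0C.
have phi0 x : 0 <= phi x by case/andP: (phi0C x).
have phiC x : `|phi x| <= C by rewrite ger0_norm//; case/andP: (phi0C x).
have C0 : 0 <= C by exact: le_trans (phiC 0).
have post0 y : 0 <= post phi y.
  by rewrite divr_ge0 ?rY0//; apply: Rintegral_ge0 => w _; rewrite mulr_ge0// (lik_ge0 h noise_rho).
rewrite (@obs_integral _ _ _ P _ _ theta h mh rho noise noise_rho noise_indep
  (EFin \o post phi)); last 2 first.
- by apply/measurable_EFinP; exact: measurable_post.
- by move=> y; rewrite lee_fin post0.
have mjoint : measurable_fun setT
    (fun z : 'rV[R]_s * 'rV[R]_t => (phi z.1)%:E).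
  apply/measurable_EFinP; exact: measurableT_comp mphi measurable_fst.
rewrite (@joint_integral _ _ _ P _ _ theta h mh rho noise noise_rho noise_indep
  _ mjoint)/=; last first.
  by move=> z; rewrite lee_fin phi0.
have mm : measurable_fun setT (fun z : Om * 'rV[R]_t =>
    (phi (theta z.1))%:E * (lik h rho z.2 (theta z.1))%:E)%E.
  apply: emeasurable_funM; apply/measurable_EFinP.
    by apply: (measurableT_comp mphi); exact: measurableT_comp measurable_fst.
  apply: (measurable_lik_comp mh noise_rho); first exact: measurable_snd.
  exact: measurableT_comp measurable_fst.
have mm0 z : (0 <= (phi (theta z.1))%:E * (lik h rho z.2 (theta z.1))%:E)%E.
  by rewrite mule_ge0// lee_fin// (lik_ge0 h noise_rho).
rewrite (fubini_tonelli (m1 := P) (m2 := lebesgue_rV R t) _ mm mm0)/=.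
apply: ge0_ae_eq_integral => //.
- apply: emeasurable_funM; first by apply/measurable_EFinP; exact: measurable_post.
  exact: (measurable_erhoY theta mh noise_rho).
- exact: (measurable_fun_fubini_tonelli_G (m1 := P) _ mm mm0).
- by move=> y _; rewrite mule_ge0 ?lee_fin// (erhoY_ge0 theta h noise_rho).
- by move=> y _; apply: integral_ge0 => w _; exact: mm0 (w, y).
apply: filterS (erhoY_ae_fin mh noise_rho noise_indep) => y yfin _.
have [y0|y0] := pselect (0 < rY y).
  rewrite (rhoY_gt0_fin y0) -EFinM /post divfK ?gt_eqF//.
  by rewrite EFin_Rintegral//; exact: (integrable_bounded_lik mphi phiC).
have e0 : erhoY theta h rho y = 0%E.
  by rewrite -(fineK yfin) -rhoYE -/rY (rhoY_eq0 y0).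
rewrite e0 mule0; apply/esym/eqP; rewrite eq_le; apply/andP; split; last first.
  by apply: integral_ge0 => w _; exact: mm0 (w, y).
rewrite -(mule0 C%:E) -e0 -ge0_integralZl//.
- apply: ge0_le_integral => //.
  + by move=> w _; exact: mm0 (w, y).
  + exact: measurable_fun_pair1 mm.
  + apply: emeasurable_funM => //; apply/measurable_EFinP.
    exact: (measurable_lik_comp mh noise_rho).
  + move=> w _; rewrite -!EFinM lee_fin ler_wpM2r// ?(lik_ge0 h noise_rho)//.
    by case/andP: (phi0C (theta w)).
- by apply/measurable_EFinP; exact: (measurable_lik_comp mh noise_rho).
- by move=> w _; rewrite lee_fin (lik_ge0 h noise_rho).
Qed.

(** The nonnegative case is applied to phi + C. Posterior averaging commutes with the addition of C
    only where [rhoY] > 0, so the integrands agree almost surely rather than pointwise. *)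
Lemma EY_post (phi : 'rV[R]_s -> R) (C : R) : measurable_fun setT phi ->
  (forall x, `|phi x| <= C) ->
  \int[P]_w post phi (obs h theta noise w) = \int[P]_w phi (theta w).
Proof.
move=> mphi phiC.
have C0 : 0 <= C by exact: le_trans (phiC 0).
have mo := measurable_obs theta mh noise.
have mpo (psi : 'rV[R]_s -> R) : measurable_fun setT psi ->
    measurable_fun setT (fun w => post psi (obs h theta noise w)).
  by move=> mpsi; exact: measurableT_comp (measurable_post mpsi) mo.
have mC : measurable_fun setT (fun x => phi x + C) by exact: measurable_funD.
have bC x : 0 <= phi x + C <= C + C.
  by have := phiC x; rewrite ler_norml => /andP[h1 h2]; rewrite lerD2r h2 andbT; lra.
have iphi : P.-integrable setT (EFin \o (phi \o theta)).
  by apply: (@integrable_bounded _ _ _ P _ C) => //=; exact: (measurableT_comp mphi).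
have ipost : P.-integrable setT (EFin \o (fun w => post phi (obs h theta noise w))).
  apply: (@integrable_bounded _ _ _ P _ C); first exact: mpo.
  by move=> w; exact: post_bounded.
have H := ge0_EY_post mC bC.
have : \int[P]_w (post phi (obs h theta noise w) + C) = \int[P]_w (phi (theta w) + C).
  rewrite {1}/Rintegral /Rintegral; congr fine; rewrite -H.
  apply: ae_eq_integral => //.
  - by apply/measurable_EFinP; apply: measurable_funD => //; exact: mpo.
  - by apply/measurable_EFinP; exact: mpo.
  exists [set w | rY (obs h theta noise w) <= 0]; split.
  - rewrite (_ : [set w | _] = obs h theta noise @^-1` (rY @^-1` `]-oo, 0]%classic)).
      apply: measurable_preimageT => //.
      rewrite -[X in measurable X]setTI.
      exact: (measurable_rhoY theta mh noise_rho).
    by apply/seteqP; split => w /=; rewrite in_itv.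
  - exact: (rhoY_obs_gt0 mh noise_rho noise_indep).
  - move=> w /=; apply: contra_notP => /negP; rewrite -ltNge => y0 _.
    set y := obs h theta noise w; congr EFin.
    rewrite (postE mC (C := C + C)); last first.
      by move=> x; have /andP[h1 h2] := bC x; rewrite ger0_norm.
    under eq_Rintegral do rewrite mulrDl.
    rewrite RintegralD//; last 2 first.
    + exact: integrable_bounded_ratio.
    + rewrite (_ : _ \o _ = (fun w => C%:E * (lratio y (theta w))%:E)%E)//.
      by apply: integrableZl => //; exact: integrable_ratio.
    rewrite -(postE mphi phiC) RintegralZl//; last exact: integrable_ratio.
    by rewrite Rintegral_ratio divff ?mulr1// gt_eqF.
rewrite !RintegralD//; [|exact: integrable_cstR|exact: integrable_cstR].
by move/addIr.
Qed.

End posterior.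

(** * Moments of sums of conditionally centred variables *)

Section state_chain.
Context {d d0 d2 dS : measure_display} {Om : measurableType d} {R : realType}
  (P : probability Om R) {T0 : measurableType d0} {T2 : measurableType d2}
  {S : measurableType dS}.
Variables (s0 : T0 -> S) (upd : S * T2 -> S).
Hypotheses (ms0 : measurable_fun setT s0) (mupd : measurable_fun setT upd).

(** A function of Y and of a block of draws is presented as a fold, so that independence and
    equality of law are proved by adding one draw at a time. *)
Fixpoint chain (Y : {mfun Om >-> T0}) (th : nat -> {mfun Om >-> T2})
    (a n : nat) : Om -> S :=
  if n is n'.+1 then fun w => upd (chain Y th a n' w, th (a + n')%N w)
  else fun w => s0 (Y w).

Lemma measurable_chain Y th a n : measurable_fun setT (chain Y th a n).
Proof.
elim: n => [|n IH] /=; first exact: measurableT_comp ms0 _.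
by apply: (measurableT_comp mupd); exact: measurable_fun_pair.
Qed.

Definition chainRV Y th a n : {mfun Om >-> S} := mkRV (measurable_chain Y th a n).

Lemma tail_indep_chain (Y : {mfun Om >-> T0}) (th : nat -> {mfun Om >-> T2})
    (N a n : nat) :
  (forall n, (n < N)%N -> tail_indep P th N n.+1 (th n)) ->
  tail_indep P th N a Y -> (a + n <= N)%N ->
  tail_indep P th N (a + n) (chain Y th a n).
Proof.
move=> thi Yi; elim: n => [|n IH] aN /=.
  by rewrite addn0; exact: (tail_indep_comp ms0 Yi).
rewrite addnS in aN *.
have W := IH (ltnW aN).
exact: (tail_indep_comp mupd (tail_indep_pair thi (W := chainRV Y th a n) aN W)).
Qed.

(** By induction on n: the state is independent of the next draw, so the law of the pair is the
    product of two laws that coincide for both chains. *)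
Lemma same_law_chain (Y : {mfun Om >-> T0}) (th : nat -> {mfun Om >-> T2})
    (N a : nat) (Y' : {mfun Om >-> T0}) (th' : nat -> {mfun Om >-> T2})
    (N' a' n : nat) :
  (forall n, (n < N)%N -> tail_indep P th N n.+1 (th n)) ->
  tail_indep P th N a Y -> (a + n <= N)%N ->
  (forall n, (n < N')%N -> tail_indep P th' N' n.+1 (th' n)) ->
  tail_indep P th' N' a' Y' -> (a' + n <= N')%N ->
  same_law P Y Y' ->
  (forall i j, (i < N)%N -> (j < N')%N -> same_law P (th i) (th' j)) ->
  same_law P (chain Y th a n) (chain Y' th' a' n).
Proof.
move=> thi Yi aN thi' Yi' aN' YY thth; elim: n aN aN' => [|n IH] aN aN'.
  exact: (same_law_comp ms0 YY).
rewrite addnS in aN; rewrite addnS in aN'.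
have W := tail_indep_chain thi Yi (ltnW aN).
have W' := tail_indep_chain thi' Yi' (ltnW aN').
have E := IH (ltnW aN) (ltnW aN').
apply: (@same_law_comp _ _ _ P _ _ _ _ (RVpair (chainRV Y th a n) (th (a + n)%N))
  (RVpair (chainRV Y' th' a' n) (th' (a' + n)%N)) upd mupd) => A mA.
rewrite !indep_pair_law//.
- apply: product_measure_unique => // B C mB mC.
  apply: (etrans (product_measure1E _ _ mB mC)).
  by congr (_ * _)%E; apply/esym; [exact: E|exact: thth].
- exact: (tail_indep_pairE (W := chainRV Y' th' a' n) aN' W').
- exact: (tail_indep_pairE (W := chainRV Y th a n) aN W).
Qed.

End state_chain.

Section moments.
Context {d d0 d2 : measure_display} {Om : measurableType d} {R : realType}
  (P : probability Om R) {T0 : measurableType d0} {T2 : measurableType d2}.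
Variables (Y : {mfun Om >-> T0}) (th : nat -> {mfun Om >-> T2}) (N a : nat).
Hypothesis th_indep : forall n, (n < N)%N -> tail_indep P th N n.+1 (th n).
Hypothesis Y_indep : tail_indep P th N a Y.
Variable Z : T0 * T2 -> R.
Hypothesis mZ : measurable_fun setT Z.
Hypothesis iZ : forall y n, (n < N)%N ->
  P.-integrable setT (EFin \o (fun w => Z (y, th n w))).
Hypothesis Z0 : forall y n, (n < N)%N -> \int[P]_w Z (y, th n w) = 0.
Variables (e B : R).
Hypothesis e01 : 0 <= e <= 1.
Hypothesis ZB : forall n, (n < N)%N ->
  (\int[P]_w (`|Z (Y w, th n w)| `^ (2 + e))%:E <= B%:E)%E.

Definition partial_sum (n : nat) (w : Om) : R :=
  \sum_(a <= m < a + n) Z (Y w, th m w).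

Let e0 : 0 <= e. Proof. by case/andP: e01. Qed.
Let q0 : 0 <= 2 + e. Proof. by rewrite addr_ge0. Qed.

Let s0 (y : T0) : T0 * R := (y, 0).
(** Y stays in the state beside the running sum because the next summand depends on it. *)
Let upd (z : (T0 * R) * T2) : T0 * R := (z.1.1, z.1.2 + Z (z.1.1, z.2)).

Let ms0 : measurable_fun setT s0.
Proof. exact: measurable_fun_pair. Qed.

Let m11 : measurable_fun setT (fun z : (T0 * R) * T2 => z.1.1).
Proof. exact: measurableT_comp measurable_fst measurable_fst. Qed.

Let m12 : measurable_fun setT (fun z : (T0 * R) * T2 => z.1.2).
Proof. exact: measurableT_comp measurable_snd measurable_fst. Qed.

Let mZ1 : measurable_fun setT (fun z : (T0 * R) * T2 => Z (z.1.1, z.2)).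
Proof.
apply: (measurableT_comp mZ); apply: measurable_fun_pair => //.
Qed.

Let mupd : measurable_fun setT upd.
Proof. by apply: measurable_fun_pair => //; exact: measurable_funD. Qed.

Let chainE n : chain s0 upd Y th a n = fun w => (Y w, partial_sum n w).
Proof.
elim: n => [|n IH] /=; apply/funext => w.
  by rewrite /partial_sum addn0 big_geq.
by rewrite IH /upd /= /partial_sum addnS big_nat_recr//= leq_addr.
Qed.

Lemma measurable_partial_sum n : measurable_fun setT (partial_sum n).
Proof.
have := measurable_chain ms0 mupd Y th a n; rewrite chainE.
by move=> h; exact: (measurableT_comp measurable_snd h).
Qed.

Let mterm n : measurable_fun setT (fun w => Z (Y w, th n w)).
Proof. by apply: (measurableT_comp mZ); exact: measurable_fun_pair. Qed.

Let mpow (g : Om -> R) : measurable_fun setT g ->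
  measurable_fun setT (fun w => `|g w| `^ (2 + e)).
Proof.
move=> mg; apply: (measurableT_comp (measurable_powR (2 + e))).
exact: measurableT_comp.
Qed.

Let iterm n : (n < N)%N ->
  P.-integrable setT (EFin \o (fun w => `|Z (Y w, th n w)| `^ (2 + e))).
Proof.
move=> nN; apply/integrableP; split; first by apply/measurable_EFinP; exact: mpow.
under eq_integral do rewrite /= ger0_norm ?powR_ge0//.
exact: le_lt_trans (ZB nN) (ltry _).
Qed.

Lemma integrable_partial_sum n : (a + n <= N)%N ->
  P.-integrable setT (EFin \o (fun w => `|partial_sum n w| `^ (2 + e))).
Proof.
elim: n => [|n IH] aN.
  rewrite (_ : _ \o _ = cst 0%E) ?integrable0//; apply/funext => w /=.
  rewrite /partial_sum addn0 big_geq// normr0 powR0// gt_eqF//.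
  by rewrite ltr_pwDl.
rewrite addnS in aN.
apply: (integrable_dominated (g := fun w => 2 `^ (2 + e) *
   (`|partial_sum n w| `^ (2 + e) + `|Z (Y w, th (a + n)%N w)| `^ (2 + e)))).
- by apply: mpow; exact: measurable_partial_sum.
- move=> w; rewrite ger0_norm ?powR_ge0// {1}/partial_sum addnS big_nat_recr ?leq_addr//=.
  exact: powR_normD_le q0.
- rewrite (_ : _ \o _ = (fun w => (2 `^ (2 + e))%R%:E *
    ((EFin \o (fun w => `|partial_sum n w| `^ (2 + e))%R) \+
     (EFin \o (fun w => `|Z (Y w, th (a + n)%N w)| `^ (2 + e))%R)) w)%E)//.
  apply: integrableZl => //; apply: integrableD => //; first exact: (IH (ltnW aN)).
  exact: iterm.
Qed.

Let cross n w := `|partial_sum n w| `^ e * partial_sum n w * Z (Y w, th (a + n)%N w).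

Let mcross n : measurable_fun setT (cross n).
Proof.
apply: measurable_funM => //; apply: measurable_funM; last exact: measurable_partial_sum.
apply: (measurableT_comp (measurable_powR e)).
by apply: measurableT_comp => //; exact: measurable_partial_sum.
Qed.

Lemma cross_le (x z : R) : `|(`|x| `^ e * x * z)| <= `|x| `^ (2 + e) + `|z| `^ (2 + e).
Proof.
rewrite !normrM (ger0_norm (powR_ge0 _ _)) !(ge0_powR_2D e0)//.
have [xz|zx] := leP `|x| `|z|.
  apply: (@le_trans _ _ (`|z| `^ e * `|z| ^+ 2)); last first.
    by rewrite lerDr mulr_ge0 ?powR_ge0.
  by rewrite expr2 mulrA; do 2 (apply: ler_pM; rewrite ?mulr_ge0 ?powR_ge0//); exact: ler_powRl.
apply: (@le_trans _ _ (`|x| `^ e * `|x| ^+ 2)); last first.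
  by rewrite lerDl mulr_ge0 ?powR_ge0.
by rewrite expr2 mulrA; apply: ler_pM; rewrite ?mulr_ge0 ?powR_ge0// ltW.
Qed.

Let icross n : (a + n < N)%N -> P.-integrable setT (EFin \o cross n).
Proof.
move=> aN; apply: (integrable_dominated (g := fun w =>
   `|partial_sum n w| `^ (2 + e) + `|Z (Y w, th (a + n)%N w)| `^ (2 + e))) => //.
  by move=> w; exact: cross_le.
rewrite (_ : _ \o _ =
    ((EFin \o (fun w => `|partial_sum n w| `^ (2 + e))%R) \+
     (EFin \o (fun w => `|Z (Y w, th (a + n)%N w)| `^ (2 + e))%R))%E)//.
apply: integrableD => //; first exact: (integrable_partial_sum (ltnW aN)).
exact: iterm.
Qed.

(** The state (Y, partial sum) is independent of the next draw. With the state frozen, the inner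
    integral is a constant times the mean of Z(y, .), which is 0. *)
Lemma Rintegral_cross n : (a + n < N)%N -> \int[P]_w cross n w = 0.
Proof.
move=> aN.
have W := tail_indep_chain ms0 mupd th_indep Y_indep (ltnW aN).
pose Phi (z : (T0 * R) * T2) := (`|z.1.2| `^ e * z.1.2 * Z (z.1.1, z.2))%:E.
have mPhi : measurable_fun setT Phi.
  apply/measurable_EFinP; apply: measurable_funM => //; apply: measurable_funM => //.
  apply: (measurableT_comp (measurable_powR e)).
  exact: measurableT_comp.
have PhiE w : (cross n w)%:E = Phi (chainRV ms0 mupd Y th a n w, th (a + n)%N w).
  by rewrite /= chainE.
rewrite /Rintegral.
under eq_integral do rewrite PhiE.
rewrite indep_integral//; last 2 first.
- exact: (tail_indep_pairE (W := chainRV ms0 mupd Y th a n) aN W).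
- apply: eq_integrable (icross aN) => // w _; exact: PhiE.
rewrite integral0_eq// => w _.
set v := chainRV ms0 mupd Y th a n w.
transitivity (\int[P]_w' ((`|v.2| `^ e * v.2)%:E * (Z (v.1, th (a + n)%N w'))%:E))%E.
  by apply: eq_integral => w' _; rewrite -EFinM.
rewrite integralZl//; last exact: iZ.
by rewrite -EFin_Rintegral ?Z0 ?mule0//; exact: iZ.
Qed.

Lemma partial_sum_moment n : (0 < n)%N -> (a + n <= N)%N ->
  (\int[P]_w (`|partial_sum n w| `^ (2 + e))%:E <=
    (78 * n%:R `^ (1 + e / 2) * B)%:E)%E.
Proof.
move=> n0 aN.
have aN0 : (a < N)%N by apply: leq_trans aN; rewrite -[X in (X < _)%N]addn0 ltn_add2l.
have B0 : 0 <= B.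
  by rewrite -lee_fin (le_trans _ (ZB aN0))// integral_ge0// => w _; rewrite lee_fin powR_ge0.
(* Beyond the last draw the moment is frozen, so that the recursion holds for all n, as
   [moment_recursion] asks. *)
pose u n := \int[P]_w (`|partial_sum (minn n (N - a)) w| `^ (2 + e)).
have uE m : (a + m <= N)%N -> u m = \int[P]_w (`|partial_sum m w| `^ (2 + e)).
  move=> amN; rewrite /u.
  suff -> : minn m (N - a) = m by [].
  by apply/minn_idPl; rewrite leq_subRL// (ltnW aN0).
rewrite -EFin_Rintegral; last exact: integrable_partial_sum.
rewrite lee_fin -uE//.
suff : forall m, (0 < m)%N -> u m <= 78 * m%:R `^ (1 + e / 2) * B
  by move=> H; exact: (H n n0).
apply: (moment_recursion e01 B0).
  rewrite uE; last by rewrite addn1.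
  rewrite -lee_fin EFin_Rintegral; last by apply: integrable_partial_sum; rewrite addn1.
  apply: le_trans (ZB aN0); rewrite le_eqVlt; apply/orP; left; apply/eqP.
  by apply: eq_integral => w _; rewrite /partial_sum addn1 big_nat1.
move=> m m0.
have um0 : 0 <= u m by apply: Rintegral_ge0 => w _; rewrite powR_ge0.
have c0 : 0 <= 39 * m%:R `^ (e / 2) * B by rewrite !mulr_ge0 ?powR_ge0.
have [amN|Nam] := ltnP (a + m) N; last first.
  have -> : u m.+1 = u m.
    have Nm : (N - a <= m)%N by rewrite leq_subLR.
    by rewrite /u (minn_idPr Nm) (minn_idPr (leqW Nm)).
  rewrite -[leLHS]addr0 lerD// ler_peMr// lerDl invr_ge0 mulr_ge0//.
rewrite !uE ?addnS// ?(ltnW amN)//.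
have m1 : 1 <= m%:R :> R by rewrite ler1n.
pose g w := `|partial_sum m w| `^ (2 + e) * (1 + (2 * m%:R)^-1) +
  (2 + e) * cross m w + 39 * m%:R `^ (e / 2) * `|Z (Y w, th (a + m)%N w)| `^ (2 + e).
have i1 : P.-integrable setT (EFin \o (fun w =>
    `|partial_sum m w| `^ (2 + e) * (1 + (2 * m%:R)^-1))).
  rewrite (_ : _ \o _ = (fun w => (1 + (2 * m%:R)^-1)%R%:E *
    (`|partial_sum m w| `^ (2 + e))%R%:E)%E); last first.
    by apply/funext => w /=; rewrite mulrC EFinM.
  by apply: integrableZl => //; exact: (integrable_partial_sum (ltnW amN)).
have i2 : P.-integrable setT (EFin \o (fun w => (2 + e) * cross m w)).
  rewrite (_ : _ \o _ = (fun w => (2 + e)%R%:E * (cross m w)%:E)%E)//.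
  by apply: integrableZl => //; exact: icross.
have i3 : P.-integrable setT (EFin \o (fun w =>
    39 * m%:R `^ (e / 2) * `|Z (Y w, th (a + m)%N w)| `^ (2 + e))).
  rewrite (_ : _ \o _ = (fun w => (39 * m%:R `^ (e / 2))%R%:E *
    (`|Z (Y w, th (a + m)%N w)| `^ (2 + e))%R%:E)%E)//.
  by apply: integrableZl => //; exact: iterm.
have i12 : P.-integrable setT (EFin \o (fun w =>
    `|partial_sum m w| `^ (2 + e) * (1 + (2 * m%:R)^-1) + (2 + e) * cross m w)).
  exact: (integrableD measurableT i1 i2).
apply: (@le_trans _ _ (\int[P]_w g w)).
  apply: le_Rintegral => //.
  - by apply: integrable_partial_sum; rewrite addnS.
  - exact: (integrableD measurableT i12 i3).
  - move=> w _; rewrite {1}/partial_sum addnS big_nat_recr ?leq_addr//=.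
    exact: powR_add_le.
rewrite RintegralD// RintegralD// RintegralZr//; last exact: (integrable_partial_sum (ltnW amN)).
rewrite RintegralZl//; last exact: icross.
rewrite Rintegral_cross// mulr0 addr0 RintegralZl//; last exact: iterm.
rewrite lerD2l ler_wpM2l ?mulr_ge0 ?powR_ge0//.
by rewrite -lee_fin EFin_Rintegral; [exact: ZB|exact: iterm].
Qed.

End moments.

(** * Ratio estimators for fixed draws *)

Section maxD_lemmas.
Context {R : realType} {D : finType}.
Implicit Types (a b : D -> R) (d : D).

Lemma maxD_ge d0 a d : a d <= maxD d0 a.
Proof. by rewrite /maxD (bigD1 d)//= le_max lexx. Qed.

Lemma maxD_attained d0 a : exists d, maxD d0 a = a d.
Proof.
rewrite /maxD; elim: (index_enum D) => [|i l [d IH]]; first by exists d0; rewrite big_nil.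
rewrite big_cons; have [ai|ai] := leP (a i) (\big[Num.max/a d0]_(j <- l) a j).
  by exists d.
by exists i.
Qed.

Lemma maxD_le d0 a C : (forall d, a d <= C) -> maxD d0 a <= C.
Proof. by move=> aC; have [d ->] := maxD_attained d0 a. Qed.

Lemma maxD_eq d0 a d : (forall d', a d' <= a d) -> maxD d0 a = a d.
Proof. by move=> ad; apply/eqP; rewrite eq_le maxD_le//= maxD_ge. Qed.

Lemma maxD_dist d0 a b C : (forall d, `|a d - b d| <= C) ->
  `|maxD d0 a - maxD d0 b| <= C.
Proof.
move=> abC; rewrite ler_norml; apply/andP; split.
  rewrite lerBrDl addrC -lerBrDl opprK addrC; apply: maxD_le => d.
  have := abC d; rewrite ler_norml => /andP[h _].
  have := maxD_ge d0 a d; lra.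
rewrite lerBlDr; apply: maxD_le => d.
have := abC d; rewrite ler_norml => /andP[_ h].
have := maxD_ge d0 b d; lra.
Qed.

Lemma maxD_bounded d0 a C : (forall d, `|a d| <= C) -> `|maxD d0 a| <= C.
Proof. by move=> aC; have [d ->] := maxD_attained d0 a. Qed.

Lemma powR_sum_le (j : D) (u : D -> R) q : 0 <= q -> (forall i, 0 <= u i) ->
  (\sum_i u i) `^ q <= #|D|%:R `^ q * \sum_i u i `^ q.
Proof.
move=> q0 u0; have [k uk] := maxD_attained j u.
have ule i : u i <= u k by rewrite -uk maxD_ge.
apply: (@le_trans _ _ ((#|D|%:R * u k) `^ q)).
  apply: ler_powRl => //; first exact: sumr_ge0.
  rewrite mulr_natl -sumr_const; apply: ler_sum => i _; exact: ule.
rewrite powRM// ler_wpM2l ?powR_ge0// (bigD1 k)//= lerDl sumr_ge0// => i _.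
exact: powR_ge0.
Qed.

End maxD_lemmas.

Section weighted_means.
Context {R : realType} {s t : nat}.
Variables (h : 'rV[R]_s -> 'rV[R]_t) (rho : 'rV[R]_t -> R).
Hypothesis rho0 : forall y, 0 <= rho y.
Variables (y : 'rV[R]_t) (x : nat -> 'rV[R]_s).
Implicit Types (a b : nat) (phi : 'rV[R]_s -> R).

Let l u := lik h rho y u.
Let l0 u : 0 <= l u. Proof. exact: rho0. Qed.

Definition wsum a b phi := \sum_(a <= m < b) phi (x m) * l (x m).

Definition wmean a b phi :=
  savg a b x (fun u => phi u * lik h rho y u) / savg a b x (lik h rho y).

Lemma wmeanE a b phi : (a < b)%N ->
  wmean a b phi = wsum a b phi / wsum a b (fun=> 1).
Proof.
move=> ab; rewrite /wmean /savg -mulf_div divff; last first.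
  by rewrite invr_eq0 pnatr_eq0 subn_eq0 -ltnNge.
by rewrite mulr1; congr (_ / _); apply: eq_bigr => i _; rewrite mul1r.
Qed.

Lemma wsum1_ge0 a b : 0 <= wsum a b (fun=> 1).
Proof. by apply: sumr_ge0 => i _; rewrite mul1r. Qed.

Lemma wsum_le a b phi C : (forall u, `|phi u| <= C) ->
  `|wsum a b phi| <= C * wsum a b (fun=> 1).
Proof.
move=> phiC; rewrite (le_trans (ler_norm_sum _ _ _))// mulr_sumr ler_sum// => i _.
by rewrite normrM (ger0_norm (l0 _)) mul1r ler_wpM2r.
Qed.

Lemma wmean_bounded a b phi C : (a < b)%N -> (forall u, `|phi u| <= C) ->
  `|wmean a b phi| <= C.
Proof.
move=> ab phiC; rewrite wmeanE// normrM normfV (ger0_norm (wsum1_ge0 _ _)).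
have [->|w0] := eqVneq (wsum a b (fun=> 1)) 0.
  by rewrite invr0 mulr0; exact: le_trans (phiC 0).
by rewrite ler_pdivrMr ?wsum_le// lt0r w0 wsum1_ge0.
Qed.

Variable r : R.
Hypothesis r0 : 0 < r.

Let X u := l u / r.

(** With r = [rhoY] y, X is the normalised likelihood [lratio], of prior mean 1. Here r is any
    positive number and the draws are fixed, so the estimates are purely algebraic. *)
Definition dev a b phi G := `|\sum_(a <= m < b) (phi (x m) - G) * X (x m)| / (b - a)%:R.

Definition dev1 a b := `|\sum_(a <= m < b) (X (x m) - 1)| / (b - a)%:R.

Lemma dev1E a b : (a < b)%N ->
  dev1 a b = `|wsum a b (fun=> 1) / (r * (b - a)%:R) - 1|.
Proof.
move=> ab; have n0 : 0 < (b - a)%:R :> R by rewrite ltr0n subn_gt0.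
rewrite /dev1 sumrB sumr_const_nat -(gtr0_norm n0) -normf_div gtr0_norm//.
congr `|_|; rewrite mulrBl divff ?gt_eqF//; congr (_ - _).
rewrite invfM mulrA; congr (_ / _); rewrite mulr_suml; apply: eq_bigr => i _.
by rewrite mul1r.
Qed.

(* If the normalised total weight is below 1/2, dev1 is at least 1/2. *)
Lemma wmean_dist a b phi C G : (a < b)%N -> (forall u, `|phi u| <= C) ->
  `|G| <= C -> `|wmean a b phi - G| <= 2 * dev a b phi G + 4 * C * dev1 a b.
Proof.
move=> ab phiC GC.
have n0 : 0 < (b - a)%:R :> R by rewrite ltr0n subn_gt0.
have C0 : 0 <= C by exact: le_trans GC.
have dev0 : 0 <= dev a b phi G by rewrite divr_ge0.
have dev10 : 0 <= dev1 a b by rewrite divr_ge0.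
pose W := wsum a b (fun=> 1) / (r * (b - a)%:R).
have [W2|W2] := leP 2^-1 W.
  have W0 : 0 < wsum a b (fun=> 1).
    rewrite lt0r wsum1_ge0 andbT; apply/eqP => w0.
    by move: W2; rewrite /W w0 mul0r; lra.
  have E : wmean a b phi - G =
      (\sum_(a <= m < b) (phi (x m) - G) * X (x m)) / (b - a)%:R / W.
    rewrite wmeanE//.
    have -> : \sum_(a <= m < b) (phi (x m) - G) * X (x m) =
        (wsum a b phi - G * wsum a b (fun=> 1)) / r.
      rewrite mulr_sumr -sumrB mulr_suml; apply: eq_bigr => i _.
      by rewrite /X mul1r -mulrBl mulrA.
    by rewrite /W; field; rewrite !gt_eqF.
  rewrite E !normrM !normfV (gtr0_norm n0) -/(dev a b phi G).
  apply: (@le_trans _ _ (2 * dev a b phi G)); last by rewrite lerDl !mulr_ge0.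
  have Wp : 0 < W by lra.
  rewrite (gtr0_norm Wp) ler_pdivrMr// mulrAC ler_peMl//; lra.
have d2 : 2^-1 <= dev1 a b by rewrite dev1E// -/W distrC ler_normr; lra.
apply: (@le_trans _ _ (4 * C * dev1 a b)); last by rewrite lerDr mulr_ge0.
apply: (@le_trans _ _ (C + C)).
  by rewrite (le_trans (ler_normB _ _))// lerD// wmean_bounded.
nra.
Qed.

(* The antithetic difference of ratios: with total weights A and B of the two
   halves it equals (A - B) (mean_a - mean_b) / (2 (A + B)). *)
Lemma wmean_antithetic M phi : (0 < M)%N ->
  `|wmean 0 (M + M) phi - 2^-1 * (wmean 0 M phi + wmean M (M + M) phi)| <=
  2^-1 * (dev1 0 M + dev1 M (M + M)) * `|wmean 0 M phi - wmean M (M + M) phi|.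
Proof.
move=> M0.
have M2 : (M < M + M)%N by rewrite -[X in (X < _)%N]addn0 ltn_add2l.
have M02 : (0 < M + M)%N by exact: leq_trans M2.
rewrite !wmeanE// !dev1E// subn0 addnK.
have cat psi : wsum 0 (M + M) psi = wsum 0 M psi + wsum M (M + M) psi.
  by rewrite /wsum (@big_cat_nat _ _ _ M)//= ltnW.
rewrite !cat.
set A := wsum 0 M (fun=> 1); set B := wsum M (M + M) (fun=> 1).
set a := wsum 0 M phi; set b := wsum M (M + M) phi.
have A0 : 0 <= A by exact: wsum1_ge0.
have B0 : 0 <= B by exact: wsum1_ge0.
(* A half of total weight 0 has only zero weights, so its weighted sum vanishes and a = A (a / A)
   holds under 0/0 = 0 as well. The sum of the |phi (x i)| serves as a bound of phi at the finitely
   many draws. *)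
have az : A = 0 -> a = 0.
  have [C phiC] : exists C, forall m, (m < M)%N -> `|phi (x m)| <= C.
    exists (\sum_(i < M) `|phi (x i)|) => m mM.
    by rewrite (bigD1 (Ordinal mM))//= lerDl sumr_ge0.
  move=> A00; apply/eqP; rewrite -normr_le0.
  have -> : 0 = C * A by rewrite A00 mulr0.
  rewrite (le_trans (ler_norm_sum _ _ _))// mulr_sumr !big_nat ler_sum// => i /andP[_ iM].
  by rewrite normrM (ger0_norm (l0 _)) mul1r ler_wpM2r// phiC.
have bz : B = 0 -> b = 0.
  have [C phiC] : exists C, forall m, (m < M + M)%N -> `|phi (x m)| <= C.
    exists (\sum_(i < M + M) `|phi (x i)|) => m mM.
    by rewrite (bigD1 (Ordinal mM))//= lerDl sumr_ge0.
  move=> B00; apply/eqP; rewrite -normr_le0.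
  have -> : 0 = C * B by rewrite B00 mulr0.
  rewrite (le_trans (ler_norm_sum _ _ _))// mulr_sumr !big_nat ler_sum// => i /andP[_ iM].
  by rewrite normrM (ger0_norm (l0 _)) mul1r ler_wpM2r// phiC.
pose k := r * M%:R.
have k0 : 0 < k by rewrite mulr_gt0// ltr0n.
rewrite -/k.
have [AB|AB] := eqVneq (A + B) 0.
  have A00 : A = 0 by lra.
  have B00 : B = 0 by lra.
  by rewrite az// bz// A00 B00 !(mul0r, addr0, mulr0, subr0, normr0).
have ABp : 0 < A + B by rewrite lt0r AB addr_ge0.
have -> : (a + b) / (A + B) - 2^-1 * (a / A + b / B) =
    2^-1 * ((A - B) / (A + B)) * (a / A - b / B).
  have ea : a = A * (a / A).
    by have [A00|A00] := eqVneq A 0; [rewrite A00 mul0r az|rewrite mulrC divfK].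
  have eb : b = B * (b / B).
    by have [B00|B00] := eqVneq B 0; [rewrite B00 mul0r bz|rewrite mulrC divfK].
  move: ea eb; set u := a / A; set v := b / B => -> ->.
  by field.
rewrite normrM ler_wpM2r// normrM gtr0_norm// ler_wpM2l//.
rewrite normrM normfV (gtr0_norm ABp) ler_pdivrMr//.
have -> : A = k * (A / k) by rewrite mulrC divfK// gt_eqF.
have -> : B = k * (B / k) by rewrite mulrC divfK// gt_eqF.
rewrite ![k * (_ / k) / k]mulrAC divff ?gt_eqF// !mul1r.
set u := A / k; set v := B / k.
have u0 : 0 <= u by rewrite divr_ge0// ltW.
have v0 : 0 <= v by rewrite divr_ge0// ltW.
rewrite -mulrBr -mulrDr normrM (gtr0_norm k0) [leRHS]mulrCA ler_wpM2l ?(ltW k0)//.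
(* The claim is |u - v| <= (|u - 1| + |v - 1|)(u + v). If u + v >= 1 the triangle inequality
   suffices; otherwise the first factor is at least 1 and |u - v| <= u + v. *)
have h1 : `|u - v| <= `|u - 1| + `|v - 1|.
  by rewrite (distrC v 1) -[u - v](subrKA 1) ler_normD.
have h2 : `|u - v| <= u + v.
  by rewrite ler_norml; apply/andP; split; lra.
have n1 := ler_norm (1 - u); have n2 := ler_norm (1 - v).
rewrite distrC in n1; rewrite distrC in n2.
have [uv|uv] := leP 1 (u + v).
  by rewrite (le_trans h1)// ler_peMr// addr_ge0.
rewrite (le_trans h2)// ler_peMl ?addr_ge0//; lra.
Qed.

End weighted_means.

Section correction_bounds.
Context {R : realType} {s t : nat} {D : finType}.
Variables (d0 : D) (f : D -> 'rV[R]_s -> R).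
Variables (h : 'rV[R]_s -> 'rV[R]_t) (rho : 'rV[R]_t -> R).
Hypothesis rho0 : forall y, 0 <= rho y.
Variables (M0 : nat) (M0_gt0 : (0 < M0)%N).
Variables (F : R) (fF : forall d u, `|f d u| <= F).
Variables (y : 'rV[R]_t) (x : nat -> 'rV[R]_s).

Let fm u := maxD d0 (f ^~ u).
Let fmF u : `|fm u| <= F. Proof. exact: maxD_bounded. Qed.

Lemma Mlev_gt0 l : (0 < Mlev M0 l)%N.
Proof. by rewrite /Mlev muln_gt0 M0_gt0 expn_gt0. Qed.

Lemma MlevS l : Mlev M0 l.+1 = (Mlev M0 l + Mlev M0 l)%N.
Proof. by rewrite /Mlev expnS mulnCA mul2n addnn. Qed.

Lemma gbarE a b d : gbar f h rho a b y x d = wmean h rho y x a b (f d).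
Proof. by []. Qed.

Lemma gmaxbarE a b : gmaxbar d0 f h rho a b y x = wmean h rho y x a b fm.
Proof. by []. Qed.

Lemma maxD_gbar_bounded a b : (a < b)%N -> `|maxD d0 (gbar f h rho a b y x)| <= F.
Proof. by move=> ab; apply: maxD_bounded => d; rewrite gbarE wmean_bounded. Qed.

Lemma DeltaP_bounded l : `|DeltaP d0 f h rho M0 l y x| <= 4 * F.
Proof.
have F0 : 0 <= F by exact: le_trans (fF d0 0).
have B1 a b : (a < b)%N -> `|gmaxbar d0 f h rho a b y x| <= F.
  by move=> ab; rewrite gmaxbarE wmean_bounded.
have B2 := maxD_gbar_bounded.
case: l => [|k] /=.
  have := B1 _ _ (Mlev_gt0 0); have := B2 _ _ (Mlev_gt0 0).
  by rewrite !ler_norml => /andP[? ?] /andP[? ?]; apply/andP; split; lra.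
have kk : (Mlev M0 k < Mlev M0 k.+1)%N.
  by rewrite MlevS -[X in (X < _)%N]addn0 ltn_add2l Mlev_gt0.
have := B1 _ _ (Mlev_gt0 k.+1); have := B2 _ _ (Mlev_gt0 k.+1).
have := B1 _ _ (Mlev_gt0 k); have := B2 _ _ (Mlev_gt0 k).
have := B1 _ _ kk; have := B2 _ _ kk.
rewrite !ler_norml; do 6 move=> /andP[? ?]; apply/andP; split; lra.
Qed.

Variables (G : D -> R) (Gm : R).

Definition close_means (e : R) (a b : nat) : Prop :=
  (forall d, `|wmean h rho y x a b (f d) - G d| <= e) /\
  `|wmean h rho y x a b fm - Gm| <= e.

Lemma close_means_dist e a b : close_means e a b ->
  `|gmaxbar d0 f h rho a b y x - maxD d0 (gbar f h rho a b y x) -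
    (Gm - maxD d0 G)| <= 2 * e.
Proof.
move=> [H1 H2]; rewrite gmaxbarE.
have := @maxD_dist _ _ d0 (gbar f h rho a b y x) G _ H1.
by move: H2; rewrite !ler_norml => /andP[? ?] /andP[? ?]; apply/andP; split; lra.
Qed.

Variables (k : nat) (e : R).
Let M := Mlev M0 k.
Hypotheses (c1 : close_means e 0 M) (c2 : close_means e M (M + M))
  (c3 : close_means e 0 (M + M)).

(** The posterior value Gm - max G enters with coefficients 1, -1/2, -1/2 and cancels; only the
    three errors of size 2e remain. *)
Lemma DeltaP_le_close : `|DeltaP d0 f h rho M0 k.+1 y x| <= 4 * e.
Proof.
rewrite /= MlevS -/M.
have := close_means_dist c1; have := close_means_dist c2.
have := close_means_dist c3.
by rewrite !ler_norml; do 3 move=> /andP[? ?]; apply/andP; split; lra.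
Qed.

Variables (r : R) (r0 : 0 < r).
Hypothesis d1e : dev1 h rho y x r 0 M + dev1 h rho y x r M (M + M) <= e.

Lemma DeltaP_le_gap dopt : (forall d, d != dopt -> G d + 2 * e <= G dopt) ->
  `|DeltaP d0 f h rho M0 k.+1 y x| <= 2 * e ^+ 2.
Proof.
move=> gap; rewrite /= MlevS -/M !gmaxbarE.
have Mp : (0 < M)%N by exact: Mlev_gt0.
have mx a b : close_means e a b ->
    maxD d0 (gbar f h rho a b y x) = wmean h rho y x a b (f dopt).
  move=> [H _]; apply: (@maxD_eq _ _ d0 _ dopt) => d; rewrite !gbarE.
  have [->//|dd] := eqVneq d dopt.
  have := gap _ dd; have := H d; have := H dopt.
  by rewrite !ler_norml => /andP[? ?] /andP[? ?] ?; lra.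
rewrite !mx//.
have e0 : 0 <= e by case: c1 => H _; exact: le_trans (H d0).
have anti phi g : `|wmean h rho y x 0 M phi - g| <= e ->
    `|wmean h rho y x M (M + M) phi - g| <= e ->
    `|wmean h rho y x 0 (M + M) phi -
      2^-1 * (wmean h rho y x 0 M phi + wmean h rho y x M (M + M) phi)| <= e ^+ 2.
  move=> H1 H2; apply: (le_trans (wmean_antithetic h rho0 y x r0 phi Mp)).
  set a := wmean _ _ _ _ 0 M _; set b := wmean _ _ _ _ M _ _.
  have ab : `|a - b| <= 2 * e.
    by move: H1 H2; rewrite -/a -/b !ler_norml => /andP[? ?] /andP[? ?]; apply/andP; split; lra.
  have -> : e ^+ 2 = 2^-1 * e * (2 * e) by rewrite expr2; field.
  apply: ler_pM => //.
    by rewrite mulr_ge0// addr_ge0// divr_ge0.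
  by rewrite ler_wpM2l.
have := anti fm Gm (proj2 c1) (proj2 c2).
have := anti (f dopt) (G dopt) (proj1 c1 dopt) (proj1 c2 dopt).
by rewrite !ler_norml => /andP[? ?] /andP[? ?]; apply/andP; split; lra.
Qed.

End correction_bounds.

(** * Ratio estimators for random draws *)

Section distance_measurability.
Context {R : realType} {n : nat}.
Variable Nm : 'rV[R]_n -> R.
Hypothesis Nm_norm : is_norm Nm.

Lemma norm0 : Nm 0 = 0.
Proof. by case: Nm_norm => _ Z _; rewrite -(scale0r (0 : 'rV[R]_n)) Z normr0 mul0r. Qed.

Lemma norm_ge0 x : 0 <= Nm x.
Proof.
case: Nm_norm => D Z _.
have := D x (- x); rewrite subrr norm0 -scaleN1r Z normrN1 mul1r; lra.
Qed.

Lemma norm_distC x y : Nm (x - y) = Nm (y - x).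
Proof. by case: Nm_norm => _ Z _; rewrite -(opprB y x) -scaleN1r Z normrN1 mul1r. Qed.

(** Expansion in unit vectors; this ties the arbitrary norm to the coordinates, which generate the
    sigma-algebra. *)
Lemma norm_le_coord (x : 'rV[R]_n) (e : R) : (forall i, `|x ord0 i| <= e) ->
  Nm x <= e * \sum_(i < n) Nm (delta_mx 0 i).
Proof.
case: Nm_norm => D Z _ xe.
have S (r : seq 'I_n) (u : 'I_n -> 'rV[R]_n) : Nm (\sum_(i <- r) u i) <= \sum_(i <- r) Nm (u i).
  elim: r => [|i r IH]; first by rewrite !big_nil norm0.
  by rewrite !big_cons (le_trans (D _ _))// lerD2l.
rewrite [x in Nm x]row_sum_delta (le_trans (S _ _))// mulr_sumr ler_sum// => i _.
by rewrite Z ler_wpM2r ?norm_ge0.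
Qed.

Variable K : set 'rV[R]_n.
Local Open Scope ereal_scope.

Lemma dist_to_lip x y : dist_to Nm K x <= dist_to Nm K y + (Nm (x - y))%:E.
Proof.
rewrite -leeBlDr//; apply: le_ereal_inf_tmp => _ [z Kz <-].
rewrite leeBlDr// -EFinD; apply: ge_ereal_inf; exists (Nm (x - z))%:E.
  by exists z.
case: Nm_norm => D _ _.
by rewrite lee_fin -[(x - z)%R](subrKA y) [leRHS]addrC; exact: D.
Qed.

Lemma dist_to_gt0_notin y : 0 < dist_to Nm K y -> ~ K y.
Proof.
move=> d0 Ky; move: d0; rewrite ltNge => /negP; apply.
by apply: ereal_inf_lbound; exists y => //; rewrite subrr norm0.
Qed.

Let zfloor (k : nat) (x : 'rV[R]_n) : 'rV[int]_n :=
  \row_i Num.floor (k.+1%:R * x ord0 i)%R.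

Let grid (k : nat) (z : 'rV[int]_n) : 'rV[R]_n :=
  (\row_i ((z ord0 i)%:~R / k.+1%:R))%R.

Let measurable_zfloor_preimage k (S : set 'rV[int]_n) :
  measurable (zfloor k @^-1` S).
Proof.
have M1 z : measurable (zfloor k @^-1` [set z]).
  rewrite (_ : _ @^-1` _ = \bigcap_(i in [set: 'I_n]) ((fun x : 'rV[R]_n => x ord0 i) @^-1`
      `[((z ord0 i)%:~R / k.+1%:R)%R, (((z ord0 i) + 1)%:~R / k.+1%:R)%R[%classic)).
    apply: fin_bigcap_measurable; first exact: finite_finset.
    move=> i _; rewrite -[X in measurable X]setTI.
    exact: (measurable_rV_coord i).
  have k0 : (0 < k.+1%:R :> R)%R by rewrite ltr0n.
  apply/seteqP; split => x /=.
    move=> <- i _ /=; rewrite in_itv/= mxE ler_pdivrMr// ltr_pdivlMr//.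
    by rewrite ![(x _ _ * _)%R]mulrC floor_itv.
  move=> H; apply/rowP => i; rewrite mxE; apply: floor_def.
  have := H i I; rewrite /= in_itv/= ler_pdivrMr// ltr_pdivlMr//.
  by rewrite ![(x _ _ * _)%R]mulrC.
(* Integer vectors are countable and [unpickle] enumerates them, so the preimage of an arbitrary set
   is a countable union of boxes. *)
rewrite (_ : _ @^-1` S = \bigcup_(j : nat)
    (if unpickle j is Some z then
      if z \in S then zfloor k @^-1` [set z] else set0 else set0)).
  apply: bigcupT_measurable => j; case: (unpickle j) => [z|]//.
  by case: ifP.
apply/seteqP; split => x /=.
  move=> Sx; exists (pickle (zfloor k x)) => //.
  by rewrite pickleK mem_set.
move=> [j _]; case: (unpickle j) => // z; case: ifPn => // zS.
by rewrite /= => ->; exact: set_mem.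
Qed.

(** The set K is arbitrary, so only the Lipschitz property of the distance is used. Rounding to the
    grid of mesh 1/(k+1) moves a point by at most C/(k+1); the distance at the rounded point depends
    on an integer vector only, and the tolerance shrinks as k grows. *)
Lemma measurable_dist_le (r : R) : measurable [set y | dist_to Nm K y <= r%:E].
Proof.
pose C := (\sum_(i < n) Nm (delta_mx 0 i))%R.
have C0 : (0 <= C)%R by apply: sumr_ge0 => i _; exact: norm_ge0.
have gridE k x : (Nm (x - grid k (zfloor k x)) <= k.+1%:R^-1 * C)%R.
  apply: norm_le_coord => i; rewrite !mxE.
  have k0 : (0 < k.+1%:R :> R)%R by rewrite ltr0n.
  have := floor_itv (k.+1%:R * x ord0 i)%R.
  set z := Num.floor _; rewrite intrD => /andP[h1 h2].
  have -> : (x ord0 i - z%:~R / k.+1%:R = (k.+1%:R * x ord0 i - z%:~R) / k.+1%:R)%R.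
    by rewrite mulrBl mulrAC divff ?mul1r// gt_eqF.
  rewrite normrM normfV (gtr0_norm k0) ler_piMl ?invr_ge0 ?(ltW k0)//.
  by rewrite ler_norml; apply/andP; split; lra.
rewrite (_ : [set y | _] = \bigcap_(k : nat)
   (zfloor k @^-1` [set z | dist_to Nm K (grid k z) <= (r + k.+1%:R^-1 * C)%:E])).
  by apply: bigcapT_measurable => k; exact: measurable_zfloor_preimage.
apply/seteqP; split => x /=.
  move=> dx k _ /=; rewrite EFinD.
  apply: (le_trans (dist_to_lip _ x)); rewrite leeD// lee_fin norm_distC.
  exact: gridE.
move=> H; apply/lee_addgt0Pr => e e0.
have [k ke] : exists k : nat, (k.+1%:R^-1 * C + k.+1%:R^-1 * C <= e)%R.
  exists (Num.truncn ((C + C) / e)).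
  have := truncnS_gt ((C + C) / e)%R; set k := Num.truncn _ => h.
  rewrite -mulrDr mulrC ler_pdivrMr ?ltr0n// mulrC -ler_pdivrMr//.
  exact: ltW.
have := H k I; rewrite /= => Hk.
apply: (le_trans (dist_to_lip x (grid k (zfloor k x)))).
apply: (@le_trans _ _ ((r + k.+1%:R^-1 * C)%:E + (k.+1%:R^-1 * C)%:E)).
  by rewrite leeD// lee_fin gridE.
by rewrite -!EFinD lee_fin -addrA lerD2l.
Qed.

End distance_measurability.

(** * From mutual independence to independence of tails *)

Section mutual_independence.
Context {d : measure_display} {Om : measurableType d} {R : realType}
  (P : probability Om R).

Lemma mutual_indep_cons (I : eqType) (G : I -> set (set Om)) (i : I) (l : seq I)
    (A : I -> set Om) : mutually_independent P G -> uniq (i :: l) ->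
  (forall j, j \in i :: l -> G j (A j)) ->
  P (A i `&` \bigcap_(j in [set` l]) A j) =
  (P (A i) * P (\bigcap_(j in [set` l]) A j))%E.
Proof.
move=> indG u GA; have /andP[_ ul] := u.
rewrite (indG l A ul); last by move=> j jl; apply: GA; rewrite inE jl orbT.
rewrite -(big_cons _ _ _ _ xpredT (fun j => P (A j))) -(indG (i :: l) A u GA).
congr (P _); apply/seteqP; split=> w /=.
  by move=> [wi wl] j /=; rewrite inE => /predU1P[->//|jl]; exact: wl.
move=> H; split; first by apply: H; rewrite /= inE eqxx.
by move=> j /= jl; apply: H; rewrite /= inE jl orbT.
Qed.

Lemma mutual_indep_pair (I : eqType) (G : I -> set (set Om)) (i j : I)
    (A B : set Om) : mutually_independent P G -> i != j -> G i A -> G j B ->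
  P (A `&` B) = (P A * P B)%E.
Proof.
move=> indG ij GA GB.
pose E k := if k == i then A else B.
have := @mutual_indep_cons _ G i [:: j] E indG.
rewrite /= inE ij /E => /(_ isT).
have -> : \bigcap_(k in [set` [:: j]]) (if k == i then A else B) = B.
  apply/seteqP; split => w /=.
    by move=> /(_ j); rewrite /= inE eqxx eq_sym (negbTE ij) => /(_ isT).
  by move=> wB k /=; rewrite inE => /eqP ->; rewrite eq_sym (negbTE ij).
rewrite eqxx => -> // k; rewrite !inE => /orP[/eqP ->|/eqP ->]; first by rewrite eqxx.
by rewrite eq_sym (negbTE ij).
Qed.

Section draws.
Context {d1 d2 : measure_display} {T1 : measurableType d1} {T2 : measurableType d2}.
Variables (Y : {RV P >-> T1}) (th : nat -> {RV P >-> T2}) (N : nat).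
Hypothesis draws_indep : mutually_independent P (fun i : option 'I_N =>
  if i is Some m then sigma_of (th m) else sigma_of Y).

Let tail_ords a : seq (option 'I_N) := 
  map Some [seq i : 'I_N <- enum 'I_N | (a <= i)%N].

Let tail_eventE a (B : nat -> set T2) (A : option 'I_N -> set Om) :
  (forall i : 'I_N, (a <= i)%N -> A (Some i) = th i @^-1` B i) ->
  tail_event th N a B = \bigcap_(i in [set` tail_ords a]) A i.
Proof.
move=> AE; apply/seteqP; split => w /=.
  move=> H j /= /mapP[i]; rewrite mem_filter => /andP[ai _] ->.
  by rewrite AE//; apply: H; rewrite /= ai ltn_ord.
move=> H i /= /andP[ai iN].
have : A (Some (Ordinal iN)) w.
  apply: H => /=; apply/mapP; exists (Ordinal iN) => //.
  by rewrite mem_filter ai mem_enum.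
by rewrite AE.
Qed.

Let uniq_tail_ords a : uniq (tail_ords a).
Proof.
rewrite map_inj_uniq; last by move=> i j [].
apply: filter_uniq; exact: enum_uniq.
Qed.

Lemma draws_tail_indep n : (n < N)%N -> tail_indep P th N n.+1 (th n).
Proof.
move=> nN A B mA mB.
pose E (i : option 'I_N) := if i is Some m then
  th m @^-1` (if (m : nat) == n then A else B m) else setT.
rewrite (@tail_eventE n.+1 B E); last by move=> i ni; rewrite /E gtn_eqF.
have -> : th n @^-1` A = E (Some (Ordinal nN)) by rewrite /E /= eqxx.
have u : uniq (Some (Ordinal nN) :: tail_ords n.+1).
  rewrite cons_uniq uniq_tail_ords andbT; apply/mapP => -[i].
  rewrite mem_filter => /andP[ni _].
  move=> /(congr1 (fun o : option 'I_N => if o is Some j then j : nat else 0%N)) /= E1.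
  by rewrite -E1 ltnn in ni.
apply: (mutual_indep_cons draws_indep u) => j; rewrite inE => /predU1P[->|].
  by exists A => //; rewrite /E /= eqxx setTI.
move=> /mapP[i _ ->]; exists (if (i : nat) == n then A else B i).
  by case: ifP.
by rewrite setTI.
Qed.

Lemma draws_tail_indepY a : tail_indep P th N a Y.
Proof.
move=> A B mA mB.
pose E (i : option 'I_N) := if i is Some m then th m @^-1` B m else Y @^-1` A.
rewrite (@tail_eventE a B E)// -[Y @^-1` A]/(E None).
have u : uniq (None :: tail_ords a).
  by rewrite cons_uniq uniq_tail_ords andbT; apply/mapP => -[].
apply: (mutual_indep_cons draws_indep u) => j; rewrite inE => /predU1P[->|].
  by exists A => //; rewrite setTI.
by move=> /mapP[i _ ->]; exists (B i) => //; rewrite setTI.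
Qed.

End draws.
End mutual_independence.

(** * Moments of the averaged deviations *)

Section deviation_moments.
Context {disp : measure_display} {Om : measurableType disp} {R : realType}
  (P : probability Om R) {s t : nat}.
Variables (theta : {RV P >-> 'rV[R]_s}).
Variables (h : 'rV[R]_s -> 'rV[R]_t) (mh : measurable_fun [set: 'rV[R]_s] h).
Variables (rho : 'rV[R]_t -> R) (noise : {RV P >-> 'rV[R]_t}).
Hypothesis noise_rho : has_density P noise rho.
Variables (p e A : R).
Hypotheses (e01 : 0 <= e <= 1) (ep : 2 + e <= p).
Hypothesis ratio_moment :
  (\int[P]_w \int[P]_w'
     (lratio theta h rho (obs h theta noise w) (theta w') `^ p)%:E <= A%:E)%E.
Variables (Y : {RV P >-> 'rV[R]_t}) (th : nat -> {RV P >-> 'rV[R]_s}) (N : nat).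
Hypothesis Y_law : same_law P Y (obs h theta noise).
Hypothesis th_law : forall m, (m < N)%N -> same_law P (th m) theta.
Hypothesis draws_indep : mutually_independent P (fun i : option 'I_N =>
  if i is Some m then sigma_of (th m) else sigma_of Y).

Let rat := lratio theta h rho.
Let rat0 y x : 0 <= rat y x. Proof. exact: (ratio_ge0 theta h noise_rho). Qed.

Let th_indep := draws_tail_indep draws_indep.
Let Y_indep := draws_tail_indepY draws_indep.

(** Y and the n-th draw are independent, so their joint law is that of the observation and a fresh
    copy of theta, the form in which [ratio_moment] is stated. *)
Lemma draw_pair_integral n (Phi : 'rV[R]_t * 'rV[R]_s -> \bar R) : (n < N)%N ->
  measurable_fun setT Phi -> (forall z, 0 <= Phi z)%E ->
  (\int[P]_w Phi (Y w, th n w) =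
   \int[P]_w \int[P]_w' Phi (obs h theta noise w, theta w'))%E.
Proof.
move=> nN mPhi Phi0.
have YN := tail_indep_pairE nN (Y_indep n).
rewrite (ge0_indep_integral YN mPhi Phi0).
transitivity (\int[P]_w \int[P]_w' Phi (Y w, theta w'))%E.
  apply: eq_integral => w _.
  apply: (same_law_ge0_integral (f := fun x => Phi (Y w, x))) => //.
    exact: th_law.
  exact: measurable_fun_pair2.
have mF : measurable_fun setT (fun z : 'rV[R]_t * Om => Phi (z.1, theta z.2)).
  apply: (measurableT_comp mPhi); apply: measurable_fun_pair => //.
  exact: measurableT_comp measurable_snd.
apply: (same_law_ge0_integral (f := fun y => (\int[P]_w' Phi (y, theta w'))%E)) => //.
- exact: (measurable_obs theta mh noise).
- by apply: (measurable_fun_fubini_tonelli_F (m2 := P) _ mF) => z; exact: Phi0.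
- by move=> y; apply: integral_ge0 => w _; exact: Phi0.
Qed.

Let mrat_draw n : measurable_fun setT (fun w => rat (Y w) (th n w)).
Proof. exact: (measurable_ratio_comp theta mh noise_rho). Qed.

Lemma ratio_draw_moment n : (n < N)%N ->
  (\int[P]_w (rat (Y w) (th n w) `^ p)%:E <= A%:E)%E.
Proof.
move=> nN.
pose Phi (z : 'rV[R]_t * 'rV[R]_s) := (rat z.1 z.2 `^ p)%:E.
rewrite (@draw_pair_integral n Phi nN)//; last by move=> z; rewrite lee_fin powR_ge0.
apply/measurable_EFinP; apply: (measurableT_comp (measurable_powR p)).
by apply: (measurable_ratio_comp theta mh noise_rho).
Qed.

Lemma A_ge0 : 0 <= A.
Proof.
rewrite -lee_fin (le_trans _ ratio_moment)//; apply: integral_ge0 => w _.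
by apply: integral_ge0 => w' _; rewrite lee_fin powR_ge0.
Qed.

Variables (Z : 'rV[R]_t * 'rV[R]_s -> R) (c : R).
Hypotheses (mZ : measurable_fun setT Z) (c0 : 0 <= c).
Hypothesis Zc : forall z, `|Z z| <= c * (rat z.1 z.2 + 1).
Hypothesis Z0 : forall y, \int[P]_w Z (y, theta w) = 0.

Let B := c `^ (2 + e) * (2 `^ p * (A + 1)).

Let e0 : 0 <= e. Proof. by case/andP: e01. Qed.
Let q0 : 0 <= 2 + e. Proof. by rewrite addr_ge0. Qed.
Let p0 : 0 <= p. Proof. exact: le_trans q0 ep. Qed.

(** The summand 1 in [Zc] makes the base at least 1, so the exponent may be raised from 2 + e to p;
    then (x + 1)^p <= 2^p (x^p + 1) gives B. *)
Lemma centered_draw_moment n : (n < N)%N ->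
  (\int[P]_w (`|Z (Y w, th n w)| `^ (2 + e))%:E <= B%:E)%E.
Proof.
move=> nN.
have mr : measurable_fun setT (fun w => rat (Y w) (th n w) `^ p).
  by apply: (measurableT_comp (measurable_powR p)).
apply: (@le_trans _ _ (\int[P]_w ((c `^ (2 + e) * 2 `^ p)%:E *
    ((rat (Y w) (th n w) `^ p)%:E + (cst 1%:E) w)))%E).
  apply: ge0_le_integral => //.
  - apply/measurable_EFinP; apply: (measurableT_comp (measurable_powR _)).
    apply: measurableT_comp => //; apply: (measurableT_comp mZ).
    exact: measurable_fun_pair.
  - by apply: measurable_funeM; apply: emeasurable_funD => //; exact/measurable_EFinP.
  - move=> w _; rewrite /= -EFinD -EFinM lee_fin.
    set x := rat _ _.
    have x0 : 0 <= x by exact: rat0.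
    have H1 : `|Z (Y w, th n w)| `^ (2 + e) <= (c * (x + 1)) `^ (2 + e).
      by apply: ler_powRl => //; exact: Zc.
    apply: (le_trans H1); rewrite powRM ?addr_ge0// -mulrA ler_wpM2l ?powR_ge0//.
    apply: (@le_trans _ _ ((x + 1) `^ p)).
      by apply: ler_powR => //; rewrite lerDr.
    have := powR_normD_le x 1 p0.
    by rewrite normr1 powR1 (ger0_norm x0) ger0_norm// addr_ge0.
rewrite ge0_integralZl//; last 3 first.
- by apply: emeasurable_funD => //; exact/measurable_EFinP.
- by move=> w _; rewrite adde_ge0// lee_fin ?powR_ge0.
- by rewrite lee_fin mulr_ge0 ?powR_ge0.
rewrite ge0_integralD//; last 2 first.
- by move=> w _; rewrite lee_fin powR_ge0.
- exact/measurable_EFinP.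
have -> : (\int[P]_w (cst 1%:E) w = 1%:E)%E.
  by rewrite integral_cst// mul1e; exact: probability_setT.
rewrite /B mulrA [leRHS]EFinM lee_wpmul2l ?lee_fin ?mulr_ge0 ?powR_ge0//.
by rewrite EFinD leeD2r// ratio_draw_moment.
Qed.

Let icstD (y : 'rV[R]_t) :
  P.-integrable setT (EFin \o (fun w => c * (rat y (theta w) + 1))).
Proof.
rewrite (_ : _ \o _ = (fun w => c%:E *
   ((EFin \o (fun w => rat y (theta w))) \+ (EFin \o (fun=> 1%R))) w)%E)//.
apply: integrableZl => //; apply: integrableD => //; last exact: integrable_cstR.
exact: (integrable_ratio theta mh noise_rho).
Qed.

Let mZy (y : 'rV[R]_t) : measurable_fun setT (fun x => Z (y, x)).
Proof. exact: measurable_fun_pair2 mZ. Qed.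

Lemma centered_integrable y n : (n < N)%N ->
  P.-integrable setT (EFin \o (fun w => Z (y, th n w))).
Proof.
move=> nN.
have thl : same_law P theta (th n) by move=> S mS; rewrite th_law.
apply: (@same_law_integrable _ _ _ P _ _ theta (th n) (fun x => (Z (y, x))%:E)) => //.
  by apply/measurable_EFinP; exact: mZy.
apply: (integrable_dominated (g := fun w => c * (rat y (theta w) + 1))) => //.
exact: measurableT_comp (mZy y) _.
Qed.

Lemma centered_Rintegral y n : (n < N)%N -> \int[P]_w Z (y, th n w) = 0.
Proof.
move=> nN; rewrite -(Z0 y) /Rintegral; congr fine.
apply: (@same_law_integral _ _ _ P _ _ (th n) theta (fun x => (Z (y, x))%:E)) => //.
  exact: th_law.
by apply/measurable_EFinP; exact: mZy.
Qed.

Definition avg_dev (a b : nat) (w : Om) : R :=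
  `|\sum_(a <= m < b) Z (Y w, th m w)| / (b - a)%:R.

Lemma avg_dev_ge0 a b w : 0 <= avg_dev a b w.
Proof. by rewrite divr_ge0. Qed.

Lemma measurable_avg_dev a b : (a < b)%N -> measurable_fun setT (avg_dev a b).
Proof.
move=> ab; apply: measurable_funM => //; apply: measurableT_comp => //.
have := measurable_partial_sum Y th a mZ (b - a).
by rewrite /partial_sum subnKC// ltnW.
Qed.

Lemma avg_dev_moment a b : (a < b)%N -> (b <= N)%N ->
  (\int[P]_w (avg_dev a b w `^ (2 + e))%:E <=
   (78 * B * (b - a)%:R `^ (- (1 + e / 2)))%:E)%E.
Proof.
move=> ab bN; have n0 : (0 < b - a)%N by rewrite subn_gt0.
have n0R : 0 < (b - a)%:R :> R by rewrite ltr0n.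
have abE : (a + (b - a) = b)%N by rewrite subnKC// ltnW.
have H := partial_sum_moment th_indep (Y_indep a) mZ (fun y n => @centered_integrable y n)
  (fun y n => @centered_Rintegral y n) e01 centered_draw_moment n0.
rewrite abE in H; have {H} := H bN.
set n := (b - a)%N in n0 n0R abE * => H.
have -> : (fun w => (avg_dev a b w `^ (2 + e))%:E) = (fun w =>
    (n%:R `^ (- (2 + e)))%:E * (`|partial_sum Y th a Z n w| `^ (2 + e))%:E)%E.
  apply/funext => w; rewrite -EFinM /avg_dev /partial_sum abE; congr EFin.
  by rewrite powRM ?invr_ge0// mulrC -powR_inv1// -powRrM mulN1r.
have mp : measurable_fun setT (fun w => (`|partial_sum Y th a Z n w| `^ (2 + e))%:E).
  apply/measurable_EFinP; apply: (measurableT_comp (measurable_powR _)).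
  by apply: measurableT_comp => //; exact: measurable_partial_sum.
rewrite ge0_integralZl ?lee_fin ?powR_ge0//.
apply: (le_trans (lee_wpmul2l _ H)); first by rewrite lee_fin powR_ge0.
rewrite -EFinM lee_fin le_eqVlt; apply/orP; left; apply/eqP.
have -> : n%:R `^ (- (1 + e / 2)) = n%:R `^ (- (2 + e)) * n%:R `^ (1 + e / 2) :> R.
  rewrite -powRD; first by congr (_ `^ _); field.
  by apply/implyP => _; rewrite gt_eqF.
ring.
Qed.

End deviation_moments.

Section block_deviation.
Context {disp : measure_display} {Om : measurableType disp} {R : realType}
  (P : probability Om R) {s t : nat} {D : finType}.
Variables (d0 : D) (f : D -> 'rV[R]_s -> R).
Hypothesis mf : forall d, measurable_fun [set: 'rV[R]_s] (f d).
Variables (F : R) (fF : forall d u, `|f d u| <= F).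
Variables (theta : {RV P >-> 'rV[R]_s}).
Variables (h : 'rV[R]_s -> 'rV[R]_t) (mh : measurable_fun [set: 'rV[R]_s] h).
Variables (rho : 'rV[R]_t -> R) (noise : {RV P >-> 'rV[R]_t}).
Hypothesis noise_rho : has_density P noise rho.

Let fm u := maxD d0 (f ^~ u).
Let rY := rhoY P h rho theta.
Let rho0 x : 0 <= rho x. Proof. by case: noise_rho. Qed.
Let rY0 y : 0 <= rY y. Proof. exact: (rhoY_ge0 theta h noise_rho). Qed.
Let F0 : 0 <= F. Proof. exact: le_trans (fF d0 0). Qed.
Let mfm : measurable_fun setT fm. Proof. exact: measurable_maxD. Qed.
Let fmF u : `|fm u| <= F. Proof. exact: maxD_bounded. Qed.

Definition centered_weight (phi : 'rV[R]_s -> R) (z : 'rV[R]_t * 'rV[R]_s) : R :=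
  (phi z.2 - post theta h rho phi z.1) * lratio theta h rho z.1 z.2.

(* The quotient rY / rY is 1 except where rY vanishes; there it is 0, so that
   the kernel stays centred. *)
Definition centered_ratio (z : 'rV[R]_t * 'rV[R]_s) : R :=
  lratio theta h rho z.1 z.2 - rY z.1 / rY z.1.

(** One index type for all centred averages behind a ratio estimator: [None] is the common
    denominator, [Some None] the numerator for the maximum over decisions, [Some (Some d)] the
    numerator for d. The moment bound is then proved once. *)
Definition dev_kernel (j : option (option D)) : 'rV[R]_t * 'rV[R]_s -> R :=
  match j with
  | None => centered_ratio
  | Some None => centered_weight fm
  | Some (Some d) => centered_weight (f d)
  end.

Let rat0 y x : 0 <= lratio theta h rho y x.
Proof. exact: (ratio_ge0 theta h noise_rho). Qed.

Let mrat : measurable_fun setT (fun z : 'rV[R]_t * 'rV[R]_s => lratio theta h rho z.1 z.2).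
Proof. by apply: (measurable_ratio_comp theta mh noise_rho). Qed.

Lemma measurable_dev_kernel j : measurable_fun setT (dev_kernel j).
Proof.
have W (phi : 'rV[R]_s -> R) : measurable_fun setT phi ->
    measurable_fun setT (centered_weight phi).
  move=> mphi; apply: measurable_funM; last exact: mrat.
  apply: measurable_funB; first exact: measurableT_comp mphi measurable_snd.
  apply: measurableT_comp measurable_fst.
  exact: (measurable_post theta mh noise_rho).
case: j => [[d|]|] /=; [exact: W|exact: W|].
apply: measurable_funB; first exact: mrat.
have mrY := measurableT_comp (measurable_rhoY theta mh noise_rho)
  (@measurable_fst _ _ 'rV[R]_t 'rV[R]_s).
exact: measurable_fun_div.
Qed.

Lemma dev_kernel_bound j z :
  `|dev_kernel j z| <= (2 * F + 1) * (lratio theta h rho z.1 z.2 + 1).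
Proof.
have r0 := rat0 z.1 z.2.
have W (phi : 'rV[R]_s -> R) : measurable_fun setT phi -> (forall u, `|phi u| <= F) ->
    `|centered_weight phi z| <= (2 * F + 1) * (lratio theta h rho z.1 z.2 + 1).
  move=> mphi phiF; rewrite /centered_weight normrM (ger0_norm r0).
  have pF := post_bounded theta mh noise_rho mphi phiF z.1.
  apply: (@le_trans _ _ ((2 * F) * lratio theta h rho z.1 z.2)).
    rewrite ler_wpM2r// (le_trans (ler_normB _ _))//.
    by rewrite mulr2n mulrDl mul1r lerD.
  have := F0; nra.
case: j => [[d|]|] /=; [exact: W|exact: W|].
rewrite /centered_ratio (le_trans (ler_normB _ _))// (ger0_norm r0).
have : `|rY z.1 / rY z.1| <= 1.
  by have [->|y0] := eqVneq (rY z.1) 0; rewrite ?mul0r ?normr0// divff// normr1.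
have := F0; nra.
Qed.

Lemma dev_kernel_centered j y : \int[P]_w dev_kernel j (y, theta w) = 0.
Proof.
case: j => [[d|]|] /=.
- exact: (Rintegral_centered_ratio theta mh noise_rho (mf d) (fF d)).
- exact: (Rintegral_centered_ratio theta mh noise_rho mfm fmF).
rewrite /centered_ratio /= RintegralB//; last 2 first.
- exact: (integrable_ratio theta mh noise_rho).
- exact: integrable_cstR.
by rewrite (Rintegral_ratio theta mh noise_rho) Rintegral_cstT subrr.
Qed.

Variables (Y : {RV P >-> 'rV[R]_t}) (th : nat -> {RV P >-> 'rV[R]_s}) (N : nat).

(** A single quantity dominating every error of a block. The weight 4F + 2 exceeds the coefficients
    2 and 4F of [wmean_dist] and the coefficient 1 with which [dev1] is used alone. *)
Definition block_dev (a b : nat) (w : Om) : R :=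
  \sum_(j : option (option D)) (4 * F + 2) * avg_dev Y th (dev_kernel j) a b w.

Lemma block_dev_ge0 a b w : 0 <= block_dev a b w.
Proof.
apply: sumr_ge0 => j _; rewrite mulr_ge0 ?avg_dev_ge0//; have := F0; lra.
Qed.

Lemma measurable_block_dev a b : (a < b)%N -> measurable_fun setT (block_dev a b).
Proof.
move=> ab; apply: measurable_sum => j; apply: measurable_funM => //.
apply: measurable_avg_dev => //; exact: measurable_dev_kernel.
Qed.

Let term_le (l : seq (option (option D))) a b w : uniq l ->
  \sum_(j <- l) (4 * F + 2) * avg_dev Y th (dev_kernel j) a b w <= block_dev a b w.
Proof.
move=> ul; rewrite /block_dev big_uniq//= [leRHS](bigID (mem l))/= lerDl.
apply: sumr_ge0 => j _; rewrite mulr_ge0 ?avg_dev_ge0//; have := F0; lra.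
Qed.

Lemma block_dev_dev1 a b w : 0 < rY (Y w) ->
  dev1 h rho (Y w) (fun m => th m w) (rY (Y w)) a b <= block_dev a b w.
Proof.
move=> y0; apply: le_trans (term_le (l := [:: None]) _ _ _ isT).
rewrite big_seq1 (_ : dev1 _ _ _ _ _ _ _ = avg_dev Y th (dev_kernel None) a b w).
  rewrite ler_peMl ?avg_dev_ge0//; have := F0; lra.
rewrite /dev1 /avg_dev /=; congr (`|_| / _); apply: eq_bigr => m _.
by rewrite /centered_ratio /= divff// gt_eqF.
Qed.

Lemma block_dev_close a b w : (a < b)%N -> 0 < rY (Y w) ->
  close_means d0 f h rho (Y w) (fun m => th m w)
    (fun d => post theta h rho (f d) (Y w)) (post theta h rho fm (Y w))
    (block_dev a b w) a b.
Proof.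
move=> ab y0.
have W (j : option (option D)) (phi : 'rV[R]_s -> R) :
    dev_kernel j = centered_weight phi -> j != None ->
    measurable_fun setT phi -> (forall u, `|phi u| <= F) ->
    `|wmean h rho (Y w) (fun m => th m w) a b phi - post theta h rho phi (Y w)|
      <= block_dev a b w.
  move=> jE jN mphi phiF.
  have pF := post_bounded theta mh noise_rho mphi phiF (Y w).
  apply: (le_trans (wmean_dist h rho0 (Y w) (fun m => th m w) y0 ab phiF pF)).
  have u : uniq [:: j; None] by rewrite /= inE jN.
  apply: le_trans (term_le _ _ _ u); rewrite big_cons big_seq1.
  have -> : dev h rho (Y w) (fun m => th m w) (rY (Y w)) a b phi
      (post theta h rho phi (Y w)) = avg_dev Y th (dev_kernel j) a b w.
    by rewrite jE.
  have -> : dev1 h rho (Y w) (fun m => th m w) (rY (Y w)) a b =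
      avg_dev Y th (dev_kernel None) a b w.
    rewrite /dev1 /avg_dev /=; congr (`|_| / _); apply: eq_bigr => m _.
    by rewrite /centered_ratio /= divff// gt_eqF.
  have := avg_dev_ge0 Y th (dev_kernel j) a b w.
  have := avg_dev_ge0 Y th (dev_kernel None) a b w.
  have := F0; nra.
split; first by move=> d; exact: (W (Some (Some d))).
exact: (W (Some None)).
Qed.

Variables (p e A : R).
Hypotheses (e01 : 0 <= e <= 1) (ep : 2 + e <= p).
Hypothesis ratio_moment :
  (\int[P]_w \int[P]_w'
     (lratio theta h rho (obs h theta noise w) (theta w') `^ p)%:E <= A%:E)%E.
Hypothesis Y_law : same_law P Y (obs h theta noise).
Hypothesis th_law : forall m, (m < N)%N -> same_law P (th m) theta.
Hypothesis draws_indep : mutually_independent P (fun i : option 'I_N =>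
  if i is Some m then sigma_of (th m) else sigma_of Y).

(** The first factor and the third, the number of kernels, come from bounding the power of a sum by
    a sum of powers, the second from the weight 4F + 2, and the last from [avg_dev_moment] with c =
    2F + 1. Nothing depends on the block. *)
Definition block_const : R :=
  #|{: option (option D)}|%:R `^ (2 + e) * (4 * F + 2) `^ (2 + e) *
  #|{: option (option D)}|%:R *
  (78 * ((2 * F + 1) `^ (2 + e) * (2 `^ p * (A + 1)))).

Lemma block_const_ge0 : 0 <= block_const.
Proof.
have A0 := A_ge0 ratio_moment.
by rewrite /block_const !mulr_ge0 ?powR_ge0// addr_ge0.
Qed.

Lemma block_dev_moment a b : (a < b)%N -> (b <= N)%N ->
  (\int[P]_w (block_dev a b w `^ (2 + e))%:E <=
   (block_const * (b - a)%:R `^ (- (1 + e / 2)))%:E)%E.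
Proof.
move=> ab bN.
have e0 : 0 <= e by case/andP: e01.
have q0 : 0 <= 2 + e by rewrite addr_ge0.
have c0 : 0 <= 4 * F + 2 by have := F0; lra.
pose k : R := #|{: option (option D)}|%:R `^ (2 + e) * (4 * F + 2) `^ (2 + e).
have k0 : 0 <= k by rewrite mulr_ge0 ?powR_ge0.
pose u j w := (avg_dev Y th (dev_kernel j) a b w `^ (2 + e))%:E.
have mu j : measurable_fun setT (u j).
  apply/measurable_EFinP; apply: (measurableT_comp (measurable_powR _)).
  by apply: measurable_avg_dev => //; exact: measurable_dev_kernel.
have u0 j w : (0 <= u j w)%E by rewrite lee_fin powR_ge0.
apply: (@le_trans _ _ (\int[P]_w (k%:E * \sum_(j : option (option D)) u j w))%E).
  apply: ge0_le_integral => //.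
  - by move=> w _; rewrite lee_fin powR_ge0.
  - apply/measurable_EFinP; apply: (measurableT_comp (measurable_powR _)).
    exact: measurable_block_dev.
  - by apply: measurable_funeM; apply: emeasurable_sum.
  - move=> w _; rewrite sumEFin -EFinM lee_fin.
    apply: (le_trans (powR_sum_le None q0 _)).
      by move=> j; rewrite mulr_ge0 ?avg_dev_ge0.
    rewrite /k -mulrA ler_wpM2l ?powR_ge0// mulr_sumr ler_sum// => j _.
    by rewrite powRM// ?avg_dev_ge0.
rewrite ge0_integralZl//; last 2 first.
- by apply: emeasurable_sum.
- by move=> w _; apply: sume_ge0.
rewrite ge0_integral_sum//.
set V : R := (78 * ((2 * F + 1) `^ (2 + e) * (2 `^ p * (A + 1))) *
  (b - a)%:R `^ (- (1 + e / 2))).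
have uV j : (\int[P]_w u j w <= V%:E)%E.
  apply: (avg_dev_moment mh noise_rho e01 ep ratio_moment Y_law th_law draws_indep).
  - exact: measurable_dev_kernel.
  - by have := F0; lra.
  - exact: dev_kernel_bound.
  - exact: dev_kernel_centered.
  - by [].
  - by [].
apply: (@le_trans _ _ (k%:E * \sum_(j : option (option D)) V%:E)%E).
  by rewrite lee_wpmul2l ?lee_fin//; apply: lee_sum.
rewrite sumEFin -EFinM lee_fin sumr_const -[V *+ _]mulr_natl /block_const /V /k.
by rewrite le_eqVlt; apply/orP; left; apply/eqP; ring.
Qed.

End block_deviation.

(** * Second moments of the correction variables *)

Section block_regret.
Context {disp : measure_display} {Om : measurableType disp} {R : realType}
  (P : probability Om R) {s t : nat} {D : finType}.
Variables (d0 : D) (f : D -> 'rV[R]_s -> R).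
Hypothesis mf : forall d, measurable_fun [set: 'rV[R]_s] (f d).
Variables (F : R) (fF : forall d u, `|f d u| <= F).
Variables (h : 'rV[R]_s -> 'rV[R]_t) (mh : measurable_fun [set: 'rV[R]_s] h).
Variables (rho : 'rV[R]_t -> R) (noise : {RV P >-> 'rV[R]_t}).
Hypothesis noise_rho : has_density P noise rho.
Variables (Y : {RV P >-> 'rV[R]_t}) (th : nat -> {RV P >-> 'rV[R]_s}).

Let rho0 x : 0 <= rho x. Proof. by case: noise_rho. Qed.

(** Estimates the posterior mean of max_d f_d minus the largest posterior mean. Each correction is
    this quantity on the block minus its average over the halves. *)
Definition block_regret (a b : nat) (w : Om) : R :=
  gmaxbar d0 f h rho a b (Y w) (fun m => th m w) -
  maxD d0 (gbar f h rho a b (Y w) (fun m => th m w)).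

Lemma block_regret_bounded a b w : (a < b)%N -> `|block_regret a b w| <= 2 * F.
Proof.
move=> ab; rewrite (le_trans (ler_normB _ _))// mulrDl mul1r lerD//.
  by rewrite gmaxbarE wmean_bounded// => u; exact: maxD_bounded.
exact: maxD_gbar_bounded.
Qed.

Lemma measurable_wmean_draws a b (phi : 'rV[R]_s -> R) : measurable_fun setT phi ->
  measurable_fun setT (fun w => wmean h rho (Y w) (fun m => th m w) a b phi).
Proof.
have ml m : measurable_fun setT (fun w => lik h rho (Y w) (th m w)).
  exact: (measurable_lik_comp mh noise_rho).
move=> mphi; apply: measurable_fun_div.
  apply: measurable_funM => //; apply: measurable_sum => m.
  by apply: measurable_funM => //; exact: measurableT_comp.
by apply: measurable_funM => //; apply: measurable_sum => m.
Qed.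

Lemma measurable_block_regret a b : measurable_fun setT (block_regret a b).
Proof.
apply: measurable_funB; first by apply: measurable_wmean_draws; exact: measurable_maxD.
apply: (@measurable_maxD _ _ _ _ d0
  (fun d w => gbar f h rho a b (Y w) (fun m => th m w) d)) => d.
exact: measurable_wmean_draws.
Qed.

Lemma integrable_block_regret a b : (a < b)%N ->
  P.-integrable setT (EFin \o block_regret a b).
Proof.
move=> ab; apply: (@integrable_bounded _ _ _ P _ (2 * F)).
  exact: measurable_block_regret.
by move=> w; exact: block_regret_bounded.
Qed.

Variable M0 : nat.

Lemma DeltaP_block_regret k w :
  DeltaP d0 f h rho M0 k.+1 (Y w) (fun m => th m w) =
  block_regret 0 (Mlev M0 k.+1) w -
  2^-1 * (block_regret 0 (Mlev M0 k) w + block_regret (Mlev M0 k) (Mlev M0 k.+1) w).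
Proof. by rewrite /DeltaP /block_regret; ring. Qed.

Lemma measurable_DeltaP l :
  measurable_fun setT (fun w => DeltaP d0 f h rho M0 l (Y w) (fun m => th m w)).
Proof.
have mb := measurable_block_regret.
case: l => [|k]; first exact: mb.
under eq_fun do rewrite DeltaP_block_regret.
by apply: measurable_funB => //; apply: measurable_funM => //; apply: measurable_funD.
Qed.

End block_regret.

Section level_variance.
Context {disp : measure_display} {Om : measurableType disp} {R : realType}
  (P : probability Om R) {s t : nat} {D : finType}.
Variables (d0 : D) (f : D -> 'rV[R]_s -> R).
Hypothesis mf : forall d, measurable_fun [set: 'rV[R]_s] (f d).
Variables (F : R) (fF : forall d u, `|f d u| <= F).
Variables (theta : {RV P >-> 'rV[R]_s}).
Variables (h : 'rV[R]_s -> 'rV[R]_t) (mh : measurable_fun [set: 'rV[R]_s] h).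
Variables (rho : 'rV[R]_t -> R) (noise : {RV P >-> 'rV[R]_t}).
Hypothesis noise_rho : has_density P noise rho.
Hypothesis noise_indep : independent_RV P theta noise.
Variables (Nm : 'rV[R]_t -> R) (Nm_norm : is_norm Nm).
Variables (K : set 'rV[R]_t) (defK : K = decision_manifold P f h rho theta).
Variables (c0 c1 c2 : R) (c0_gt0 : 0 < c0) (c1_gt0 : 0 < c1) (c2_gt0 : 0 < c2).
Hypothesis K_small : forall r : R, 0 < r < 1 ->
  (P [set w | (dist_to Nm K (obs h theta noise w) <= r%:E)%E] <= (c0 * r)%:E)%E.
Hypothesis gap_large : forall y dopt, Ydomain P h rho theta y -> ~ K y ->
  is_dopt P f h rho theta y dopt ->
  (mine c1%:E (c2%:E * dist_to Nm K y) < decision_gap P d0 f h rho theta y dopt)%E.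

Let fm u := maxD d0 (f ^~ u).
Let rY := rhoY P h rho theta.
Let rho0 x : 0 <= rho x. Proof. by case: noise_rho. Qed.
Let F0 : 0 <= F. Proof. exact: le_trans (fF d0 0). Qed.

(** A point of the domain at positive distance from K lies outside K, hence has a unique optimum;
    the lower bound of the gap increases with the distance, so r may replace it. *)
Lemma gap_far y r : 0 < r -> 0 < rY y -> (r%:E < dist_to Nm K y)%E ->
  exists dopt, forall d, d != dopt ->
    post theta h rho (f d) y + Num.min c1 (c2 * r) <= post theta h rho (f dopt) y.
Proof.
move=> r0 y0 rd.
have Ky : ~ K y by apply: (dist_to_gt0_notin Nm_norm); apply: lt_trans rd; rewrite lte_fin.
have [dopt [dopt_opt _]] : exists! d, is_dopt P f h rho theta y d.
  by apply: contrapT => nd; apply: Ky; rewrite defK; split.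
exists dopt => d dd.
have := gap_large y0 Ky dopt_opt; rewrite /decision_gap.
have -> : maxD d0 (Gdec P f h rho theta ^~ y) = Gdec P f h rho theta dopt y.
  apply: (@maxD_eq _ _ d0 (Gdec P f h rho theta ^~ y) dopt) => d'.
  rewrite /Gdec; apply: ler_wpM2r; last exact: dopt_opt.
  by rewrite invr_ge0 (ltW y0).
rewrite -[post _ _ _ (f dopt) y]/(Gdec P f h rho theta dopt y).
set B := \big[maxe/-oo%E]_(_ | _) _ => gap.
have dB : ((post theta h rho (f d) y)%:E <= B)%E.
  by rewrite /B; apply: (@le_bigmax_cond _ _ _ _ d (fun d => d != dopt)
    (fun d => (Gdec P f h rho theta d y)%:E)).
have m1 : ((Num.min c1 (c2 * r))%:E <= mine c1%:E (c2%:E * dist_to Nm K y))%E.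
  rewrite EFin_min le_min !ge_min lexx /=; apply/orP; right.
  by rewrite EFinM lee_wpmul2l// ?lee_fin ?ltW.
(* B is finite: it dominates the value at d, and B = +oo would make the gap -oo. *)
have {gap m1} := le_lt_trans m1 gap; case: B dB => [b| |] //=.
rewrite lee_fin => db; rewrite -EFinB lte_fin => mb; lra.
Qed.

(** For x <= 1 the first entry of the minimum gives 4 x^4 <= 4 x^(2+e); for x > 1 the second gives
    16 F^2, and x^(2+e) >= 1. *)
Lemma sqr_le_quartic x e : 0 <= e <= 1 -> 0 <= x ->
  Num.min (2 * x ^+ 2) (4 * F) ^+ 2 <= (4 + 16 * F ^+ 2) * x `^ (2 + e).
Proof.
move=> /andP[e0 e1] x0.
have p0 := powR_ge0 x (2 + e).
have [x1|x1] := leP x 1.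
  have h4 : x ^+ 4 <= x `^ (2 + e).
    have [->|xn] := eqVneq x 0; first by rewrite expr0n/= powR_ge0.
    have xp : 0 < x by rewrite lt0r xn.
    rewrite -powR_mulrn//; apply: ger_powR; first by rewrite xp x1.
    lra.
  apply: (@le_trans _ _ ((2 * x ^+ 2) ^+ 2)).
    rewrite ler_sqr ?nnegrE ?ge_min ?lexx//; last by rewrite mulr_ge0 ?sqr_ge0.
    by rewrite le_min !mulr_ge0 ?sqr_ge0.
  have -> : (2 * x ^+ 2) ^+ 2 = 4 * x ^+ 4 by ring.
  have := sqr_ge0 F; nra.
have xq : 1 <= x `^ (2 + e).
  by rewrite -[leLHS](powRr0 x); apply: ler_powR; [exact: ltW|rewrite addr_ge0].
apply: (@le_trans _ _ ((4 * F) ^+ 2)).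
  rewrite ler_sqr ?nnegrE ?ge_min ?lexx ?orbT ?mulr_ge0//.
  by rewrite le_min !mulr_ge0 ?sqr_ge0.
have := sqr_ge0 F; nra.
Qed.

Variables (M0 : nat) (M0_gt0 : (0 < M0)%N) (k : nat).
Let M := Mlev M0 k.
Let N := Mlev M0 k.+1.
Let NE : N = (M + M)%N. Proof. exact: MlevS. Qed.
Let Mp : (0 < M)%N. Proof. exact: Mlev_gt0. Qed.
Let M2 : (M < M + M)%N. Proof. by rewrite -[X in (X < _)%N]addn0 ltn_add2l. Qed.
Let M02 : (0 < M + M)%N. Proof. exact: leq_trans M2. Qed.
Variables (Y : {RV P >-> 'rV[R]_t}) (th : nat -> {RV P >-> 'rV[R]_s}).

Let bdev := block_dev d0 f F theta h rho Y th.

Definition level_dev (w : Om) : R :=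
  bdev 0 M w + bdev M (M + M)%N w + bdev 0 (M + M)%N w.

Let bdev0 a b w : 0 <= bdev a b w. Proof. exact: (block_dev_ge0 d0 fF). Qed.

Lemma level_dev_ge0 w : 0 <= level_dev w.
Proof. by rewrite !addr_ge0. Qed.

Lemma measurable_level_dev : measurable_fun setT level_dev.
Proof.
have mb := measurable_block_dev d0 mf F theta mh noise_rho Y th.
by apply: measurable_funD; [apply: measurable_funD|]; exact: mb.
Qed.

Let DP w := DeltaP d0 f h rho M0 k.+1 (Y w) (fun m => th m w).

(** Each case spends its own terms. The last indicator covers [rhoY] = 0 and the two terms in sg the
    points near K. Far from K, with m the minimum of c1 and c2 r, the term in m/2 covers deviations
    above m/2 and 4 + 16 F^2 the others; the half is there because [DeltaP_le_gap] asks for a gap of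
    twice the deviation. *)
Lemma DeltaP_sqr_le e r sg w : 0 <= e <= 1 -> 0 < r -> 0 < sg ->
  DP w ^+ 2 <=
    (4 + 16 * F ^+ 2 + 16 * sg `^ (- e) + 16 * (Num.min c1 (c2 * r) / 2) `^ (- e)) *
      level_dev w `^ (2 + e) +
    16 * sg ^+ 2 * \1_[set y | (dist_to Nm K y <= r%:E)%E] (Y w) +
    16 * F ^+ 2 * \1_[set y | rY y <= 0] (Y w).
Proof.
move=> e01 r0 sg0; have /andP[e0 e1] := e01.
set T := level_dev w; set m := Num.min _ _.
have T0 : 0 <= T by exact: level_dev_ge0.
have m0 : 0 < m by rewrite lt_min c1_gt0 mulr_gt0.
have pT := powR_ge0 T (2 + e).
have psg := powR_ge0 sg (- e); have pm := powR_ge0 (m / 2) (- e).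
have F2 := sqr_ge0 F.
have sg2 := sqr_ge0 sg.
have DPF : `|DP w| <= 4 * F by exact: DeltaP_bounded.
have DPsqr B : 0 <= B -> `|DP w| <= B -> DP w ^+ 2 <= B ^+ 2.
  by move=> B0 DB; rewrite -[DP w ^+ 2]real_normK ?num_real// ler_sqr.
have iA : 0 <= \1_[set y | (dist_to Nm K y <= r%:E)%E] (Y w) :> R by rewrite indicE.
have iB : 0 <= \1_[set y | rY y <= 0] (Y w) :> R by rewrite indicE.
have [y0|y0] := leP (rY (Y w)) 0.
  have E1 : \1_[set y | rY y <= 0] (Y w) = 1 :> R by rewrite indicE mem_set.
  rewrite E1 mulr1.
  have := DPsqr _ (mulr_ge0 (ler0n _ 4) F0) DPF.
  have -> : (4 * F) ^+ 2 = 16 * F ^+ 2 by ring.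
  have h1 : 0 <= 16 * sg ^+ 2 * \1_[set y | (dist_to Nm K y <= r%:E)%E] (Y w).
    exact: mulr_ge0 (mulr_ge0 (ler0n _ 16) sg2) iA.
  have h2 : 0 <= (4 + 16 * F ^+ 2 + 16 * sg `^ (- e) + 16 * (m / 2) `^ (- e)) * T `^ (2 + e).
    by rewrite mulr_ge0// !addr_ge0// ?mulr_ge0.
  lra.
have close a b : (a < b)%N -> bdev a b w <= T ->
    close_means d0 f h rho (Y w) (fun m => th m w)
    (fun d => post theta h rho (f d) (Y w)) (post theta h rho fm (Y w)) T a b.
  move=> ab bT; have [H1 H2] := block_dev_close d0 mf fF mh noise_rho th ab y0.
  by split; [move=> d; exact: le_trans (H1 d) bT|exact: le_trans H2 bT].
have b1 := bdev0 0 M w; have b2 := bdev0 M (M + M)%N w; have b3 := bdev0 0 (M + M)%N w.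
have cl1 := close 0%N M Mp; have cl2 := close M (M + M)%N M2.
have cl3 := close 0%N (M + M)%N M02.
rewrite /T /level_dev in cl1 cl2 cl3.
have {}cl1 := cl1 ltac:(lra); have {}cl2 := cl2 ltac:(lra); have {}cl3 := cl3 ltac:(lra).
rewrite -/(level_dev w) -/T in cl1 cl2 cl3.
have D4 : `|DP w| <= 4 * T by exact: DeltaP_le_close cl1 cl2 cl3.
have D16 : DP w ^+ 2 <= 16 * T ^+ 2.
  have -> : 16 * T ^+ 2 = (4 * T) ^+ 2 by ring.
  exact: DPsqr (mulr_ge0 (ler0n _ 4) T0) D4.
have h2 : 0 <= 16 * F ^+ 2 * \1_[set y | rY y <= 0] (Y w) by rewrite !mulr_ge0.
have [rd|rd] := leP (dist_to Nm K (Y w)) r%:E.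
  have E1 : \1_[set y | (dist_to Nm K y <= r%:E)%E] (Y w) = 1 :> R by rewrite indicE mem_set.
  rewrite E1 mulr1.
  have := sqr_le_sqrD_powR e0 sg0 T0.
  have h4 : 0 <= (4 + 16 * F ^+ 2 + 16 * (m / 2) `^ (- e)) * T `^ (2 + e).
    by rewrite mulr_ge0// !addr_ge0// ?mulr_ge0.
  lra.
have h1 : 0 <= 16 * sg ^+ 2 * \1_[set y | (dist_to Nm K y <= r%:E)%E] (Y w).
  exact: mulr_ge0 (mulr_ge0 (ler0n _ 16) sg2) iA.
have h5 : 0 <= 16 * sg `^ (- e) * T `^ (2 + e) by rewrite !mulr_ge0.
have [Tm|mT] := leP T (m / 2); last first.
  have h3 := sqr_le_powR e0 (divr_gt0 m0 (ltr0n _ 2)) T0 (ltW mT).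
  have h4 : 0 <= (4 + 16 * F ^+ 2) * T `^ (2 + e) by rewrite mulr_ge0// !addr_ge0// ?mulr_ge0.
  lra.
have [dopt gap] := gap_far r0 y0 rd.
have d1T : dev1 h rho (Y w) (fun m => th m w) (rY (Y w)) 0 M +
    dev1 h rho (Y w) (fun m => th m w) (rY (Y w)) M (M + M) <= T.
  have e1' := block_dev_dev1 d0 fF th 0%N M y0.
  have e2' := block_dev_dev1 d0 fF th M (M + M)%N y0.
  by rewrite /T /level_dev; move: e1' e2'; rewrite -/(bdev _ _ _) -/(bdev _ _ _) => ? ?; lra.
have gap' d : d != dopt -> post theta h rho (f d) (Y w) + 2 * T <=
    post theta h rho (f dopt) (Y w).
  by move=> /gap; rewrite -/m => ?; lra.
have D2 := DeltaP_le_gap rho0 M0_gt0 cl1 cl2 cl3 y0 d1T gap'.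
have : `|DP w| <= Num.min (2 * T ^+ 2) (4 * F) by rewrite le_min D2 DPF.
move=> /(DPsqr _ _); rewrite le_min !mulr_ge0 ?sqr_ge0//= => /(_ isT).
have := sqr_le_quartic e01 T0.
have h6 : 0 <= 16 * (m / 2) `^ (- e) * T `^ (2 + e) by rewrite !mulr_ge0.
lra.
Qed.

Variables (p e A : R).
Hypotheses (e01 : 0 <= e <= 1) (ep : 2 + e <= p).
Hypothesis ratio_moment :
  (\int[P]_w \int[P]_w'
     (lratio theta h rho (obs h theta noise w) (theta w') `^ p)%:E <= A%:E)%E.
Hypothesis Y_law : same_law P Y (obs h theta noise).
Hypothesis th_law : forall m, (m < N)%N -> same_law P (th m) theta.
Hypothesis draws_indep : mutually_independent P (fun i : option 'I_N =>
  if i is Some m then sigma_of (th m) else sigma_of Y).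

Let Cb := block_const (D := D) F p e A.
Let Cb0 : 0 <= Cb.
Proof. exact: block_const_ge0 ratio_moment. Qed.
Let e0 : 0 <= e. Proof. by case/andP: e01. Qed.
Let q0 : 0 <= 2 + e. Proof. by rewrite addr_ge0. Qed.

Lemma level_dev_moment :
  (\int[P]_w (level_dev w `^ (2 + e))%:E <=
    (4 `^ (2 + e) * (3 * Cb) * M%:R `^ (- (1 + e / 2)))%:E)%E.
Proof.
have mb a b : (a < b)%N -> measurable_fun setT (fun w => (bdev a b w `^ (2 + e))%:E).
  move=> ab; apply/measurable_EFinP; apply: (measurableT_comp (measurable_powR _)).
  exact: (measurable_block_dev d0 mf F theta mh noise_rho Y th ab).
have b0 a b w : (0 <= (bdev a b w `^ (2 + e))%:E)%E by rewrite lee_fin powR_ge0.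
have H a b : (a < b)%N -> (b <= M + M)%N -> (M <= b - a)%N ->
    (\int[P]_w (bdev a b w `^ (2 + e))%:E <= (Cb * M%:R `^ (- (1 + e / 2)))%:E)%E.
  move=> ab bN Mab; have bN' : (b <= N)%N by rewrite NE.
  apply: (le_trans (block_dev_moment d0 mf fF mh noise_rho e01 ep ratio_moment
    Y_law th_law draws_indep ab bN')).
  rewrite lee_fin ler_wpM2l// !powRN lef_pV2 ?posrE ?powR_gt0 ?ltr0n ?subn_gt0//.
  by apply: ler_powRl; rewrite ?addr_ge0 ?divr_ge0// ler_nat.
apply: (@le_trans _ _ (\int[P]_w ((4 `^ (2 + e))%:E * ((bdev 0 M w `^ (2 + e))%:E +
   ((bdev M (M + M)%N w `^ (2 + e))%:E + (bdev 0 (M + M)%N w `^ (2 + e))%:E))))%E).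
  apply: ge0_le_integral => //.
  - by move=> w _; rewrite lee_fin powR_ge0.
  - apply/measurable_EFinP; apply: (measurableT_comp (measurable_powR _)).
    exact: measurable_level_dev.
  - by apply: measurable_funeM; apply: emeasurable_funD; [|apply: emeasurable_funD];
      exact: mb.
  move=> w _; rewrite -!EFinD -EFinM lee_fin /level_dev.
  set x := bdev 0 M w; set y := bdev M (M + M)%N w; set z := bdev 0 (M + M)%N w.
  have x0 : 0 <= x by exact: bdev0.
  have y0 : 0 <= y by exact: bdev0.
  have z0 : 0 <= z by exact: bdev0.
  have px := powR_ge0 x (2 + e); have py := powR_ge0 y (2 + e).
  have pz := powR_ge0 z (2 + e).
  have H1 := powR_normD_le (x + y) z q0; have H2 := powR_normD_le x y q0.
  rewrite !ger0_norm ?addr_ge0// in H1; rewrite !ger0_norm ?addr_ge0// in H2.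
  have -> : 4 `^ (2 + e) = 2 `^ (2 + e) * 2 `^ (2 + e) :> R.
    by rewrite -powRM//; congr (_ `^ _); rewrite -natrM.
  set k2 := 2 `^ (2 + e) in H1 H2 *.
  have k21 : 1 <= k2.
    by rewrite -[leLHS](powRr0 2); apply: ler_powR; rewrite ?ler1n.
  apply: (le_trans H1); rewrite -mulrA ler_wpM2l//; first by rewrite powR_ge0.
  rewrite addrA mulrDr lerD// ler_peMl//.
rewrite ge0_integralZl//; last 2 first.
- by apply: emeasurable_funD; [|apply: emeasurable_funD]; exact: mb.
- by move=> w _; rewrite !adde_ge0.
rewrite -mulrA EFinM lee_wpmul2l ?lee_fin ?powR_ge0//.
rewrite ge0_integralD//; last 3 first.
- exact: mb.
- by move=> w _; rewrite adde_ge0.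
- by apply: emeasurable_funD; exact: mb.
rewrite ge0_integralD//; [|exact: mb|exact: mb].
have -> : 3 * Cb * M%:R `^ (- (1 + e / 2)) = Cb * M%:R `^ (- (1 + e / 2)) +
  (Cb * M%:R `^ (- (1 + e / 2)) + Cb * M%:R `^ (- (1 + e / 2))) by ring.
rewrite !EFinD; apply: leeD; first by apply: H; rewrite ?subn0// leq_addr.
by apply: leeD; apply: H; rewrite ?addnK ?subn0 ?leq_addr.
Qed.

Let mDP : measurable_fun setT DP.
Proof. exact: (measurable_DeltaP d0 mf mh noise_rho). Qed.

Lemma measurable_rhoY_le0 : measurable [set y | rY y <= 0].
Proof.
rewrite (_ : [set y | _] = rY @^-1` `]-oo, 0%R]%classic); last first.
  by apply/seteqP; split => y /=; rewrite in_itv.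
by rewrite -[X in measurable X]setTI; exact: (measurable_rhoY theta mh noise_rho).
Qed.

Lemma DeltaP_second_moment r sg : 0 < r < 1 -> 0 < sg ->
  (\int[P]_w (DP w ^+ 2)%:E <=
    ((4 + 16 * F ^+ 2 + 16 * sg `^ (- e) + 16 * (Num.min c1 (c2 * r) / 2) `^ (- e)) *
      (4 `^ (2 + e) * (3 * Cb) * M%:R `^ (- (1 + e / 2))) +
     16 * sg ^+ 2 * (c0 * r))%:E)%E.
Proof.
move=> r01 sg0; have /andP[r0 r1] := r01.
set c3 := 4 + _ + _ + _.
have c30 : 0 <= c3.
  by rewrite /c3 !addr_ge0 ?mulr_ge0 ?powR_ge0 ?sqr_ge0.
have mB1 := measurable_dist_le Nm_norm K r.
set B1 := [set y | _] in mB1.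
have mB2 := measurable_rhoY_le0; set B2 := [set y | _] in mB2.
have mi (B : set 'rV[R]_t) : measurable B ->
    measurable_fun setT (fun w => (\1_B (Y w))%:E : \bar R).
  move=> mB; apply/measurable_EFinP.
  by apply: (@measurableT_comp _ _ _ _ _ _ (\1_B : 'rV[R]_t -> R)).
have i0 (B : set 'rV[R]_t) w : (0 <= (\1_B (Y w))%:E :> \bar R)%E by rewrite lee_fin indicE.
have iE (B : set 'rV[R]_t) : measurable B ->
    (\int[P]_w (\1_B (Y w))%:E = P (obs h theta noise @^-1` B))%E.
  move=> mB; rewrite -(Y_law mB) -[X in P X]setIT -integral_indic//.
  exact: measurable_preimageT.
have mL : measurable_fun setT (fun w => (level_dev w `^ (2 + e))%:E).
  apply/measurable_EFinP; apply: (measurableT_comp (measurable_powR _)).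
  exact: measurable_level_dev.
have k1 : 0 <= 16 * sg ^+ 2 by rewrite mulr_ge0 ?sqr_ge0.
have k2 : 0 <= 16 * F ^+ 2 by rewrite mulr_ge0 ?sqr_ge0.
apply: (@le_trans _ _ (\int[P]_w (c3%:E * (level_dev w `^ (2 + e))%:E +
   ((16 * sg ^+ 2)%:E * (\1_B1 (Y w))%:E + (16 * F ^+ 2)%:E * (\1_B2 (Y w))%:E)))%E).
  apply: ge0_le_integral => //.
  - by move=> w _; rewrite lee_fin sqr_ge0.
  - by apply/measurable_EFinP; apply: measurable_funX.
  - apply: emeasurable_funD; first exact: measurable_funeM.
    by apply: emeasurable_funD; apply: measurable_funeM; exact: mi.
  - move=> w _; rewrite -!EFinM -!EFinD lee_fin addrA.
    exact: DeltaP_sqr_le.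
rewrite ge0_integralD//; last 4 first.
- by move=> w _; rewrite mule_ge0 ?lee_fin ?powR_ge0.
- exact: measurable_funeM.
- by move=> w _; rewrite adde_ge0// mule_ge0 ?lee_fin.
- by apply: emeasurable_funD; apply: measurable_funeM; exact: mi.
rewrite ge0_integralD//; last 4 first.
- by move=> w _; rewrite mule_ge0 ?lee_fin.
- by apply: measurable_funeM; exact: mi.
- by move=> w _; rewrite mule_ge0 ?lee_fin.
- by apply: measurable_funeM; exact: mi.
rewrite !ge0_integralZl ?lee_fin ?powR_ge0//;
  [|exact: mi|exact: mi|by move=> w _; rewrite lee_fin powR_ge0].
rewrite !iE// [X in (_ + (_ + _ * X))%E](_ : _ = 0%E); last first.
  exact: (rhoY_obs_gt0 mh noise_rho noise_indep).
rewrite mule0 adde0 [leRHS]EFinD; apply: leeD.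
  by rewrite [leRHS]EFinM lee_wpmul2l ?lee_fin//; exact: level_dev_moment.
by rewrite [leRHS]EFinM lee_wpmul2l ?lee_fin//; exact: K_small.
Qed.

(** With r = M^(-1/4) / 2 < 1, half of min(c1, c2 r) is at least min(c1, c2) M^(-1/4) / 4, which
    explains the 4; 8 c0 is 16 c0 times the 1/2 in r. *)
Definition variance_const : R :=
  (4 + 16 * F ^+ 2 + 16 + 16 * (Num.min c1 c2 / 4) `^ (- e)) *
  (4 `^ (2 + e) * (3 * Cb)) + 8 * c0.

Lemma DeltaP_variance :
  (\int[P]_w (DP w ^+ 2)%:E <= (variance_const * M%:R `^ (- (1 + e / 16)))%:E)%E.
Proof.
pose x : R := M%:R.
have x1 : 1 <= x by rewrite ler1n.
have x0 : 0 < x by exact: lt_le_trans x1.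
have e1 : e <= 1 by case/andP: e01.
(* The exponents balance: sg^(-e) lowers the decay 1 + e/2 to 1 + e/16, and sg^2 r decays with
   exponent 7/8 + 1/4 = 9/8 >= 1 + e/16. Halving keeps r below 1 even for M = 1. *)
pose r := x `^ (- 4^-1) / 2; pose sg := x `^ (- (7 / 16)).
have xle a : a <= 0 -> x `^ a <= 1.
  by move=> a0; rewrite -[leRHS](powRr0 x); apply: ler_powR.
have r0 : 0 < r by rewrite divr_gt0// powR_gt0.
have r2 : r <= 2^-1 by rewrite /r ler_piMl// xle// oppr_le0 invr_ge0.
have r1 : r < 1 by lra.
have sg0 : 0 < sg by rewrite powR_gt0.
have r01 : 0 < r < 1 by rewrite r0 r1.
apply: (le_trans (DeltaP_second_moment r01 sg0)); rewrite lee_fin -/x.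
set cm := Num.min c1 c2.
have cm0 : 0 < cm by rewrite lt_min c1_gt0 c2_gt0.
have xpp a b : x `^ a * x `^ b = x `^ (a + b).
  by rewrite powRD//; apply/implyP => _; rewrite gt_eqF.
have sgE : sg `^ (- e) = x `^ (7 / 16 * e).
  by rewrite /sg -powRrM; congr (_ `^ _); ring.
have mE : (Num.min c1 (c2 * r) / 2) `^ (- e) <= (cm / 4) `^ (- e) * x `^ (7 / 16 * e).
  apply: (@le_trans _ _ ((cm / 4 * x `^ (- 4^-1)) `^ (- e))).
    have h1 : 0 < cm / 4 * x `^ (- 4^-1) by rewrite mulr_gt0 ?powR_gt0// divr_gt0.
    have h2 : cm / 4 * x `^ (- 4^-1) <= Num.min c1 (c2 * r) / 2.
      have -> : cm / 4 * x `^ (- 4^-1) = cm * r / 2 by rewrite /r; field.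
      rewrite ler_wpM2r ?invr_ge0// le_min.
      have cc1 : cm <= c1 by rewrite ge_min lexx.
      have cc2 : cm <= c2 by rewrite ge_min lexx orbT.
      by apply/andP; split; nra.
    rewrite [leLHS]powRN [leRHS]powRN lef_pV2 ?posrE ?powR_gt0//;
      last exact: (lt_le_trans h1 h2).
    by apply: ler_powRl => //; exact: ltW.
  rewrite powRM ?powR_ge0//; last by rewrite divr_ge0// ltW.
  rewrite ler_wpM2l ?powR_ge0// -powRrM; apply: ler_powR => //.
  by have := e0; nra.
have E1 : x `^ (7 / 16 * e) * x `^ (- (1 + e / 2)) = x `^ (- (1 + e / 16)).
  by rewrite xpp; congr (_ `^ _); field.
have E2 : 16 * sg ^+ 2 * (c0 * r) <= 8 * c0 * x `^ (- (1 + e / 16)).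
  have -> : 16 * sg ^+ 2 * (c0 * r) =
      8 * c0 * (x `^ (- (7 / 16)) * x `^ (- (7 / 16)) * x `^ (- 4^-1)).
    by rewrite /r /sg; field.
  rewrite !xpp ler_wpM2l ?mulr_ge0 ?(ltW c0_gt0)//; apply: ler_powR => //; lra.
rewrite /variance_const -/cm [leRHS]mulrDl; apply: lerD => //.
set Ct := 4 `^ (2 + e) * (3 * Cb).
have Ct0 : 0 <= Ct by exact: mulr_ge0 (powR_ge0 _ _) (mulr_ge0 (ler0n _ 3) Cb0).
rewrite -E1; set X1 := x `^ (7 / 16 * e); set X2 := x `^ (- (1 + e / 2)).
set K1 := 4 + 16 * F ^+ 2 + 16 + _.
have -> : K1 * Ct * (X1 * X2) = K1 * X1 * (Ct * X2) by ring.
apply: ler_wpM2r; first by rewrite mulr_ge0 ?powR_ge0.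
have X11 : 1 <= X1.
  rewrite -[leLHS](powRr0 x); apply: ler_powR => //; have := e0; lra.
have t1 : 4 + 16 * F ^+ 2 <= (4 + 16 * F ^+ 2) * X1.
  by rewrite ler_peMr// addr_ge0// mulr_ge0 ?sqr_ge0.
rewrite sgE -/X1 /K1; move: mE; rewrite -/X1; lra.
Qed.

End level_variance.

(** * Bias *)

Section level_bias.
Context {disp : measure_display} {Om : measurableType disp} {R : realType}
  (P : probability Om R) {s t : nat} {D : finType}.
Variables (d0 : D) (f : D -> 'rV[R]_s -> R).
Hypothesis mf : forall d, measurable_fun [set: 'rV[R]_s] (f d).
Variables (F : R) (fF : forall d u, `|f d u| <= F).
Variables (theta : {RV P >-> 'rV[R]_s}).
Variables (h : 'rV[R]_s -> 'rV[R]_t) (mh : measurable_fun [set: 'rV[R]_s] h).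
Variables (rho : 'rV[R]_t -> R) (noise : {RV P >-> 'rV[R]_t}).
Hypothesis noise_rho : has_density P noise rho.
Hypothesis noise_indep : independent_RV P theta noise.

Let fm u := maxD d0 (f ^~ u).
Let rY := rhoY P h rho theta.
Let rho0 x : 0 <= rho x. Proof. by case: noise_rho. Qed.
Let F0 : 0 <= F. Proof. exact: le_trans (fF d0 0). Qed.
Let mfm : measurable_fun setT fm. Proof. exact: measurable_maxD. Qed.
Let fmF u : `|fm u| <= F. Proof. exact: maxD_bounded. Qed.

Definition posterior_regret (y : 'rV[R]_t) : R :=
  post theta h rho fm y - maxD d0 (fun d => post theta h rho (f d) y).

Lemma measurable_posterior_regret : measurable_fun setT posterior_regret.
Proof.
have mpost phi := @measurable_post _ _ _ P _ _ theta h mh rho noise noise_rho phi.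
apply: measurable_funB; first exact: mpost.
by apply: measurable_maxD => d; exact: mpost.
Qed.

Lemma posterior_regret_bounded y : `|posterior_regret y| <= 2 * F.
Proof.
have pF phi := @post_bounded _ _ _ P _ _ theta h mh rho noise noise_rho phi.
have h1 := pF fm mfm F fmF y.
have h2 : `|maxD d0 (fun d => post theta h rho (f d) y)| <= F.
  by apply: maxD_bounded => d; exact: pF.
by rewrite (le_trans (ler_normB _ _))// mulrDl mul1r lerD.
Qed.

(** The best prior mean is common to both values and cancels. The tower property rewrites the
    remaining prior expectation as a mean over Y. *)
Lemma EVPI_sub_EVSI pi0 : has_density P theta pi0 ->
  EVPI P d0 f theta - EVSI P d0 f h rho pi0 theta noise =
  \int[P]_w posterior_regret (obs h theta noise w).
Proof.
move=> theta_pi0.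
have pF phi := @post_bounded _ _ _ P _ _ theta h mh rho noise noise_rho phi.
have mpost phi := @measurable_post _ _ _ P _ _ theta h mh rho noise noise_rho phi.
have mo := measurable_obs theta mh noise.
rewrite /EVPI /EVSI opprB addrA subrK.
rewrite /posterior_regret RintegralB//; last 2 first.
- apply: (@integrable_bounded _ _ _ P _ F); first exact: measurableT_comp (mpost _ mfm) mo.
  by move=> w; exact: pF.
- apply: (@integrable_bounded _ _ _ P _ F).
    apply: (measurableT_comp (f := fun y => maxD d0 (fun d => post theta h rho (f d) y))) => //.
    by apply: measurable_maxD => d; exact: mpost.
  by move=> w; apply: maxD_bounded => d; exact: pF.
congr (_ - _).
  by rewrite (EY_post mh noise_rho noise_indep mfm fmF).
rewrite /EY; apply: eq_Rintegral => w _; congr maxD; apply/funext => d.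
exact: (Epost_post theta_pi0 mh noise_rho (mf d) (fF d)).
Qed.

Section one_level.
Variables (Y : {RV P >-> 'rV[R]_t}) (th : nat -> {RV P >-> 'rV[R]_s}).

Let regret := block_regret d0 f h rho Y th.

Variables (N : nat) (N_gt0 : (0 < N)%N).
Variables (p e A : R).
Hypotheses (e01 : 0 <= e <= 1) (ep : 2 + e <= p).
Hypothesis ratio_moment :
  (\int[P]_w \int[P]_w'
     (lratio theta h rho (obs h theta noise w) (theta w') `^ p)%:E <= A%:E)%E.
Hypothesis Y_law : same_law P Y (obs h theta noise).
Hypothesis th_law : forall m, (m < N)%N -> same_law P (th m) theta.
Hypothesis draws_indep : mutually_independent P (fun i : option 'I_N =>
  if i is Some m then sigma_of (th m) else sigma_of Y).

Let Cb := block_const (D := D) F p e A.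
Let bdev := block_dev d0 f F theta h rho Y th.

Lemma regret_dist_le w : `|regret 0 N w - posterior_regret (Y w)| <=
  2 * bdev 0 N w + 4 * F * \1_[set y | rY y <= 0] (Y w).
Proof.
have bd0 : 0 <= bdev 0 N w by exact: (block_dev_ge0 d0 fF).
have [y0|y0] := leP (rY (Y w)) 0.
  have -> : \1_[set y | rY y <= 0] (Y w) = 1 :> R by rewrite indicE mem_set.
  have : `|regret 0 N w| <= 2 * F by exact: (block_regret_bounded d0 fF h noise_rho).
  have := posterior_regret_bounded (Y w).
  by rewrite !ler_norml => /andP[? ?] /andP[? ?]; apply/andP; split; lra.
rewrite ler_wpDr//; first by rewrite mulr_ge0 ?mulr_ge0// indicE.
exact: close_means_dist (block_dev_close d0 mf fF mh noise_rho th N_gt0 y0).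
Qed.

(** Truncation at r = N^(-1/2): a value b > r satisfies b <= b^2 / r, which the (2+e)-th moment
    controls, and r^(-e-1) N^(-(1+e/2)) = r. *)
Lemma block_dev_mean :
  (\int[P]_w (bdev 0 N w)%:E <= ((2 + Cb) * N%:R `^ (- 2^-1))%:E)%E.
Proof.
have e0 : 0 <= e by case/andP: e01.
have mb := measurable_block_dev d0 mf F theta mh noise_rho Y th N_gt0.
pose x : R := N%:R.
have x0 : 0 < x by rewrite ltr0n.
pose r := x `^ (- 2^-1).
have r0 : 0 < r by rewrite powR_gt0.
have ptw w : bdev 0 N w <= 2 * r + r `^ (- e) / r * bdev 0 N w `^ (2 + e).
  have b0 : 0 <= bdev 0 N w by exact: (block_dev_ge0 d0 fF).
  have p0 : 0 <= r `^ (- e) / r * bdev 0 N w `^ (2 + e).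
    by rewrite !mulr_ge0 ?powR_ge0// invr_ge0 ltW.
  have [br|br] := leP (bdev 0 N w) r; first by lra.
  have := sqr_le_sqrD_powR e0 r0 b0; set b := bdev 0 N w in b0 br p0 *.
  rewrite -(ler_pM2r (_ : 0 < r^-1)) ?invr_gt0// mulrDl => H.
  have h1 : b <= b ^+ 2 / r by rewrite ler_pdivlMr// expr2 ler_wpM2l// ltW.
  have h2 : r ^+ 2 / r = r by rewrite expr2 mulfK// gt_eqF.
  rewrite h2 mulrAC in H; lra.
apply: (@le_trans _ _ (\int[P]_w ((2 * r)%:E +
    (r `^ (- e) / r)%:E * (bdev 0 N w `^ (2 + e))%:E))%E).
  apply: ge0_le_integral => //.
  - by move=> w _; rewrite lee_fin (block_dev_ge0 d0 fF).
  - exact/measurable_EFinP.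
  - apply: emeasurable_funD => //; apply: measurable_funeM; apply/measurable_EFinP.
    exact: (measurableT_comp (measurable_powR _)).
  - by move=> w _; rewrite -EFinM -EFinD lee_fin.
have mp : measurable_fun setT (fun w => (bdev 0 N w `^ (2 + e))%:E).
  by apply/measurable_EFinP; exact: (measurableT_comp (measurable_powR _)).
have k0 : 0 <= r `^ (- e) / r by rewrite mulr_ge0 ?powR_ge0// invr_ge0 ltW.
rewrite ge0_integralD//; last 3 first.
- by move=> w _; rewrite lee_fin mulr_ge0// ltW.
- by move=> w _; rewrite mule_ge0 ?lee_fin ?powR_ge0.
- exact: measurable_funeM.
rewrite (_ : \int[P]_x (2 * r)%:E = (2 * r)%:E)%E; last first.
  by rewrite integral_cst// -[RHS]mule1; congr (_ * _)%E; exact: probability_setT.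
rewrite ge0_integralZl ?lee_fin//; last by move=> w _; rewrite lee_fin powR_ge0.
have H := block_dev_moment d0 mf fF mh noise_rho e01 ep ratio_moment Y_law th_law
  draws_indep N_gt0 (leqnn N).
have {H}H := lee_wpmul2l (_ : 0%E <= (r `^ (- e) / r)%:E)%E H.
apply: (le_trans (leeD2l _ (H _))); first by rewrite lee_fin.
rewrite subn0 -EFinM -EFinD lee_fin -/x -/r.
have E : r `^ (- e) / r * x `^ (- (1 + e / 2)) = r.
  rewrite -[r^-1]powR_inv1 ?(ltW r0)// /r -!powRrM -!powRD; first by congr (_ `^ _); field.
    by apply/implyP => _; rewrite gt_eqF.
  by apply/implyP => _; rewrite gt_eqF.
by rewrite [X in _ + X]mulrCA E -mulrDl.
Qed.

Lemma block_regret_bias :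
  `|\int[P]_w regret 0 N w - \int[P]_w posterior_regret (obs h theta noise w)|
   <= 2 * (2 + Cb) * N%:R `^ (- 2^-1).
Proof.
have mo := measurable_obs theta mh noise.
have mpY : measurable_fun setT (fun w => posterior_regret (Y w)).
  exact: measurableT_comp measurable_posterior_regret _.
have -> : \int[P]_w posterior_regret (obs h theta noise w) = \int[P]_w posterior_regret (Y w).
  rewrite /Rintegral; congr fine; apply/esym.
  apply: (@same_law_integral _ _ _ P _ _ Y (obs h theta noise)
    (EFin \o posterior_regret)) => //.
  by apply/measurable_EFinP; exact: measurable_posterior_regret.
have ipY : P.-integrable setT (EFin \o (fun w => posterior_regret (Y w))).
  by apply: (@integrable_bounded _ _ _ P _ (2 * F)) => // w; exact: posterior_regret_bounded.
have ibr := integrable_block_regret d0 mf fF mh noise_rho Y th N_gt0.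
rewrite -RintegralB//.
have idiff : P.-integrable setT (EFin \o (fun w => regret 0 N w - posterior_regret (Y w))).
  exact: (integrableB measurableT ibr ipY).
rewrite (le_trans (le_normr_Rintegral _ idiff))//.
rewrite -lee_fin EFin_Rintegral; last exact: (integrable_norm idiff).
have mb := measurable_block_dev d0 mf F theta mh noise_rho Y th N_gt0.
have mB := measurable_rhoY_le0 theta mh noise_rho.
have mi : measurable_fun setT (fun w => (\1_[set y | rY y <= 0] (Y w))%:E : \bar R).
  apply/measurable_EFinP.
  by apply: (@measurableT_comp _ _ _ _ _ _ (\1_[set y | rY y <= 0] : 'rV[R]_t -> R)).
apply: (@le_trans _ _ (\int[P]_w (2%:E * (bdev 0 N w)%:E +
  (4 * F)%:E * (\1_[set y | rY y <= 0] (Y w))%:E))%E).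
  apply: ge0_le_integral => //.
  - apply/measurable_EFinP; apply: measurableT_comp => //.
    by apply: measurable_funB => //; exact: (measurable_block_regret d0 mf mh noise_rho).
  - apply: emeasurable_funD; apply: measurable_funeM => //.
    exact/measurable_EFinP.
  - by move=> w _; rewrite -!EFinM -EFinD lee_fin; exact: regret_dist_le.
have F4 : 0 <= 4 * F by rewrite mulr_ge0.
have b0 w : (0 <= (bdev 0 N w)%:E)%E by rewrite lee_fin (block_dev_ge0 d0 fF).
have i0 w : (0 <= (\1_[set y | rY y <= 0] (Y w))%:E :> \bar R)%E by rewrite lee_fin indicE.
have mbE : measurable_fun setT (fun w => (bdev 0 N w)%:E) by exact/measurable_EFinP.
rewrite ge0_integralD//; last 4 first.
- by move=> w _; rewrite mule_ge0.
- exact: measurable_funeM.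
- by move=> w _; rewrite mule_ge0.
- exact: measurable_funeM.
rewrite !ge0_integralZl//.
have -> : (\int[P]_w (\1_[set y | rY y <= 0] (Y w))%:E = 0)%E.
  rewrite -(rhoY_obs_gt0 mh noise_rho noise_indep).
  rewrite -[RHS](Y_law mB) -[X in P X]setIT -integral_indic//.
  exact: measurable_preimageT.
rewrite mule0 adde0 -mulrA EFinM lee_wpmul2l//; exact: block_dev_mean.
Qed.

End one_level.

(** * Invariance of the law of a block *)

Section regret_law.

(** A block enters [block_regret] only through the likelihood-weighted sums of these functions;
    stacked in a row vector of length K (here the number of statistics) they form the state of a
    [chain]. *)
Definition stat (j : option (option D)) (u : 'rV[R]_s) : R :=
  match j with None => 1 | Some None => fm u | Some (Some d) => f d u end.

Let K := #|{: option (option D)}|.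

Let s0 (y : 'rV[R]_t) : 'rV[R]_t * 'rV[R]_K := (y, 0).

Let incr (y : 'rV[R]_t) (x : 'rV[R]_s) : 'rV[R]_K :=
  \row_j (stat (enum_val j) x * lik h rho y x).

Let upd (z : ('rV[R]_t * 'rV[R]_K) * 'rV[R]_s) : 'rV[R]_t * 'rV[R]_K :=
  (z.1.1, z.1.2 + incr z.1.1 z.2).

Let mstat j : measurable_fun setT (stat j).
Proof. by case: j => [[d|]|]; [exact: mf|exact: mfm|exact: measurable_cst]. Qed.

Let ms0 : measurable_fun setT s0.
Proof. exact: measurable_fun_pair. Qed.

Let m11 : measurable_fun setT (fun z : ('rV[R]_t * 'rV[R]_K) * 'rV[R]_s => z.1.1).
Proof. exact: measurableT_comp measurable_fst measurable_fst. Qed.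

Let mupd : measurable_fun setT upd.
Proof.
apply: measurable_fun_pair => //; apply: measurable_rV_add.
  exact: measurableT_comp measurable_snd measurable_fst.
apply: measurable_fun_rV => j.
rewrite (_ : (fun z => _) = (fun z : ('rV[R]_t * 'rV[R]_K) * 'rV[R]_s =>
    stat (enum_val j) z.2 * lik h rho z.1.1 z.2)); last first.
  by apply/funext => z; rewrite mxE.
apply: measurable_funM; first exact: measurableT_comp (mstat _) measurable_snd.
apply: (measurable_lik_comp mh noise_rho) => //; exact: measurable_snd.
Qed.

Let chainE (Y : {RV P >-> 'rV[R]_t}) (th : nat -> {RV P >-> 'rV[R]_s}) a n :
  chain s0 upd Y th a n = fun w => (Y w, \row_j \sum_(a <= m < a + n)
    (stat (enum_val j) (th m w) * lik h rho (Y w) (th m w))).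
Proof.
elim: n => [|n IH] /=; apply/funext => w.
  congr pair; apply/rowP => j; rewrite !mxE addn0 big_geq//.
rewrite IH /upd /=; congr pair; apply/rowP => j; rewrite !mxE.
by rewrite addnS big_nat_recr ?leq_addr.
Qed.

Let final (n : nat) (z : 'rV[R]_t * 'rV[R]_K) : R :=
  let v j := z.2 ord0 (enum_rank j) / n%:R in
  v (Some None) / v None - maxD d0 (fun d => v (Some (Some d)) / v None).

Let mfinal n : measurable_fun setT (final n).
Proof.
have mv j : measurable_fun setT
    (fun z : 'rV[R]_t * 'rV[R]_K => z.2 ord0 (enum_rank j) / n%:R).
  apply: measurable_funM => //.
  exact: measurableT_comp (measurable_rV_coord _) measurable_snd.
rewrite /final; apply: measurable_funB; first exact: measurable_fun_div.
by apply: measurable_maxD => d; exact: measurable_fun_div.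
Qed.

Let block_regretE (Y : {RV P >-> 'rV[R]_t}) (th : nat -> {RV P >-> 'rV[R]_s}) a n :
  block_regret d0 f h rho Y th a (a + n) = final n \o chain s0 upd Y th a n.
Proof.
rewrite chainE; apply/funext => w; rewrite /block_regret /final /=.
have E1 j : (\row_j \sum_(a <= m < a + n)
    (stat (enum_val j) (th m w) * lik h rho (Y w) (th m w))) ord0 (enum_rank j) / n%:R =
    savg a (a + n) (fun m => th m w) (fun u => stat j u * lik h rho (Y w) u).
  by rewrite mxE enum_rankK /savg addKn.
have E2 : savg a (a + n) (fun m => th m w) (fun u => stat None u * lik h rho (Y w) u) =
    savg a (a + n) (fun m => th m w) (lik h rho (Y w)).
  by rewrite /savg; congr (_ / _); apply: eq_bigr => i _; rewrite mul1r.
congr (_ - _); first by rewrite !E1 E2.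
by congr maxD; apply/funext => d; rewrite !E1 E2.
Qed.

(** The starting indices may differ, so each half of the draws of one level can be compared with the
    whole block of the level below. *)
Lemma block_regret_law (Y : {RV P >-> 'rV[R]_t}) (th : nat -> {RV P >-> 'rV[R]_s})
    (N a : nat) (Y' : {RV P >-> 'rV[R]_t}) (th' : nat -> {RV P >-> 'rV[R]_s})
    (N' a' n : nat) :
  mutually_independent P (fun i : option 'I_N =>
    if i is Some m then sigma_of (th m) else sigma_of Y) ->
  mutually_independent P (fun i : option 'I_N' =>
    if i is Some m then sigma_of (th' m) else sigma_of Y') ->
  (a + n <= N)%N -> (a' + n <= N')%N -> same_law P Y Y' ->
  (forall i j, (i < N)%N -> (j < N')%N -> same_law P (th i) (th' j)) ->
  \int[P]_w block_regret d0 f h rho Y th a (a + n) w =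
  \int[P]_w block_regret d0 f h rho Y' th' a' (a' + n) w.
Proof.
move=> di di' aN aN' YY tt.
rewrite !block_regretE /Rintegral; congr fine.
apply: (@same_law_integral _ _ _ P _ _ (chain s0 upd Y th a n) (chain s0 upd Y' th' a' n)
  (EFin \o final n)).
- exact: measurable_chain.
- exact: measurable_chain.
- apply: (same_law_chain ms0 mupd (N := N) (N' := N')) => //.
  + by move=> i iN; exact: (draws_tail_indep di iN).
  + exact: (draws_tail_indepY di).
  + by move=> i iN; exact: (draws_tail_indep di' iN).
  + exact: (draws_tail_indepY di').
- exact/measurable_EFinP.
Qed.

End regret_law.
End level_bias.

(** * Mean square error and cost *)

Section uncorrelated_sums.
Context {d : measure_display} {Om : measurableType d} {R : realType}
  (P : probability Om R).

Definition sq_integrable (f : Om -> R) : Prop :=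
  measurable_fun setT f /\ P.-integrable setT (EFin \o (fun w => f w ^+ 2)).

Lemma sq_integrable_mul f g : sq_integrable f -> sq_integrable g ->
  P.-integrable setT (EFin \o (fun w => f w * g w)).
Proof.
move=> [mf f2] [mg g2].
apply: (integrable_dominated (g := fun w => f w ^+ 2 + g w ^+ 2)).
- exact: measurable_funM.
- move=> w; rewrite normrM -[f w ^+ 2]real_normK ?num_real//.
  rewrite -[g w ^+ 2]real_normK ?num_real//.
  have := sqr_ge0 (`|f w| - `|g w|); have := normr_ge0 (f w); have := normr_ge0 (g w).
  nra.
- exact: (integrableD measurableT f2 g2).
Qed.

Lemma sq_integrableZ c f : sq_integrable f -> sq_integrable (fun w => c * f w).
Proof.
move=> [mf f2]; split; first exact: measurable_funM.
rewrite (_ : _ \o _ = (fun w => (c ^+ 2)%R%:E * (f w ^+ 2)%R%:E)%E).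
  exact: integrableZl.
by apply/funext => w; rewrite /= exprMn EFinM.
Qed.

Lemma sq_integrable_cst c : sq_integrable (fun=> c).
Proof. by split; [exact: measurable_cst|exact: integrable_cstR]. Qed.

Lemma sq_integrableD f g : sq_integrable f -> sq_integrable g ->
  sq_integrable (fun w => f w + g w).
Proof.
move=> sf sg; have [mf f2] := sf; have [mg g2] := sg.
split; first exact: measurable_funD.
have fg := sq_integrable_mul sf sg.
rewrite (_ : _ \o _ = ((EFin \o (fun w => f w ^+ 2)%R) \+
    ((fun w => 2%:E * (EFin \o (fun w => f w * g w)%R) w) \+
    (EFin \o (fun w => g w ^+ 2)%R)))%E).
  apply: integrableD => //; apply: integrableD => //; exact: integrableZl.
by apply/funext => w /=; rewrite sqrrD -mulr_natl !EFinD EFinM addeA.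
Qed.

Lemma sq_integrable_integrable f : sq_integrable f -> P.-integrable setT (EFin \o f).
Proof.
move=> sf; have := sq_integrable_mul sf (sq_integrable_cst 1).
by apply: eq_integrable => // w _ /=; rewrite mulr1.
Qed.

Lemma Rintegral_sqr_uncorrelated (I : eqType) (l : seq I) (a : I -> R)
    (x : I -> Om -> R) : uniq l -> (forall i, i \in l -> sq_integrable (x i)) ->
  (forall i j, i \in l -> j \in l -> i != j -> \int[P]_w (x i w * x j w) = 0) ->
  sq_integrable (fun w => \sum_(i <- l) a i * x i w) /\
  \int[P]_w (\sum_(i <- l) a i * x i w) ^+ 2 =
    \sum_(i <- l) a i ^+ 2 * \int[P]_w (x i w ^+ 2).
Proof.
elim: l => [|i l IH] /=.
  move=> _ _ _; split.
    by under eq_fun do rewrite big_nil; exact: sq_integrable_cst.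
  rewrite big_nil -[RHS](Rintegral_cstT P); apply: eq_Rintegral => w _.
  by rewrite big_nil expr0n.
move=> /andP[il ul] sx ux.
have sxl j : j \in l -> sq_integrable (x j) by move=> jl; apply: sx; rewrite inE jl orbT.
have sxi : sq_integrable (x i) by apply: sx; rewrite inE eqxx.
have [sS IS] := IH ul sxl (fun j k jl kl => ux j k
  (ltac:(by rewrite inE jl orbT)) (ltac:(by rewrite inE kl orbT))).
set S := fun w => _ in sS.
have saxi := sq_integrableZ (a i) sxi.
split; first by under eq_fun do rewrite big_cons; exact: sq_integrableD.
rewrite big_cons -IS.
have cross : \int[P]_w (x i w * S w) = 0.
  (* Stated for sublists so that the induction keeps l, and with it the orthogonality hypothesis,
     fixed; integrability is carried along for additivity. *)
  have H k : {subset k <= l} ->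
      P.-integrable setT (EFin \o (fun w => x i w * \sum_(j <- k) a j * x j w)) /\
      \int[P]_w (x i w * \sum_(j <- k) a j * x j w) = 0.
    elim: k => [|j k IHk] kl.
      split.
        rewrite (_ : _ \o _ = cst 0%E) ?integrable0//; apply/funext => w /=.
        by rewrite big_nil mulr0.
      rewrite -[RHS](Rintegral_cstT P); apply: eq_Rintegral => w _.
      by rewrite big_nil mulr0.
    have [ik Ik] := IHk (fun u uk => kl u (ltac:(by rewrite inE uk orbT))).
    have jl : j \in l by apply: kl; rewrite inE eqxx.
    have ij := sq_integrable_mul sxi (sxl j jl).
    have iaj : P.-integrable setT (EFin \o (fun w => a j * (x i w * x j w))).
      rewrite (_ : _ \o _ = (fun w => (a j)%:E * (x i w * x j w)%R%:E)%E)//.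
      exact: integrableZl.
    have E w : x i w * \sum_(j <- j :: k) a j * x j w =
        a j * (x i w * x j w) + x i w * \sum_(j <- k) a j * x j w.
      by rewrite big_cons; ring.
    split.
      rewrite (_ : EFin \o _ = EFin \o (fun w => a j * (x i w * x j w) +
         x i w * \sum_(j <- k) a j * x j w)).
        exact: (integrableD measurableT iaj ik).
      by apply/funext => w /=; rewrite E.
    under eq_Rintegral do rewrite E.
    rewrite RintegralD// Ik addr0 RintegralZl// ux ?mulr0// ?inE ?eqxx ?jl ?orbT//.
    by apply: contraNneq il => ->.
  by have [] := H l (fun=> id).
have iS2 : P.-integrable setT (EFin \o (fun w => S w ^+ 2)) by case: sS.
have ix2 : P.-integrable setT (EFin \o (fun w => x i w ^+ 2)) by case: sxi.
have ixS := sq_integrable_mul sxi sS.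
have i1 : P.-integrable setT (EFin \o (fun w => a i ^+ 2 * x i w ^+ 2)).
  rewrite (_ : _ \o _ = (fun w => (a i ^+ 2)%R%:E * (x i w ^+ 2)%R%:E)%E)//.
  exact: integrableZl.
have i2 : P.-integrable setT (EFin \o (fun w => 2 * a i * (x i w * S w))).
  rewrite (_ : _ \o _ = (fun w => (2 * a i)%R%:E * (x i w * S w)%R%:E)%E)//.
  exact: integrableZl.
have i12 : P.-integrable setT (EFin \o (fun w =>
    a i ^+ 2 * x i w ^+ 2 + 2 * a i * (x i w * S w))).
  exact: (integrableD measurableT i1 i2).
transitivity (\int[P]_w (a i ^+ 2 * x i w ^+ 2 + 2 * a i * (x i w * S w) + S w ^+ 2)).
  by apply: eq_Rintegral => w _; rewrite big_cons -/(S w); ring.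
by rewrite RintegralD// RintegralD// !RintegralZl// cross mulr0 addr0.
Qed.

Lemma indep_centered_mul (X X' : {RV P >-> R}) :
  sq_integrable X -> sq_integrable X' ->
  (forall A B, measurable A -> measurable B ->
    P (X @^-1` A `&` X' @^-1` B) = (P (X @^-1` A) * P (X' @^-1` B))%E) ->
  \int[P]_w ((X w - \int[P]_w X w) * (X' w - \int[P]_w X' w)) = 0.
Proof.
move=> sX sX' XX'; set m := \int[P]_w X w; set m' := \int[P]_w X' w.
have iX' := sq_integrable_integrable sX'.
pose Phi (z : R * R) := ((z.1 - m) * (z.2 - m'))%:E.
have mPhi : measurable_fun setT Phi.
  by apply/measurable_EFinP; apply: measurable_funM; apply: measurable_funB.
rewrite /Rintegral (indep_integral XX' mPhi); last first.
  apply: sq_integrable_mul.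
    exact: (sq_integrableD sX (sq_integrable_cst (- m))).
  exact: (sq_integrableD sX' (sq_integrable_cst (- m'))).
rewrite integral0_eq// => w _.
transitivity (\int[P]_w' ((X w - m)%:E * (X' w' - m')%:E))%E.
  by apply: eq_integral => w' _; rewrite -EFinM.
have iXm : P.-integrable setT (EFin \o (fun w' => X' w' - m')).
  exact: (integrableB measurableT iX' (integrable_cstR P m')).
rewrite integralZl// -EFin_Rintegral// RintegralB ?Rintegral_cstT ?subrr ?mule0//.
exact: integrable_cstR.
Qed.

Lemma centered_sqr_le (X : {RV P >-> R}) : sq_integrable X ->
  \int[P]_w ((X w - \int[P]_w X w) ^+ 2) <= \int[P]_w (X w ^+ 2).
Proof.
move=> sX; set m := \int[P]_w X w.
have iX := sq_integrable_integrable sX.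
have iX2 : P.-integrable setT (EFin \o (fun w => X w ^+ 2)) by case: sX.
have iZ : P.-integrable setT (EFin \o (fun w => 2 * m * X w - m ^+ 2)).
  apply: (integrableB measurableT (f := EFin \o (fun w => 2 * m * X w)) _
    (integrable_cstR P (m ^+ 2))).
  rewrite (_ : _ \o _ = (fun w => (2 * m)%R%:E * (X w)%:E)%E)//.
  exact: integrableZl.
have iZ1 : P.-integrable setT (EFin \o (fun w => 2 * m * X w)).
  rewrite (_ : _ \o _ = (fun w => (2 * m)%R%:E * (X w)%:E)%E)//.
  exact: integrableZl.
have -> : \int[P]_w ((X w - m) ^+ 2) = \int[P]_w (X w ^+ 2 - (2 * m * X w - m ^+ 2)).
  by apply: eq_Rintegral => w _; ring.
rewrite RintegralB// RintegralB//; last exact: integrable_cstR.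
rewrite Rintegral_cstT RintegralZl// -/m.
have := sqr_ge0 m; rewrite expr2; lra.
Qed.

End uncorrelated_sums.

(** * Choice of the last level and of the sample sizes *)

Section complexity.
Context {R : realType}.

Lemma geometric_sum_le (x : R) (L : nat) : 0 < x < 1 ->
  \sum_(l < L.+1) x ^+ l <= (1 - x)^-1.
Proof.
move=> /andP[x0 x1]; have x10 : 0 < 1 - x by rewrite subr_gt0.
rewrite -[leRHS]mul1r ler_pdivlMr// mulrC -opprB mulNr -subrX1 opprB lerBlDr.
by rewrite lerDl exprn_ge0// ltW.
Qed.

Lemma sum_expr2 (L : nat) : \sum_(l < L.+1) 2 ^+ l <= 2 * 2 ^+ L :> R.
Proof.
have -> : \sum_(l < L.+1) 2 ^+ l = 2 ^+ L.+1 - 1 :> R.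
  by rewrite subrX1 -[2 - 1 in RHS]/(2 - 1) [2 - 1](_ : _ = 1) ?mul1r//; ring.
by rewrite exprS; lra.
Qed.

(** Take the least L with B <= 2^L: minimality gives 2^L < 2B if L > 0, and the summand 1 covers L =
    0. *)
Lemma last_level_exists (B : R) : exists L : nat,
  B <= 2 ^+ L /\ 2 ^+ L <= 2 * `|B| + 1.
Proof.
have ex : exists n, B <= 2 ^+ n :> R.
  exists (Num.truncn B).+1; apply: (@le_trans _ _ (Num.truncn B).+1%:R).
    exact/ltW/truncnS_gt.
  by rewrite -natrX ler_nat ltnW// ltn_expl.
case: (ex_minnP ex) => L LB Lmin; exists L; split => //.
case: L LB Lmin => [|L] LB Lmin; first by rewrite expr0 lerDr mulr_ge0.
have : 2 ^+ L < B by rewrite ltNge; apply/negP => /Lmin; rewrite ltnn.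
have := ler_norm B; rewrite exprS; lra.
Qed.

(* The standard choice of the numbers of samples, proportional to
   sqrt (V_l / cost_l); S stands for the sum of the lam^l. *)
Lemma mlmc_complexity (V b : nat -> R) (C1 CB lam : R) :
  0 < C1 -> 0 < CB -> 0 < lam <= 1 ->
  (forall l, V l <= C1 * 2 ^- l * lam ^+ (l + l)) ->
  (forall l, b l ^+ 2 <= CB * 2 ^- l) ->
  exists c : R, 0 < c /\ forall e : R, 0 < e < expR (-1) ->
    exists (L : nat) (N : nat -> nat),
      [/\ forall l, (0 < N l)%N,
          b L ^+ 2 + \sum_(l < L.+1) V l / (N l)%:R <= e ^+ 2,
          lam < 1 -> (mlmc_cost L N)%:R <= c * e ^- 2 &
          (mlmc_cost L N)%:R <= c * e ^- 2 * ln e^-1 ^+ 2].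
Proof.
move=> C10 CB0 /andP[l0 l1] VC bC.
pose C3 := (ln (4 * CB + 1) + 2) / ln 2 + 1 : R.
(* One summand per source of cost: S <= 1/(1 - lam) when lam < 1 (for lam = 1 the summand is 0), S
   <= L + 1 <= C3 ln(1/e) in general, and rounding up the N_l, which costs at most 2 * 2^L. C3 comes
   from L ln 2 <= ln(4 CB + 1) + 2 ln(1/e) together with ln(1/e) >= 1. *)
pose c := 2 * C1 * (1 - lam)^-1 ^+ 2 + 2 * C1 * C3 ^+ 2 + 2 * (4 * CB + 1).
have c3 : 0 < 2 * (4 * CB + 1) by rewrite mulr_gt0// addr_gt0// mulr_gt0.
have cA : 0 <= 2 * C1 * (1 - lam)^-1 ^+ 2 by rewrite mulr_ge0 ?sqr_ge0// mulr_ge0// ltW.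
have cB : 0 <= 2 * C1 * C3 ^+ 2 by rewrite mulr_ge0 ?sqr_ge0// mulr_ge0// ltW.
exists c; split; first by rewrite /c; lra.
move=> e /andP[e0 e1].
have einv : expR 1 < e^-1 by rewrite -[expR 1]invrK -expRN ltf_pV2 ?posrE ?expR_gt0.
have Lam1 : 1 <= ln e^-1.
  by rewrite -[leLHS](expRK 1) ler_ln ?posrE ?expR_gt0 ?invr_gt0// ltW.
have e21 : 1 <= e ^- 2.
  have : 1 <= e^-1 by apply: le_trans (ltW einv); rewrite -expR0 ler_expR.
  by rewrite -exprVn expr2 => h; nra.
have e20 : 0 < e ^- 2 by exact: lt_le_trans e21.
(* This level makes the squared bias at most e^2 / 2; the other half of e^2 is left to the
   variances. *)
have [L [LB LU]] := last_level_exists (2 * CB * e ^- 2).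
have BL : 0 <= 2 * CB * e ^- 2 by rewrite !mulr_ge0// ltW.
rewrite (ger0_norm BL) in LU.
have LU' : 2 ^+ L <= (4 * CB + 1) * e ^- 2 by rewrite mulrDl mul1r; lra.
pose S : R := \sum_(l < L.+1) lam ^+ l.
have lx l : 0 < lam ^+ l by rewrite exprn_gt0.
have S1 : 1 <= S.
  by rewrite /S big_ord_recl expr0 lerDl sumr_ge0// => i _; exact/ltW.
have S0 : 0 < S by exact: lt_le_trans S1.
(* Since V_l <= C1 2^(-l) lam^(2l), this gives V_l / a_l <= e^2 lam^l / (2S), which sums to e^2 / 2,
   while the costs 2^l a_l sum to 2 C1 S^2 / e^2. *)
pose a l : R := 2 * C1 * S * e ^- 2 * 2 ^- l * lam ^+ l.
have p2 l : 0 < 2 ^- l :> R by rewrite invr_gt0 exprn_gt0.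
have a0 l : 0 < a l by rewrite !mulr_gt0.
pose N l := (Num.truncn (a l)).+1.
have Na l : a l <= (N l)%:R by exact/ltW/truncnS_gt.
have NU l : (N l)%:R <= a l + 1.
  by rewrite /N -natr1 lerD2r truncn_le// ltW.
exists L, N.
have cost : (mlmc_cost L N)%:R <= 2 * C1 * e ^- 2 * S ^+ 2 + 2 * 2 ^+ L.
  rewrite /mlmc_cost natr_sum.
  apply: (@le_trans _ _ (\sum_(l < L.+1) (2 * C1 * S * e ^- 2 * lam ^+ l + 2 ^+ l))).
    apply: ler_sum => l _; rewrite natrM natrX.
    apply: (le_trans (ler_wpM2l _ (NU l))); first by rewrite exprn_ge0.
    rewrite mulrDr mulr1 lerD2r /a le_eqVlt; apply/orP; left; apply/eqP.
    have pN : 2 ^+ l != 0 :> R by rewrite gt_eqF// exprn_gt0.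
    by move: (e ^- 2) => q; field.
  rewrite big_split/= -mulr_sumr -/S; apply: lerD; last exact: sum_expr2.
  by rewrite le_eqVlt; apply/orP; left; apply/eqP; ring.
have costS T : S <= T -> (mlmc_cost L N)%:R <=
    (2 * C1 * T ^+ 2 + 2 * (4 * CB + 1)) * e ^- 2.
  move=> ST; apply: (le_trans cost).
  have h1 : S ^+ 2 <= T ^+ 2 by rewrite ler_sqr ?nnegrE ?(ltW S0)// (le_trans (ltW S0)).
  rewrite [leRHS]mulrDl; apply: lerD; last by lra.
  rewrite mulrAC ler_wpM2r ?(ltW e20)//; apply: ler_wpM2l => //.
  by apply: mulr_ge0 => //; exact: ltW.
split.
- by [].
- have H1 : b L ^+ 2 <= e ^+ 2 / 2.
    apply: (le_trans (bC L)).
    have e2p : 0 < e ^+ 2 by rewrite exprn_gt0.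
    rewrite ler_pdivrMr ?exprn_gt0//.
    have := ler_wpM2l (ltW e2p) LB.
    rewrite mulrCA mulfV ?gt_eqF//; lra.
  have H2 : \sum_(l < L.+1) V l / (N l)%:R <= e ^+ 2 / 2.
    apply: (@le_trans _ _ (\sum_(l < L.+1) (e ^+ 2 / (2 * S)) * lam ^+ l)).
      apply: ler_sum => l _.
      have N0 : 0 < (N l)%:R :> R by rewrite ltr0n.
      rewrite ler_pdivrMr//; apply: (le_trans (VC l)).
      apply: (@le_trans _ _ (e ^+ 2 / (2 * S) * lam ^+ l * a l)); last first.
        by rewrite ler_wpM2l// mulr_ge0 ?(ltW (lx _))// divr_ge0 ?sqr_ge0// mulr_ge0// ltW.
      rewrite /a exprD le_eqVlt; apply/orP; left; apply/eqP.
      have eN : e != 0 by rewrite gt_eqF.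
      have SN : S != 0 by rewrite gt_eqF.
      have pN : 2 ^+ l != 0 :> R by rewrite gt_eqF// exprn_gt0.
      by field; rewrite eN SN pN.
    rewrite -mulr_sumr -/S le_eqVlt; apply/orP; left; apply/eqP.
    by field; rewrite gt_eqF.
  by rewrite [leRHS]splitr; exact: lerD.
- move=> ll; have l01 : 0 < lam < 1 by rewrite l0 ll.
  apply: (le_trans (costS _ (geometric_sum_le L l01))).
  by rewrite ler_wpM2r ?(ltW e20)// /c; lra.
have ln2 : 0 < ln 2 :> R by rewrite ln_gt0// ltr1n.
have LL : L%:R * ln 2 <= ln (4 * CB + 1) + 2 * ln e^-1.
  have q0 : 0 < 4 * CB + 1 by lra.
  have : ln (2 ^+ L) <= ln ((4 * CB + 1) * e ^- 2).
    by rewrite ler_ln ?posrE ?exprn_gt0// mulr_gt0.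
  rewrite lnXn// lnM ?posrE// -exprVn lnXn ?invr_gt0//.
  by rewrite -(mulr_natl (ln 2) L) -(mulr_natl (ln e^-1) 2).
have lnC : 0 <= ln (4 * CB + 1) by rewrite ln_ge0// lerDr mulr_ge0// ltW.
have SL : S <= C3 * ln e^-1.
  apply: (@le_trans _ _ (L%:R + 1)).
    rewrite natr1 -[L.+1 in leRHS]card_ord -sum1_card natr_sum /S.
    by apply: ler_sum => l _; rewrite exprn_ile1// ltW.
  have h1 : ln (4 * CB + 1) <= ln (4 * CB + 1) * ln e^-1 by rewrite ler_peMr.
  have h2 : L%:R <= (ln (4 * CB + 1) + 2) / ln 2 * ln e^-1.
    rewrite mulrAC ler_pdivlMr//; apply: (le_trans LL); lra.
  rewrite /C3; lra.
apply: (le_trans (costS _ SL)).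
have Lam2 : 1 <= ln e^-1 ^+ 2 by rewrite expr_ge1 ?(le_trans _ Lam1).
set X := ln e^-1 ^+ 2 in Lam2 *.
rewrite [leRHS]mulrAC; apply: ler_wpM2r; first exact: ltW.
rewrite exprMn -/X.
have hA : 0 <= 2 * C1 * (1 - lam)^-1 ^+ 2 * X by rewrite mulr_ge0// (le_trans ler01).
have h3 : 2 * (4 * CB + 1) <= 2 * (4 * CB + 1) * X by rewrite ler_peMr// ltW.
have -> : c * X = 2 * C1 * (1 - lam)^-1 ^+ 2 * X +
    2 * C1 * (C3 ^+ 2 * X) + 2 * (4 * CB + 1) * X.
  by rewrite /c; ring.
lra.
Qed.

End complexity.

Section level_means.
Context {disp : measure_display} {Om : measurableType disp} {R : realType}
  (P : probability Om R) {s t : nat} {D : finType}.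
Variables (d0 : D) (f : D -> 'rV[R]_s -> R).
Hypothesis mf : forall d, measurable_fun [set: 'rV[R]_s] (f d).
Variables (F : R) (fF : forall d u, `|f d u| <= F).
Variables (theta : {RV P >-> 'rV[R]_s}).
Variables (h : 'rV[R]_s -> 'rV[R]_t) (mh : measurable_fun [set: 'rV[R]_s] h).
Variables (rho : 'rV[R]_t -> R) (noise : {RV P >-> 'rV[R]_t}).
Hypothesis noise_rho : has_density P noise rho.
Variables (M0 : nat) (M0_gt0 : (0 < M0)%N).

Variables (Ys : nat -> {RV P >-> 'rV[R]_t}) (ths : nat -> nat -> {RV P >-> 'rV[R]_s}).
Hypothesis Ys_law : forall l, same_law P (Ys l) (obs h theta noise).
Hypothesis ths_law : forall l m, (m < Mlev M0 l)%N -> same_law P (ths l m) theta.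
Hypothesis draws_indep : forall l,
  mutually_independent P (fun i : option 'I_(Mlev M0 l) =>
    if i is Some m then sigma_of (ths l m) else sigma_of (Ys l)).

Let regret l := \int[P]_w block_regret d0 f h rho (Ys l) (ths l) 0 (Mlev M0 l) w.

Lemma DeltaP_mean_succ k :
  \int[P]_w DeltaP d0 f h rho M0 k.+1 (Ys k.+1 w) (fun m => ths k.+1 m w) =
  regret k.+1 - regret k.
Proof.
under eq_Rintegral do rewrite DeltaP_block_regret.
have M_gt0 l : (0 < Mlev M0 l)%N := Mlev_gt0 M0_gt0 l.
have ib a b : (a < b)%N -> P.-integrable setT
    (EFin \o block_regret d0 f h rho (Ys k.+1) (ths k.+1) a b).
  exact: (integrable_block_regret d0 mf fF mh noise_rho).
have MM : (Mlev M0 k < Mlev M0 k.+1)%N.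
  by rewrite MlevS -[X in (X < _)%N]addn0 ltn_add2l.
have i1 := ib _ _ (M_gt0 k.+1); have i2 := ib _ _ (M_gt0 k); have i3 := ib _ _ MM.
have i23 : P.-integrable setT (EFin \o (fun w =>
    block_regret d0 f h rho (Ys k.+1) (ths k.+1) 0 (Mlev M0 k) w +
    block_regret d0 f h rho (Ys k.+1) (ths k.+1) (Mlev M0 k) (Mlev M0 k.+1) w)).
  exact: (integrableD measurableT i2 i3).
rewrite RintegralB//; last first.
  rewrite (_ : _ \o _ = (fun w => (2^-1)%:E *
    (block_regret d0 f h rho (Ys k.+1) (ths k.+1) 0 (Mlev M0 k) w +
    block_regret d0 f h rho (Ys k.+1) (ths k.+1) (Mlev M0 k) (Mlev M0 k.+1) w)%R%:E)%E)//.
  exact: integrableZl.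
rewrite RintegralZl// RintegralD//.
have law a : (a + Mlev M0 k <= Mlev M0 k.+1)%N ->
    \int[P]_w block_regret d0 f h rho (Ys k.+1) (ths k.+1) a (a + Mlev M0 k) w = regret k.
  move=> aM; rewrite /regret -[X in block_regret _ _ _ _ (Ys k) _ 0 X]add0n.
  apply: (@block_regret_law _ _ _ P _ _ _ d0 f mf h mh rho noise noise_rho
    (Ys k.+1) (ths k.+1) (Mlev M0 k.+1) a (Ys k) (ths k) (Mlev M0 k) 0 (Mlev M0 k)) => //.
    by move=> A mA; rewrite (Ys_law k.+1 mA) (Ys_law k mA).
  by move=> i j ik jk A mA; rewrite (ths_law ik mA) (ths_law jk mA).
have := law 0%N; have := law (Mlev M0 k); rewrite add0n -MlevS => -> // -> //.
  by congr (_ - _); field.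
exact: ltnW.
Qed.

Lemma DeltaP_mean_sum L :
  \sum_(l < L.+1) \int[P]_w DeltaP d0 f h rho M0 l (Ys l w) (fun m => ths l m w) =
  regret L.
Proof.
elim: L => [|L IH]; first by rewrite big_ord1.
by rewrite big_ord_recr/= IH DeltaP_mean_succ addrC subrK.
Qed.

End level_means.

Section mean_square_error.
Context {d : measure_display} {Om : measurableType d} {R : realType}
  (P : probability Om R).
Variables (DP : nat -> nat -> {RV P >-> R}) (m V : nat -> R) (L : nat) (N : nat -> nat).
Hypotheses (DP_sq : forall l n, sq_integrable P (DP l n))
  (DP_mean : forall l n, \int[P]_w DP l n w = m l)
  (DP_moment : forall l n, \int[P]_w DP l n w ^+ 2 = V l)
  (DP_indep : mutually_independent P (fun i : nat * nat => sigma_of (DP i.1 i.2)))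
  (N_gt0 : forall l, (0 < N l)%N).

Lemma mlmc_mse T :
  sq_integrable P (fun w => Zmlmc DP L N w - T) /\
  \int[P]_w (Zmlmc DP L N w - T) ^+ 2 <=
    (\sum_(l < L.+1) m l - T) ^+ 2 + \sum_(l < L.+1) V l / (N l)%:R.
Proof.
pose prs := [seq (l, n) | l <- index_iota 0 L.+1, n <- index_iota 0 (N l)].
(* The bias joins the family as the constant variable 1 with coefficient b. It is uncorrelated with
   the centred variables, so the mean square error is a single Pythagorean sum. *)
pose ix := None :: [seq Some i | i <- prs].
pose x (i : option (nat * nat)) w : R :=
  if i is Some (l, n) then DP l n w - \int[P]_w' DP l n w' else 1.
pose b := \sum_(l < L.+1) m l - T.
pose a (i : option (nat * nat)) : R := if i is Some (l, n) then (N l)%:R^-1 else b.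
have sumE (G : option (nat * nat) -> R) : \sum_(i <- ix) G i =
    G None + \sum_(l < L.+1) \sum_(n < N l) G (Some (l : nat, n : nat)).
  rewrite big_cons big_map big_allpairs_dep big_mkord; congr (_ + _).
  by apply: eq_bigr => l _; rewrite big_mkord.
have sx i : sq_integrable P (x i).
  case: i => [[l n]|]; last exact: sq_integrable_cst.
  exact: (sq_integrableD (DP_sq l n) (sq_integrable_cst P (- _))).
have x0 l n : \int[P]_w x (Some (l, n)) w = 0.
  rewrite /x RintegralB//; last exact: integrable_cstR.
    by rewrite Rintegral_cstT subrr.
  exact: sq_integrable_integrable.
have uix : uniq ix.
  rewrite /ix cons_uniq map_inj_uniq; last by move=> ? ? [].
  apply/andP; split; first by apply/mapP => -[].
  apply: allpairs_uniq_dep; first exact: iota_uniq.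
    by move=> l _; exact: iota_uniq.
  by move=> [? ?] [? ?] _ _ /= [-> ->].
have ux i j : i \in ix -> j \in ix -> i != j -> \int[P]_w (x i w * x j w) = 0.
  move=> _ _; case: i => [[l n]|]; case: j => [[l' n']|] // ij.
  - apply: indep_centered_mul => // A B mA mB.
    apply: (mutual_indep_pair DP_indep (i := (l, n)) (j := (l', n'))) => /=.
    + by apply: contra ij => /eqP ->.
    + by exists A => //; rewrite setTI.
    + by exists B => //; rewrite setTI.
  - by under eq_Rintegral do rewrite mulr1; exact: x0.
  - by under eq_Rintegral do rewrite mul1r; exact: x0.
have NN l : (N l)%:R != 0 :> R by rewrite pnatr_eq0 -lt0n.
have ZE w : \sum_(i <- ix) a i * x i w = Zmlmc DP L N w - T.
  rewrite sumE /a /x mulr1 /b addrAC; congr (_ - _).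
  rewrite -big_split/=; apply: eq_bigr => l _.
  under eq_bigr do rewrite DP_mean.
  rewrite -mulr_sumr sumrB sumr_const card_ord mulrBr -[m l *+ _]mulr_natl mulKf//.
  by rewrite addrC subrK.
have [sS IS] := Rintegral_sqr_uncorrelated a uix (fun i _ => sx i) ux.
have ZE' : (fun w => \sum_(i <- ix) a i * x i w) = (fun w => Zmlmc DP L N w - T).
  exact/funext.
split; first by rewrite -ZE'.
under eq_Rintegral do rewrite -ZE.
rewrite IS sumE /a /x.
under [X in _ * X]eq_Rintegral do rewrite expr1n.
rewrite Rintegral_cstT mulr1 lerD2l; apply: ler_sum => l _.
apply: (@le_trans _ _ (\sum_(n < N l) (N l)%:R^-1 ^+ 2 * V l)).
  apply: ler_sum => n _; apply: ler_wpM2l; first exact: sqr_ge0.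
  by rewrite -(DP_moment l n); exact: centered_sqr_le.
rewrite sumr_const card_ord -mulr_natl le_eqVlt; apply/orP; left; apply/eqP.
by field.
Qed.

End mean_square_error.

Theorem mainTheorem2 (R : realType) (disp : measure_display)
  (Om : measurableType disp) (P : probability Om R) (s t : nat)
  (* the decision problem *)
  (D : finType) (d0 : D) (f : D -> 'rV[R]_s -> R)
  (mf : forall d, measurable_fun [set: 'rV[R]_s] (f d))
  (* the observation model Y = h(theta) + noise *)
  (pi0 : 'rV[R]_s -> R) (theta : {RV P >-> 'rV[R]_s})
  (theta_pi0 : has_density P theta pi0)
  (h : 'rV[R]_s -> 'rV[R]_t) (mh : measurable_fun [set: 'rV[R]_s] h)
  (rho : 'rV[R]_t -> R) (noise : {RV P >-> 'rV[R]_t})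
  (noise_rho : has_density P noise rho)
  (noise_mean : zero_mean P noise)
  (noise_indep : independent_RV P theta noise)
  (* the norm, and the decision manifold K *)
  (Nm : 'rV[R]_t -> R) (Nm_norm : is_norm Nm)
  (K : set 'rV[R]_t) (defK : K = decision_manifold P f h rho theta)
  (K_null : (lebesgue_rV R t).-negligible K)
  (* the draws used for one sample of each DeltaP_l *)
  (M0 : nat) (M0_gt0 : (0 < M0)%N)
  (Ys : nat -> {RV P >-> 'rV[R]_t}) (ths : nat -> nat -> {RV P >-> 'rV[R]_s})
  (Ys_law : forall l, same_law P (Ys l) (obs h theta noise))
  (ths_law : forall l m, (m < Mlev M0 l)%N -> same_law P (ths l m) theta)
  (draws_indep : forall l,
    mutually_independent P (fun i : option 'I_(Mlev M0 l) =>
      if i is Some m then sigma_of (ths l m) else sigma_of (Ys l)))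
  (* the i.i.d. copies DP l n of DeltaP_l, independent across levels *)
  (DP : nat -> nat -> {RV P >-> R})
  (DP_law : forall l n, same_law P (DP l n)
    (fun w => DeltaP d0 f h rho M0 l (Ys l w) (fun m => ths l m w)))
  (DP_indep : mutually_independent P (fun i : nat * nat =>
    sigma_of (DP i.1 i.2)))
  (* assumption (1) *)
  (Fmax : R) (Fmax_gt0 : 0 < Fmax) (f_bounded : forall d x, `|f d x| <= Fmax)
  (* assumption (2) *)
  (c0 : R) (c0_gt0 : 0 < c0)
  (K_small : forall r : R, 0 < r < 1 ->
    (P [set w | (dist_to Nm K (obs h theta noise w) <= r%:E)%E]
       <= (c0 * r)%:E)%E)
  (* assumption (3) *)
  (c1 c2 : R) (c1_gt0 : 0 < c1) (c2_gt0 : 0 < c2)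
  (gap_large : forall y dopt, Ydomain P h rho theta y -> ~ K y ->
    is_dopt P f h rho theta y dopt ->
    (mine c1%:E (c2%:E * dist_to Nm K y)
       < decision_gap P d0 f h rho theta y dopt)%E)
  (* assumption (4) *)
  (p : R) (p_ge2 : 2 <= p)
  (ratio_moment :
    (\int[P]_w \int[P]_w'
       ((lik h rho (obs h theta noise w) (theta w') /
         rhoY P h rho theta (obs h theta noise w)) `^ p)%:E < +oo)%E) :
  exists c : R, 0 < c /\
    forall e : R, 0 < e < expR (-1) ->
      exists (L : nat) (N : nat -> nat),
        [/\ forall l, (l <= L)%N -> (0 < N l)%N,
            ('E_P[fun w => ((Zmlmc DP L N w -
                 (EVPI P d0 f theta - EVSI P d0 f h rho pi0 theta noise)) ^+ 2)%R]
               <= (e ^+ 2)%:E)%E,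
            2 < p -> (mlmc_cost L N)%:R <= c * e ^- 2 &
            p = 2 -> (mlmc_cost L N)%:R <= c * e ^- 2 * ln e^-1 ^+ 2].
Proof.
have rho0 x : 0 <= rho x by case: noise_rho.
(* powR_add_le needs moments of order at most 3. *)
pose e := Num.min p 3 - 2.
have e0 : 0 <= e by rewrite subr_ge0 le_min p_ge2/=; lra.
have e1 : e <= 1 by rewrite lerBlDr (_ : 1 + 2 = 3) ?ge_min ?lexx ?orbT//; ring.
have ep : 2 + e <= p by rewrite /e addrC subrK ge_min lexx.
have e01 : 0 <= e <= 1 by rewrite e0 e1.
set ratio_int := (X in (X < +oo)%E) in ratio_moment.
pose A := fine ratio_int.
have A_moment : (\int[P]_w \int[P]_w'
    (lratio theta h rho (obs h theta noise w) (theta w') `^ p)%:E <= A%:E)%E.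
  rewrite /A fineK// ge0_fin_numE//; apply: integral_ge0 => w _.
  by apply: integral_ge0 => w' _; rewrite lee_fin powR_ge0.
pose Cb := block_const (D := D) Fmax p e A.
have Cb0 : 0 <= Cb by exact: (block_const_ge0 Fmax e A_moment).
pose vc := variance_const (D := D) Fmax c0 c1 c2 p e A.
pose DPl l w := DeltaP d0 f h rho M0 l (Ys l w) (fun m => ths l m w).
pose V l := \int[P]_w DPl l w ^+ 2.
pose m l := \int[P]_w DPl l w.
pose T := EVPI P d0 f theta - EVSI P d0 f h rho pi0 theta noise.
pose b L := \sum_(l < L.+1) m l - T.
have mDPl l : measurable_fun setT (DPl l).
  exact: (measurable_DeltaP d0 mf mh noise_rho).
have DPlF l w : `|DPl l w| <= 4 * Fmax.
  exact: (DeltaP_bounded d0 h rho0 M0_gt0 f_bounded).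
have F0 : 0 <= Fmax by exact: ltW.
have DPl_sqr l w : DPl l w ^+ 2 <= (4 * Fmax) ^+ 2.
  by rewrite -real_normK ?num_real// ler_sqr ?nnegrE ?mulr_ge0.
have iDPl l : P.-integrable setT (EFin \o (fun w => DPl l w ^+ 2)).
  apply: (@integrable_bounded _ _ _ P _ ((4 * Fmax) ^+ 2)).
    exact: measurable_funX.
  by move=> w; rewrite ger0_norm ?sqr_ge0.
have DP_moment l n : \int[P]_w DP l n w ^+ 2 = V l.
  rewrite /Rintegral; congr fine.
  apply: (@same_law_integral _ _ _ P _ _ (DP l n) (DPl l) (fun x => (x ^+ 2)%:E)) => //.
  by apply/measurable_EFinP; exact: measurable_funX.
have DP_mean l n : \int[P]_w DP l n w = m l.
  rewrite /Rintegral; congr fine.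
  by apply: (@same_law_integral _ _ _ P _ _ (DP l n) (DPl l) EFin).
have DP_sq l n : sq_integrable P (DP l n).
  split => //.
  apply: (@same_law_integrable _ _ _ P _ _ (DPl l) (DP l n) (fun x => (x ^+ 2)%:E)) => //.
  - by move=> B mB; exact/esym/DP_law.
  - by apply/measurable_EFinP; exact: measurable_funX.
  - exact: iDPl.
have Mlev_ge l : 2 ^+ l <= (Mlev M0 l)%:R :> R.
  by rewrite -natrX ler_nat /Mlev leq_pmull.
(* Chosen so that lam^(2l) = 2^(-l e / 16), the decay of the variance beyond 2^(-l). It equals 1
   exactly when e = 0, that is when p = 2. *)
pose lam : R := 2 `^ (- (e / 32)).
have lam0 : 0 < lam by rewrite powR_gt0.
have lam1 : lam <= 1.
  by rewrite -[leRHS](powRr0 2) ler_powR ?ler1n// oppr_le0 divr_ge0.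
have lamE l : (2 ^+ l) `^ (- (1 + e / 16)) = 2 ^- l * lam ^+ (l + l) :> R.
  rewrite -(powR_mulrn (l + l) (ltW lam0)) -(powR_mulrn l (ler0n R 2)) -powRN -!powRrM.
  rewrite -powRD; last by apply/implyP => _; rewrite pnatr_eq0.
  by congr (_ `^ _); rewrite natrD; field.
(* 16 Fmax^2 bounds level 0. The variance of level k + 1 is bounded in terms of M_k, and passing
   from k to k + 1 loses 2 / lam^2 <= 4, whence the factor 4. *)
pose C1 := 4 * `|vc| + 16 * Fmax ^+ 2.
have C10 : 0 < C1.
  by rewrite ltr_wpDl ?mulr_ge0// mulr_gt0// exprn_gt0.
have VC l : V l <= C1 * 2 ^- l * lam ^+ (l + l).
  case: l => [|k].
    rewrite expr0 invr1 !mulr1.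
    apply: (@le_trans _ _ ((4 * Fmax) ^+ 2)).
      rewrite -[leRHS](Rintegral_cstT P); apply: le_Rintegral => //.
      exact: integrable_cstR.
    by rewrite exprMn /C1 (_ : 4 ^+ 2 = 16) ?lerDr ?mulr_ge0//; ring.
  have Vk : V k.+1 <= `|vc| * (2 ^- k * lam ^+ (k + k)).
    rewrite -lee_fin EFin_Rintegral//.
    apply: (le_trans (DeltaP_variance mf f_bounded mh noise_rho noise_indep Nm_norm
      defK c0_gt0 c1_gt0 c2_gt0 K_small gap_large M0_gt0 e01 ep A_moment (Ys_law k.+1)
      (ths_law k.+1) (draws_indep k.+1))).
    rewrite lee_fin; apply: (le_trans (ler_wpM2r (powR_ge0 _ _) (ler_norm _))).
    rewrite -lamE; apply: ler_wpM2l => //.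
    by apply: powRN_anti; rewrite ?exprn_gt0// addr_ge0// divr_ge0.
  apply: (le_trans Vk).
  have lam2 : 2^-1 <= lam ^+ 2.
    rewrite -(powR_mulrn 2 (ltW lam0)) -powRrM -[leLHS](powR_inv1 (ler0n R 2)).
    apply: ler_powR; first by rewrite ler1n.
    lra.
  have q0 : 0 <= 2 ^- k * lam ^+ (k + k) by rewrite mulr_ge0 ?invr_ge0 ?exprn_ge0// ltW.
  have -> : C1 * 2 ^- k.+1 * lam ^+ (k.+1 + k.+1) =
      C1 * 2^-1 * lam ^+ 2 * (2 ^- k * lam ^+ (k + k)).
    by rewrite addSn addnS !exprS invfM; ring.
  apply: ler_wpM2r => //; apply: (@le_trans _ _ (C1 * 2^-1 * 2^-1)).
    by rewrite /C1; have := sqr_ge0 Fmax; lra.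
  by apply: ler_wpM2l => //; exact: divr_ge0 (ltW C10) _.
pose CB := (2 * (2 + Cb)) ^+ 2.
have CB0 : 0 < CB by rewrite exprn_gt0// mulr_gt0// ltr_wpDr.
have bC L : b L ^+ 2 <= CB * 2 ^- L.
  rewrite /b (DeltaP_mean_sum d0 mf f_bounded mh noise_rho M0_gt0 Ys_law ths_law draws_indep).
  rewrite /T (EVPI_sub_EVSI d0 mf f_bounded mh noise_rho noise_indep theta_pi0).
  have := block_regret_bias d0 mf f_bounded mh noise_rho noise_indep (Mlev_gt0 M0_gt0 L)
    e01 ep A_moment (Ys_law L) (ths_law L) (draws_indep L).
  rewrite -/Cb; set bL := _ - _ => bLle.
  have ML : (Mlev M0 L)%:R `^ (- 2^-1) <= (2 ^+ L) `^ (- 2^-1) :> R.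
    by apply: powRN_anti; rewrite ?exprn_gt0.
  have q0 : 0 <= 2 * (2 + Cb) by rewrite mulr_ge0// addr_ge0.
  have {}bLle := le_trans bLle (ler_wpM2l q0 ML).
  have -> : CB * 2 ^- L = (2 * (2 + Cb) * (2 ^+ L) `^ (- 2^-1)) ^+ 2.
    rewrite exprMn -/CB -(powR_mulrn 2 (powR_ge0 _ _)) -powRrM.
    by rewrite mulNr mulVf// powR_inv1// exprn_ge0.
  by rewrite -[leLHS]real_normK ?num_real// ler_sqr ?nnegrE// (le_trans _ bLle).
have l01 : 0 < lam <= 1 by rewrite lam0 lam1.
have [c [c_gt0 Hc]] := mlmc_complexity C10 CB0 l01 VC bC.
exists c; split=> // eps eps01; have [L [N [N0 err cost1 cost2]]] := Hc eps eps01.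
exists L, N; split => //.
- have [sZ mse] := mlmc_mse L DP_sq DP_mean DP_moment DP_indep N0 T.
  rewrite unlock -EFin_Rintegral; last by case: sZ.
  by rewrite lee_fin (le_trans mse).
- move=> p2; apply: cost1; rewrite /lam powRN invf_lt1 ?powR_gt0//.
  have e3 : 0 < e / 32 by rewrite divr_gt0// subr_gt0 lt_min p2/=; lra.
  have := gt0_ltr_powR e3 (_ : 1 \in Num.nneg) (_ : 2 \in Num.nneg) (_ : 1 < 2 :> R).
  by rewrite powR1 !nnegrE ler01 ler0n ltr1n; exact.
Qed.
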